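(* Let $\Theta=\tilde p/p$ be a rational inner function on $\mathbb{D}^2$ of degree $(m,n)$, and let $\mathcal{K}_\Theta=\mathcal{S}_1\oplus\mathcal{S}_2$ be an orthogonal decomposition into closed subspaces with $\mathcal{S}_1$ invariant under $M_{z_1}$ and $\mathcal{S}_2$ invariant under $M_{z_2}$. Let $K_1,K_2$ be the reproducing kernels with $\mathcal{H}(K_1)=\mathcal{S}_1\ominus z_1\mathcal{S}_1$ and $\mathcal{H}(K_2)=\mathcal{S}_2\ominus z_2\mathcal{S}_2$. Let $E_\Theta=\{\tau\in\mathbb{T}:\exists\,\tau_1\in\mathbb{T}\text{ with }p(\tau_1,\tau)=0\}$. Then for every $\tau\in\mathbb{T}\setminus E_\Theta$, the slice function $\Theta_\tau:=\Theta(\cdot,\tau)$ is a Blaschke product of degree $m$, and the restriction map $\mathcal{J}_\tau:\mathcal{H}(K_2)\to\mathcal{K}_{\Theta_\tau}$, $\mathcal{J}_\tau f=f(\cdot,\tau)$, is well defined and unitary. Furthermore $\dim\mathcal{H}(K_2)=m$. The analogous statements hold for $\mathcal{H}(K_1)$: with $E'_\Theta=\{\tau\in\mathbb{T}:\exists\,\tau_2\in\mathbb{T}\text{ with }p(\tau,\tau_2)=0\}$, for every $\tau\in\mathbb{T}\setminus E'_\Theta$ the function $\Theta(\tau,\cdot)$ is a Blaschke product of degree $n$, the map $g\mapsto g(\tau,\cdot)$ is a unitary from $\mathcal{H}(K_1)$ onto the one-variable model space of $\Theta(\tau,\cdot)$, and $\dim\mathcal{H}(K_1)=n$.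
   Context: $\mathbb{D}$ is the open unit disk, $\mathbb{T}$ the unit circle, $H^2(\mathbb{D}^2)$ the Hardy space of the bidisk. A rational inner function on $\mathbb{D}^2$ is a rational function holomorphic on $\mathbb{D}^2$ with $|\Theta|=1$ a.e. on $\mathbb{T}^2$. Its degree $(m,n)$ is defined by writing $\Theta=q/p$ in lowest terms: $m$ (resp. $n$) is the highest power of $z_1$ (resp. $z_2$) appearing in $p$ or $q$. Such $\Theta$ can be written $\Theta=\tilde p/p$ with $p$ a polynomial with no zeros on $\mathbb{D}^2$, $\tilde p(z)=z_1^mz_2^n\overline{p(1/\bar z_1,1/\bar z_2)}$, and $p,\tilde p$ without common factors. The two-variable model space is $\mathcal{K}_\Theta=H^2(\mathbb{D}^2)\ominus\Theta H^2(\mathbb{D}^2)$; for a one-variable inner (Blaschke) function $B$, $\mathcal{K}_B=H^2(\mathbb{D})\ominus BH^2(\mathbb{D})$. $\mathcal{H}(K)$ denotes the reproducing kernel Hilbert space with kernel $K$. Elements of $\mathcal{H}(K_2)$ are rational functions of the form $q/p$ with $q$ a polynomial, so $f(\cdot,\tau)$ makes sense for $\tau\in\mathbb{T}\setminus E_\Theta$. *)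

(* Defs.v *)
(* Complex numbers are  R[i]  (mathcomp-real-closed
   complex.v) over an arbitrary  R : realType. *)
From mathcomp Require Import all_boot all_algebra.
From mathcomp Require Import all_classical all_reals all_analysis.
From mathcomp Require Import complex.
Set Implicit Arguments. Unset Strict Implicit. Unset Printing Implicit Defensive.
Import GRing.Theory Num.Theory.
Import numFieldNormedType.Exports.
Local Open Scope classical_set_scope.
Local Open Scope ring_scope.

Section Defs.
Variable R : realType.
Local Notation C := (R[i]).

(* ---------- points of the disk / circle ---------- *)
Definition inD (z : C) : bool := `|z| < 1.
Definition onT (z : C) : bool := `|z| == 1.

(* ---------- complex limits, via real and imaginary parts ---------- *)
Definition clim (u : nat -> C) : C :=
  Complex (limn (fun N => complex.Re (u N))) (limn (fun N => complex.Im (u N))).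

(* F r --> l as r --> 1^- (r real) *)
Definition radlim (F : R -> C) (l : C) : Prop :=
  (fun r => complex.Re (F r)) r @[r --> 1^'-] --> complex.Re l /\
  (fun r => complex.Im (F r)) r @[r --> 1^'-] --> complex.Im l.

Definition sqmod (z : C) : R := complex.Re z ^+ 2 + complex.Im z ^+ 2.

(* ---------- Hardy spaces, elements given by Taylor coefficients ---------- *)
Definition coef1 := nat -> C.
Definition coef2 := nat -> nat -> C.

Definition H2_1 (a : coef1) : Prop :=
  exists M : R, forall N, \sum_(i < N) sqmod (a i) <= M.
Definition H2_2 (a : coef2) : Prop :=
  exists M : R, forall N, \sum_(i < N) \sum_(j < N) sqmod (a i j) <= M.

Definition ip1 (a b : coef1) : C :=
  clim (fun N => \sum_(i < N) a i * (b i)^*).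
Definition ip2 (a b : coef2) : C :=
  clim (fun N => \sum_(i < N) \sum_(j < N) a i j * (b i j)^*).

(* value of the power series at a point of D, resp. D^2 *)
Definition eval1 (a : coef1) (z : C) : C :=
  clim (fun N => \sum_(i < N) a i * z ^+ i).
Definition eval2 (a : coef2) (z1 z2 : C) : C :=
  clim (fun N => \sum_(i < N) \sum_(j < N) a i j * z1 ^+ i * z2 ^+ j).

(* multiplication by z1, z2 on coefficients *)
Definition shift1 (f : coef2) : coef2 :=
  fun i j => if i is i'.+1 then f i' j else 0.
Definition shift2 (f : coef2) : coef2 :=
  fun i j => if j is j'.+1 then f i j' else 0.

(* closed (in the H^2 norm) linear subspace of H^2(D^2) *)
Definition closed_subspace2 (S : set coef2) : Prop :=
  [/\ (forall f, S f -> H2_2 f),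
      S (fun _ _ => 0),
      (forall f g, S f -> S g -> S (fun i j => f i j + g i j)),
      (forall (c : C) f, S f -> S (fun i j => c * f i j)) &
      (forall (u : nat -> coef2) f, (forall k, S (u k)) -> H2_2 f ->
         (fun k => complex.Re (ip2 (fun i j => u k i j - f i j)
                                   (fun i j => u k i j - f i j))) @ \oo --> 0 ->
         S f)].

(* ---------- bivariate polynomials: {poly {poly C}}, inner variable z1, outer z2 ---------- *)
Definition peval (p : {poly {poly C}}) (z1 z2 : C) : C := (p.[z2%:P]).[z1].

(* bidegree at most (m, n) *)
Definition bideg_le (m n : nat) (p : {poly {poly C}}) : Prop :=
  leq (size p) n.+1 /\ forall j, leq (size p`_j) m.+1.

(* reflection  ptilde(z) = z1^m z2^n conj(p(1/conj z1, 1/conj z2)) *)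
(* coefficient of z1^i z2^j *)
Definition pcoef (p : {poly {poly C}}) (i j : nat) : C := (p`_j)`_i.

Definition prefl (m n : nat) (p : {poly {poly C}}) : {poly {poly C}} :=
  \poly_(j < n.+1) \poly_(i < m.+1) (pcoef p (m - i) (n - j))^*.

(* p and q have no common (non-constant) factor in C[z1, z2] *)
Definition no_common_factor (p q : {poly {poly C}}) : Prop :=
  forall d a b : {poly {poly C}}, p = d * a -> q = d * b -> exists c : C, d = c%:P%:P.

Definition no_zeros_D2 (p : {poly {poly C}}) : Prop :=
  forall z1 z2, inD z1 -> inD z2 -> peval p z1 z2 != 0.

(* Theta = ptilde / p *)
Definition Theta (m n : nat) (p : {poly {poly C}}) (z1 z2 : C) : C :=
  peval (prefl m n p) z1 z2 / peval p z1 z2.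

(* two-variable model space  K_Theta = H^2 (-) Theta H^2 *)
Definition KTheta (m n : nat) (p : {poly {poly C}}) : set coef2 :=
  [set f | H2_2 f /\
     forall g h : coef2, H2_2 g -> H2_2 h ->
       (forall z1 z2, inD z1 -> inD z2 -> eval2 g z1 z2 = Theta m n p z1 z2 * eval2 h z1 z2) ->
       ip2 f g = 0].

(* one-variable model space  K_B = H^2 (-) B H^2 *)
Definition Kmodel1 (B : C -> C) : set coef1 :=
  [set b | H2_1 b /\
     forall g h : coef1, H2_1 g -> H2_1 h ->
       (forall z, inD z -> eval1 g z = B z * eval1 h z) ->
       ip1 b g = 0].

(* finite Blaschke product of degree d *)
Definition blaschke (B : C -> C) (d : nat) : Prop :=
  exists (c : C) (a : 'I_d -> C),
    [/\ `|c| = 1, (forall k, inD (a k)) &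
        forall z, inD z -> B z = c * \prod_(k < d) ((z - a k) / (1 - (a k)^* * z))].

(* orthogonal decomposition K = S1 (+) S2 *)
Definition orth_decomp (K S1 S2 : set coef2) : Prop :=
  [/\ S1 `<=` K, S2 `<=` K,
      (forall f g, S1 f -> S2 g -> ip2 f g = 0) &
      (forall h, K h -> exists f g, [/\ S1 f, S2 g & h = (fun i j => f i j + g i j)])].

(* S (-) z_k S *)
Definition wandering1 (S : set coef2) : set coef2 :=
  [set f | S f /\ forall g, S g -> ip2 f (shift1 g) = 0].
Definition wandering2 (S : set coef2) : set coef2 :=
  [set f | S f /\ forall g, S g -> ip2 f (shift2 g) = 0].

(* slice maps, as relations "J f = b" *)
(* J_tau f = f(., tau) : radial limit in the second variable *)
Definition slice2 (tau : C) (f : coef2) (b : coef1) : Prop :=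
  H2_1 b /\ forall z1, inD z1 ->
    radlim (fun r => eval2 f z1 (Complex r 0 * tau)) (eval1 b z1).
(* g |-> g(tau, .) : radial limit in the first variable *)
Definition slice1 (tau : C) (g : coef2) (b : coef1) : Prop :=
  H2_1 b /\ forall z2, inD z2 ->
    radlim (fun r => eval2 g (Complex r 0 * tau) z2) (eval1 b z2).

(* J is a well-defined map from H into K which is unitary onto K *)
Definition unitary_map (H : set coef2) (K : set coef1) (J : coef2 -> coef1 -> Prop) : Prop :=
  [/\ (forall f, H f -> exists b, K b /\ J f b),
      (forall f b b', H f -> J f b -> J f b' -> b = b'),
      (forall f g bf bg, H f -> H g -> J f bf -> J g bg -> ip1 bf bg = ip2 f g) &
      (forall b, K b -> exists f, H f /\ J f b)].

(* the (linear) subspace S has dimension d *)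
Definition dim_eq (S : set coef2) (d : nat) : Prop :=
  exists e : 'I_d -> coef2,
    [/\ (forall k, S (e k)),
        (forall c : 'I_d -> C,
           (fun i j => \sum_(k < d) c k * e k i j) = (fun _ _ => 0) -> forall k, c k = 0) &
        (forall f, S f -> exists c : 'I_d -> C, f = (fun i j => \sum_(k < d) c k * e k i j))].

End Defs.

(* Main.v *)
Require Import Defs.
From HB Require Import structures.
From mathcomp Require Import all_boot all_order all_algebra.
From mathcomp Require Import all_classical all_reals all_analysis.
From mathcomp Require Import complex polyXY ring lra zify.
Set Implicit Arguments. Unset Strict Implicit. Unset Printing Implicit Defensive.
Import Order.TTheory GRing.Theory Num.Theory.
Import numFieldNormedType.Exports.
Local Open Scope classical_set_scope.
Local Open Scope ring_scope.

(** Write [<.,.>] for the inner product of the Hardy space of the bidisk and [p~] for the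
    reflection of [p].  Testing [f] in K_Theta against the multiples of [p~] shows that
    [p f] has no coefficients of bidegree >= (m, n).  Invariance of S2 under z2 then gives
    deg_z1 (p f) < m for f in S2, and for f in W2 = S2 (-) z2 S2 the backward z2-shift of f
    lies in S1, whence deg_z2 (p f) <= n.  So W2 consists of fractions q/p, and an
    orthonormal family of W2 has at most m elements, because more than m polynomials of
    z1-degree < m are linearly dependent over C[z2] while the z2-shifts of the family are
    orthonormal.

    Theta acts isometrically: the form <f,g> - <Theta f, Theta g> vanishes on the ideal
    generated by p and p~, which contains a nonzero polynomial in z2 alone.  Hence K_Theta
    contains its Szego-type kernels; splitting them along S1 and S2 gives the Agler identity
      p p^* - p~ p~^* = (1 - z1 w1^* ) sum q_k q_k^* + (1 - z2 w2^* ) sum r_l r_l^*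
    where (q_k / p) is an orthonormal basis of W2.  At z2 = w2 = tau it says that the slices
    of the basis form a Parseval frame of the m-dimensional model space of Theta(., tau).
    Hence there are at least m, so exactly m of them, and they are orthonormal.  The second
    half of the theorem follows by exchanging the two variables. *)

(** * Formal power series *)

(** The obstacle is that p may vanish on the torus. Then 1/p need not be square summable, and with
    elements of the Hardy space given as coefficient arrays no boundary values of Theta are at hand.
    So Theta is a formal series, and |p~| = |p| on the torus is replaced by the coefficient identity
    <p~ F, K> = <z1^m z2^n F, p K>. For each r < 1 the dilate p_r has an inverse in the Hardy space,
    and the reflection of p_r divided by p_r has norm exactly 1. Letting r tend to 1 coefficientwise
    puts Theta in the Hardy space and gives <p~ a, Theta b> = <p a, b> for polynomials a, b; this is
    why the form vanishes on the ideal. To pass from the multiples of r(z2) in the ideal to all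
    polynomials, the roots of r are removed one at a time. At a root x, multiplying an argument of
    the form by z2 amounts to multiplying the form by x, while powers of z2 tend weakly to 0; this
    forces the form to vanish for |x| >= 1, and for |x| < 1 after shifting both arguments. The same
    r has finitely many zeros on the circle, which yields a regular tau and thus the dimension, a
    statement free of tau. *)

Definition fps (A : Type) := nat -> A.

HB.instance Definition _ (A : Type) := gen_eqMixin (fps A).
HB.instance Definition _ (A : Type) := gen_choiceMixin (fps A).

Section FpsRing.
Variable A : comNzRingType.
Implicit Types f g h : fps A.

Definition fps_add f g : fps A := fun n => f n + g n.
Definition fps_opp f : fps A := fun n => - f n.
Definition fps_mul f g : fps A := fun n => \sum_(i < n.+1) f i * g (n - i)%N.
Definition fps_one : fps A := fun n => (n == 0)%:R.

Fact fps_addA : associative fps_add.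
Proof. by move=> f g h; apply/funext => n; rewrite /fps_add addrA. Qed.
Fact fps_addC : commutative fps_add.
Proof. by move=> f g; apply/funext => n; rewrite /fps_add addrC. Qed.
Fact fps_add0 : left_id (fun _ => 0 : A) fps_add.
Proof. by move=> f; apply/funext => n; rewrite /fps_add add0r. Qed.
Fact fps_addN : left_inverse (fun _ => 0 : A) fps_opp fps_add.
Proof. by move=> f; apply/funext => n; rewrite /fps_add /fps_opp addNr. Qed.

HB.instance Definition _ := GRing.isZmodule.Build (fps A)
  fps_addA fps_addC fps_add0 fps_addN.

(** A coefficient of a product sees only finitely many coefficients of the factors, so commutativity
    and associativity are inherited from polynomials. *)
Lemma fps_mul_poly N f g n : (n < N)%N ->
  fps_mul f g n = (\poly_(i < N) f i * \poly_(i < N) g i)`_n.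
Proof.
move=> nN; rewrite coefM; apply: eq_bigr => i _; rewrite !coef_poly.
have iN : (i < N)%N by rewrite (leq_ltn_trans _ nN) // -ltnS.
by rewrite iN (leq_ltn_trans (leq_subr _ _) nN).
Qed.

Fact fps_mulC : commutative fps_mul.
Proof. by move=> f g; apply/funext => n; rewrite !(@fps_mul_poly n.+1) // mulrC. Qed.

Fact fps_mulA : associative fps_mul.
Proof.
have E f g h n : fps_mul (fps_mul f g) h n =
    (\poly_(i < n.+1) f i * \poly_(i < n.+1) g i * \poly_(i < n.+1) h i)`_n.
  rewrite coefM; apply: eq_bigr => i _.
  by rewrite (@fps_mul_poly n.+1) ?ltn_ord // !coef_poly ltnS leq_subr.
move=> f g h; apply/funext => n; rewrite E fps_mulC E.
by congr (_`_n); rewrite mulrC mulrA.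
Qed.

Fact fps_mul1 : left_id fps_one fps_mul.
Proof.
move=> f; apply/funext => n; rewrite /fps_mul big_ord_recl /= mul1r subn0.
by rewrite big1 ?addr0 // => i _; rewrite mul0r.
Qed.

Fact fps_mulD : left_distributive fps_mul fps_add.
Proof.
move=> f g h; apply/funext => n; rewrite /fps_mul /fps_add -big_split /=.
by apply: eq_bigr => i _; rewrite mulrDl.
Qed.

Fact fps_one_neq0 : fps_one != 0.
Proof.
by apply/eqP => /(congr1 (fun f => f 0%N)) /eqP; rewrite /fps_one oner_eq0.
Qed.

HB.instance Definition _ := GRing.Zmodule_isComNzRing.Build (fps A)
  fps_mulA fps_mulC fps_mul1 fps_mulD fps_one_neq0.

Lemma fpsD f g n : (f + g) n = f n + g n. Proof. by []. Qed.
Lemma fpsB f g n : (f - g) n = f n - g n. Proof. by []. Qed.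
Lemma fps1 n : (1 : fps A) n = (n == 0)%:R. Proof. by []. Qed.
Lemma fpsM f g n : (f * g) n = \sum_(i < n.+1) f i * g (n - i)%N. Proof. by []. Qed.
Lemma fps_sum (I : Type) (s : seq I) (P : pred I) (F : I -> fps A) n :
  (\sum_(i <- s | P i) F i) n = \sum_(i <- s | P i) F i n.
Proof. by elim/big_rec2: _ => //= i y1 y2 _ <-. Qed.

Definition fpsX : fps A := fun n => (n == 1)%:R.
Definition fpsC (a : A) : fps A := fun n => if n is 0 then a else 0.

Lemma fpsXM f n : (fpsX * f) n = if n is n'.+1 then f n' else 0.
Proof.
rewrite fpsM; case: n => [|n]; first by rewrite big_ord1 mul0r.
rewrite big_ord_recl mul0r add0r big_ord_recl mul1r big1 => [|i _].
  by rewrite addr0 /bump /= subSS subn0.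
by rewrite mul0r.
Qed.

Lemma fpsCM a f n : (fpsC a * f) n = a * f n.
Proof.
rewrite fpsM big_ord_recl subn0 big1 ?addr0 // => i _; exact: mul0r.
Qed.

Fact fpsC_is_additive : zmod_morphism fpsC.
Proof. by move=> a b; apply/funext => -[|n]; rewrite fpsB //= subrr. Qed.
HB.instance Definition _ := GRing.isZmodMorphism.Build A (fps A) fpsC fpsC_is_additive.
Fact fpsC_is_multiplicative : monoid_morphism fpsC.
Proof.
split; first by apply/funext => -[|n].
by move=> a b; apply/funext => -[|n]; rewrite fpsCM //= mulr0.
Qed.
HB.instance Definition _ := GRing.isMonoidMorphism.Build A (fps A) fpsC fpsC_is_multiplicative.

Lemma fpsXnM k f n : (fpsX ^+ k * f) n = if (k <= n)%N then f (n - k)%N else 0.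
Proof.
elim: k f n => [|k IH] f n; first by rewrite mul1r subn0.
rewrite exprS -mulrA fpsXM; case: n => [|n] //; exact: IH.
Qed.

(** The first n coefficients of 1/a, kept in a list because each one depends on all the earlier
    ones. The inverse [y] of the constant term is an argument, so that [A] may itself be a ring of
    series; [pol_inverse] uses this twice. *)
Fixpoint fps_inv_seq (a : fps A) (y : A) (n : nat) : seq A :=
  if n is n'.+1 then
    let s := fps_inv_seq a y n' in
    rcons s (- y * \sum_(i < n') a (n' - i)%N * nth 0 s i + y *+ (n' == 0))
  else [::].

Lemma fps_inv_exists (a : fps A) (y : A) : a 0%N * y = 1 -> exists b, a * b = 1.
Proof.
move=> ay.
have sz n : size (fps_inv_seq a y n) = n by elim: n => //= n IH; rewrite size_rcons IH.
pose b : fps A := fun n => nth 0 (fps_inv_seq a y n.+1) n.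
have nb n i : (i < n)%N -> nth 0 (fps_inv_seq a y n) i = b i.
  elim: n => // n IH; rewrite ltnS leq_eqVlt => /orP[/eqP-> //|lin].
  by rewrite /= nth_rcons sz lin IH.
exists b; rewrite mulrC; apply/funext => n.
rewrite fpsM big_ord_recr /= subnn {2}/b /= nth_rcons sz ltnn eqxx.
have -> : \sum_(i < n) a (n - i)%N * nth 0 (fps_inv_seq a y n) i =
   \sum_(i < n) b i * a (n - i)%N.
  by apply: eq_bigr => i _; rewrite nb // mulrC.
set S := (X in X + _ = _).
have -> : S + (- y * S + y *+ (n == 0%N)) * a 0%N =
  S - S * (a 0%N * y) + (a 0%N * y) *+ (n == 0%N) by ring.
by rewrite ay mulr1 subrr add0r.
Qed.

End FpsRing.

(** * Complex numbers and limits *)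

Section ComplexBasics.
Variable R : realType.
Local Notation C := (R[i]).
Implicit Types z w : C.

Definition nrm z : R := Normc.normc z.
Definition rc (x : R) : C := Complex x 0.

Lemma normE z : `|z| = rc (nrm z). Proof. by []. Qed.
Lemma ReJ z : complex.Re z^* = complex.Re z. Proof. by case: z. Qed.
Lemma ImJ z : complex.Im z^* = - complex.Im z. Proof. by case: z. Qed.
Lemma ReD z w : complex.Re (z + w) = complex.Re z + complex.Re w.
Proof. by case: z; case: w. Qed.
Lemma ImD z w : complex.Im (z + w) = complex.Im z + complex.Im w.
Proof. by case: z; case: w. Qed.
Lemma ReN z : complex.Re (- z) = - complex.Re z. Proof. by case: z. Qed.
Lemma ImN z : complex.Im (- z) = - complex.Im z. Proof. by case: z. Qed.
Lemma ReM z w : complex.Re (z * w) =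
  complex.Re z * complex.Re w - complex.Im z * complex.Im w.
Proof. by case: z; case: w. Qed.
Lemma ImM z w : complex.Im (z * w) =
  complex.Re z * complex.Im w + complex.Im z * complex.Re w.
Proof. by case: z; case: w. Qed.
Lemma complex_ext z w :
  complex.Re z = complex.Re w -> complex.Im z = complex.Im w -> z = w.
Proof. by case: z; case: w => /= ? ? ? ? -> ->. Qed.
Lemma Re_sum (I : Type) (s : seq I) (P : pred I) (F : I -> C) :
  complex.Re (\sum_(i <- s | P i) F i) = \sum_(i <- s | P i) complex.Re (F i).
Proof. by elim/big_rec2: _ => //= i y1 y2 _ <-; rewrite ReD. Qed.
Lemma Im_sum (I : Type) (s : seq I) (P : pred I) (F : I -> C) :
  complex.Im (\sum_(i <- s | P i) F i) = \sum_(i <- s | P i) complex.Im (F i).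
Proof. by elim/big_rec2: _ => //= i y1 y2 _ <-; rewrite ImD. Qed.

Lemma sqmodE z : sqmod z = nrm z ^+ 2.
Proof. by case: z => a b; rewrite /sqmod /nrm /= sqr_sqrtr // addr_ge0 // sqr_ge0. Qed.
Lemma sqmod_ge0 z : 0 <= sqmod z. Proof. by rewrite sqmodE sqr_ge0. Qed.
Lemma mulJ z : z * z^* = rc (sqmod z).
Proof. by case: z => a b; apply: complex_ext; rewrite ?ReM ?ImM /sqmod /=; ring. Qed.
Lemma rcD x y : rc (x + y) = rc x + rc y.
Proof. by apply: complex_ext; rewrite ?ReD ?ImD /= ?addr0. Qed.
Lemma rcM x y : rc (x * y) = rc x * rc y.
Proof. by apply: complex_ext; rewrite ?ReM ?ImM /=; ring. Qed.
Lemma rc_sum (I : Type) (s : seq I) (P : pred I) (F : I -> R) :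
  rc (\sum_(i <- s | P i) F i) = \sum_(i <- s | P i) rc (F i).
Proof. by elim/big_rec2: _ => //= i y1 y2 _ <-; rewrite rcD. Qed.
Lemma rcJ x : (rc x)^* = rc x.
Proof. by apply: complex_ext; rewrite /= ?oppr0. Qed.
Lemma rcX x n : rc (x ^+ n) = rc x ^+ n.
Proof. by elim: n => // n IH; rewrite !exprS rcM IH. Qed.

Lemma nrm_ge0 z : 0 <= nrm z.
Proof. by have := normr_ge0 z; rewrite normE lecE => /andP[]. Qed.
Lemma nrmM z w : nrm (z * w) = nrm z * nrm w. Proof. exact: Normc.normcM. Qed.
Lemma nrmD z w : nrm (z + w) <= nrm z + nrm w. Proof. exact: le_normcD. Qed.
Lemma nrmN z : nrm (- z) = nrm z. Proof. exact: normcN. Qed.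
Lemma nrmV z : nrm z^-1 = (nrm z)^-1. Proof. exact: Normc.normcV. Qed.
Lemma nrm0 : nrm 0 = 0. Proof. exact: Normc.normc0. Qed.
Lemma nrm1 : nrm 1 = 1. Proof. exact: Normc.normc1. Qed.
Lemma nrmX z n : nrm (z ^+ n) = nrm z ^+ n.
Proof. by elim: n => [|n IH]; rewrite ?nrm1 // !exprS nrmM IH. Qed.
Lemma nrmJ z : nrm z^* = nrm z.
Proof. by case: z => a b; rewrite /nrm /= sqrrN. Qed.
Lemma nrm_eq0 z : (nrm z == 0) = (z == 0).
Proof. by apply/eqP/eqP => [/Normc.eq0_normc|->]; rewrite ?nrm0. Qed.
Lemma nrm_gt0 z : (0 < nrm z) = (z != 0).
Proof. by rewrite lt_neqAle nrm_ge0 andbT eq_sym nrm_eq0. Qed.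
Lemma nrm_rc x : 0 <= x -> nrm (rc x) = x.
Proof. by move=> x0; rewrite /nrm /= expr0n addr0 sqrtr_sqr ger0_norm. Qed.
Lemma nrm_prod (I : Type) (s : seq I) (P : pred I) (F : I -> C) :
  nrm (\prod_(i <- s | P i) F i) = \prod_(i <- s | P i) nrm (F i).
Proof. by elim/big_rec2: _ => [|i y1 y2 _ h]; rewrite ?nrm1 // nrmM h. Qed.
Lemma nrmB_ge z w : nrm z - nrm w <= nrm (z - w).
Proof. by rewrite lerBlDr -{1}(subrK w z) nrmD. Qed.

Lemma inDE z : inD z = (nrm z < 1).
Proof. by rewrite /inD normE ltcE eqxx. Qed.
Lemma onTE z : onT z = (nrm z == 1).
Proof. by rewrite /onT normE eq_complex /= eqxx andbT. Qed.

Lemma onT_mulJ z : onT z -> z * z^* = 1.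
Proof. by rewrite onTE mulJ sqmodE => /eqP->; rewrite expr1n. Qed.
Lemma onT_neq0 z : onT z -> z != 0.
Proof. by rewrite onTE => /eqP zE; rewrite -nrm_gt0 zE. Qed.

(** Componentwise, to agree by conversion with [radlim] and to match [clim]. *)
Definition ctends (T : Type) (F : set_system T) (u : T -> C) (l : C) :=
  complex.Re (u t) @[t --> F] --> complex.Re l /\
  complex.Im (u t) @[t --> F] --> complex.Im l.

Section Ctends.
Context {T : Type} {F : set_system T} {FF : ProperFilter F}.
Implicit Types u v : T -> C.

Lemma ctends_cst l : ctends F (fun=> l) l.
Proof. by split; exact: cvg_cst. Qed.
Lemma ctendsD u v a b : ctends F u a -> ctends F v b ->
  ctends F (fun t => u t + v t) (a + b).
Proof.
move=> [ur ui] [vr vi]; split.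
  under eq_cvg do rewrite ReD; rewrite ReD; exact: cvgD.
under eq_cvg do rewrite ImD; rewrite ImD; exact: cvgD.
Qed.
Lemma ctendsM u v a b : ctends F u a -> ctends F v b ->
  ctends F (fun t => u t * v t) (a * b).
Proof.
move=> [ur ui] [vr vi]; split.
  under eq_cvg do rewrite ReM; rewrite ReM; apply: cvgB; exact: cvgM.
under eq_cvg do rewrite ImM; rewrite ImM; apply: cvgD; exact: cvgM.
Qed.
Lemma ctendsJ u a : ctends F u a -> ctends F (fun t => (u t)^*) a^*.
Proof.
move=> [ur ui]; split.
  by under eq_cvg do rewrite ReJ; rewrite ReJ.
under eq_cvg do rewrite ImJ; rewrite ImJ; exact: cvgN.
Qed.
Lemma ctendsN u a : ctends F u a -> ctends F (fun t => - u t) (- a).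
Proof.
move=> h; under eq_fun do rewrite -mulN1r; rewrite -[- a]mulN1r.
exact: ctendsM (ctends_cst _) h.
Qed.
Lemma ctends_rc (x : T -> R) (l : R) : x t @[t --> F] --> l ->
  ctends F (fun t => rc (x t)) (rc l).
Proof. by move=> h; split => //=; exact: cvg_cst. Qed.
Lemma ctends_sum (I : Type) (s : seq I) (P : pred I) (u : I -> T -> C) (a : I -> C) :
  (forall i, P i -> ctends F (u i) (a i)) ->
  ctends F (fun t => \sum_(i <- s | P i) u i t) (\sum_(i <- s | P i) a i).
Proof.
move=> h; elim: s => [|i s IH].
  by under eq_fun do rewrite big_nil; rewrite big_nil; exact: ctends_cst.
under eq_fun do rewrite big_cons; rewrite big_cons; case: ifP => Pi //.
by apply: ctendsD IH; exact: h.
Qed.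
Lemma ctendsX u a n : ctends F u a -> ctends F (fun t => u t ^+ n) (a ^+ n).
Proof.
move=> h; elim: n => [|n IH]; first exact: ctends_cst.
by under eq_fun do rewrite exprS; rewrite exprS; exact: ctendsM.
Qed.
Lemma ctends_unique u a b : ctends F u a -> ctends F u b -> a = b.
Proof.
move=> [ar ai] [br bi]; apply: complex_ext.
  exact: (cvg_unique _ ar br).
exact: (cvg_unique _ ai bi).
Qed.
Lemma ctends_near u v a : (\forall t \near F, u t = v t) ->
  ctends F u a -> ctends F v a.
Proof.
move=> uv [ur ui]; split.
  apply: cvg_trans ur; apply: near_eq_cvg; near=> t; congr (complex.Re _).
  by near: t.
apply: cvg_trans ui; apply: near_eq_cvg; near=> t; congr (complex.Im _).
by near: t.
Unshelve. all: by end_near. Qed.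
Lemma cvg_sqmod u a : ctends F u a -> sqmod (u t) @[t --> F] --> sqmod a.
Proof.
by move=> [ur ui]; apply: cvgD; under eq_cvg do rewrite expr2; rewrite expr2; exact: cvgM.
Qed.
Lemma ctendsV u a : a != 0 -> ctends F u a -> ctends F (fun t => (u t)^-1) a^-1.
Proof.
move=> a0 h; have E z : z^-1 = z^* * rc (sqmod z)^-1.
  have [->|z0] := eqVneq z 0; first by rewrite invr0 conjC0 mul0r.
  apply: (mulfI z0); rewrite divff // mulrA mulJ -rcM divff //.
  by rewrite sqmodE expf_neq0 // nrm_eq0.
under eq_fun do rewrite E; rewrite E.
apply: ctendsM; first exact: ctendsJ.
apply: ctends_rc; apply: cvgV; last exact: cvg_sqmod.
by rewrite sqmodE expf_neq0 // nrm_eq0.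
Qed.
End Ctends.

End ComplexBasics.

(** * The Hardy space of the bidisk *)

Section HardyTwo.
Variable R : realType.
Local Notation C := (R[i]).
Local Notation fps2 := (fps (fps C)).
Implicit Types f g h : fps2.

(* [fps (fps C)] is convertible to [coef2 R], the outer index being the exponent of z1.
   Restating the notions at this type makes [*] the Cauchy product, not the pointwise one. *)
Definition H2 f : Prop := H2_2 f.
Definition ip f g : C := ip2 f g.
Definition ev f (w1 w2 : C) : C := eval2 f w1 w2.

Definition csc (a : C) : fps2 := fpsC (fpsC a).
Definition X1 : fps2 := fpsX (fps C).
Definition X2 : fps2 := fpsC (fpsX C).
Definition tr f : fps2 := fun i j => f j i.

Lemma cscM a f i j : (csc a * f) i j = a * f i j.
Proof. by rewrite fpsCM fpsCM. Qed.
Lemma X1M f i j : (X1 * f) i j = if i is i'.+1 then f i' j else 0.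
Proof. by rewrite fpsXM; case: i. Qed.
Lemma X2M f i j : (X2 * f) i j = if j is j'.+1 then f i j' else 0.
Proof. by rewrite fpsCM fpsXM. Qed.
Lemma shift1E f : shift1 f = X1 * f.
Proof. by apply/funext => i; apply/funext => j; rewrite X1M. Qed.
Lemma shift2E f : shift2 f = X2 * f.
Proof. by apply/funext => i; apply/funext => j; rewrite X2M. Qed.
Lemma cscN a : csc (- a) = - csc a. Proof. by rewrite /csc !rmorphN. Qed.
Lemma csc1 : csc 1 = 1. Proof. by rewrite /csc !rmorph1. Qed.
Lemma fps2_ext f g : (forall i j, f i j = g i j) -> f = g.
Proof. by move=> e; apply/funext => i; apply/funext => j. Qed.
Lemma fps2D f g i j : (f + g) i j = f i j + g i j. Proof. by []. Qed.
Lemma fps2N f i j : (- f) i j = - f i j. Proof. by []. Qed.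
Lemma fps2B f g i j : (f - g) i j = f i j - g i j. Proof. by []. Qed.
Lemma fps20 i j : (0 : fps2) i j = 0. Proof. by []. Qed.
Lemma fps21 i j : (1 : fps2) i j = ((i == 0) && (j == 0))%:R.
Proof. by rewrite fps1; case: i. Qed.
Lemma fps2_sum (I : Type) (s : seq I) (P : pred I) (F : I -> fps2) i j :
  (\sum_(k <- s | P k) F k) i j = \sum_(k <- s | P k) F k i j.
Proof. by rewrite fps_sum fps_sum. Qed.
Lemma trK f : tr (tr f) = f. Proof. by []. Qed.
Lemma trX2 f : X1 * f = tr (X2 * tr f).
Proof. by apply: fps2_ext => i j; rewrite X1M /tr X2M. Qed.

Definition ipN (N : nat) f g : C := \sum_(i < N) \sum_(j < N) f i j * (g i j)^*.
Definition nN (N : nat) f : R := \sum_(i < N) \sum_(j < N) sqmod (f i j).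
Definition n2 f : R := limn (fun N => nN N f).

Lemma H2_bounded f (M : R) : (forall N, nN N f <= M) -> H2 f.
Proof. by move=> h; exists M. Qed.

Lemma ipN_n2 N f : ipN N f f = rc (nN N f).
Proof.
rewrite rc_sum; apply: eq_bigr => i _.
by rewrite rc_sum; apply: eq_bigr => j _; rewrite mulJ.
Qed.

Lemma nN_mono f : nondecreasing_seq (nN^~ f).
Proof.
apply/nondecreasing_seqP => N; rewrite /nN big_ord_recr /= -[leLHS]addr0 lerD //.
  by apply: ler_sum => i _; rewrite big_ord_recr /= lerDl sqmod_ge0.
by apply: sumr_ge0 => j _; exact: sqmod_ge0.
Qed.

Lemma nN_cvg f : H2 f -> nN^~ f @ \oo --> n2 f.
Proof.
move=> [M hM]; apply: nondecreasing_is_cvgn; first exact: nN_mono.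
by exists M => _ [N _ <-]; exact: hM.
Qed.

Lemma nN_le_n2 f N : H2 f -> nN N f <= n2 f.
Proof.
move=> hf; apply: nondecreasing_cvgn_le; first exact: nN_mono.
by apply/cvg_ex; exists (n2 f); exact: nN_cvg.
Qed.

Lemma n2_le f M : (forall N, nN N f <= M) -> n2 f <= M.
Proof.
move=> h; apply: limr_le; last by near=> N; exact: h.
by apply/cvg_ex; exists (n2 f); apply: nN_cvg; exists M.
Unshelve. all: by end_near. Qed.

Lemma n2_ge0 f : H2 f -> 0 <= n2 f.
Proof. by move=> hf; apply: le_trans (nN_le_n2 0 hf); rewrite /nN big_ord0. Qed.

Lemma sqmod_le_n2 f i j : H2 f -> sqmod (f i j) <= n2 f.
Proof.
move=> hf; apply: le_trans (nN_le_n2 (maxn i j).+1 hf); rewrite /nN.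
have hi : (i < (maxn i j).+1)%N by rewrite ltnS leq_maxl.
have hj : (j < (maxn i j).+1)%N by rewrite ltnS leq_maxr.
rewrite (bigD1 (Ordinal hi)) //= (bigD1 (Ordinal hj)) //= -addrA lerDl.
apply: addr_ge0; first by apply: sumr_ge0 => ? _; exact: sqmod_ge0.
by apply: sumr_ge0 => ? _; apply: sumr_ge0 => ? _; exact: sqmod_ge0.
Qed.

Lemma n2_eq0 f : H2 f -> n2 f = 0 -> f = 0.
Proof.
move=> hf f0; apply: fps2_ext => i j; apply/eqP.
have := sqmod_le_n2 i j hf; rewrite f0 sqmodE => h.
by rewrite -nrm_eq0 -sqrf_eq0 eq_le h sqr_ge0.
Qed.

Lemma H2_0 : H2 (0 : fps2).
Proof.
exists 0 => N; rewrite big1 // => i _; rewrite big1 // => j _.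
by rewrite sqmodE nrm0 expr0n.
Qed.

Lemma sqmodD_le (z w : C) : sqmod (z + w) <= 2 * sqmod z + 2 * sqmod w.
Proof.
case: z w => [a b] [c d]; rewrite /sqmod ReD ImD /=.
have := sqr_ge0 (a - c); have := sqr_ge0 (b - d); nra.
Qed.

Lemma H2_D f g : H2 f -> H2 g -> H2 (f + g).
Proof.
move=> [M hM] [M' hM']; exists (2 * M + 2 * M') => N.
apply: le_trans (_ : 2 * nN N f + 2 * nN N g <= _); last first.
  by apply: lerD; rewrite ler_pM2l //; [exact: hM|exact: hM'].
rewrite /nN !mulr_sumr -big_split; apply: ler_sum => i _ /=.
by rewrite !mulr_sumr -big_split; apply: ler_sum => j _ /=; exact: sqmodD_le.
Qed.

Lemma H2_Z a f : H2 f -> H2 (csc a * f).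
Proof.
move=> [M hM]; exists (sqmod a * M) => N.
apply: le_trans (_ : sqmod a * nN N f <= _); last first.
  by apply: ler_wpM2l; rewrite ?sqmod_ge0 //; exact: hM.
rewrite /nN mulr_sumr; apply: ler_sum => i _; rewrite mulr_sumr.
by apply: ler_sum => j _; rewrite cscM !sqmodE nrmM exprMn.
Qed.

Lemma H2_N f : H2 f -> H2 (- f).
Proof. by move=> hf; rewrite -mulN1r -csc1 -cscN; exact: H2_Z. Qed.

Lemma H2_B f g : H2 f -> H2 g -> H2 (f - g).
Proof. by move=> hf hg; apply: H2_D => //; exact: H2_N. Qed.

Lemma H2_sum (I : Type) (s : seq I) (P : pred I) (F : I -> fps2) :
  (forall i, P i -> H2 (F i)) -> H2 (\sum_(i <- s | P i) F i).
Proof. by move=> h; elim/big_ind: _ => //; [exact: H2_0 | exact: H2_D]. Qed.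

Lemma tr_H2 f : H2 f -> H2 (tr f).
Proof. by move=> [M hM]; exists M => N; rewrite exchange_big; exact: hM. Qed.

Lemma n2_tr f : n2 (tr f) = n2 f.
Proof. by congr (limn _); apply/funext => N; rewrite /nN exchange_big. Qed.

(** The shift moves one index only, so square partial sums of [X2 * f] are not square partial sums
    of [f]. Trapping them between two such sums is enough for equality of the limits. *)
Lemma nN_X2 f N : nN N f <= nN N.+1 (X2 * f) <= nN N.+1 f.
Proof.
have E i : \sum_(j < N.+1) sqmod ((X2 * f) i j) = \sum_(j < N) sqmod (f i j).
  rewrite big_ord_recl X2M sqmodE nrm0 expr0n add0r; apply: eq_bigr => j _.
  by rewrite X2M.
rewrite /nN; under [X in _ <= X <= _]eq_bigr do rewrite E.
rewrite [X in _ <= X <= _]big_ord_recr /= lerDl sumr_ge0 => [/=|j _]; last exact: sqmod_ge0.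
rewrite [leRHS]big_ord_recr /=; apply: lerD; last first.
  by rewrite big_ord_recr /= lerDl sqmod_ge0.
by apply: ler_sum => i _; rewrite big_ord_recr /= lerDl sqmod_ge0.
Qed.

Lemma H2_X2 f : H2 f -> H2 (X2 * f).
Proof.
move=> [M hM]; exists M; case=> [|N]; last first.
  by have /andP[_ h] := nN_X2 f N; apply: le_trans h (hM _).
by rewrite big_ord0; apply: le_trans (hM 0%N); rewrite big_ord0.
Qed.

Lemma H2_X1 f : H2 f -> H2 (X1 * f).
Proof. by move=> hf; rewrite trX2; apply/tr_H2/H2_X2/tr_H2. Qed.

Lemma n2_X2 f : H2 f -> n2 (X2 * f) = n2 f.
Proof.
move=> hf; have hX := H2_X2 hf; apply/eqP; rewrite eq_le; apply/andP; split.
  apply: n2_le => -[|N]; first by rewrite /nN big_ord0 n2_ge0.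
  by have /andP[_ h] := nN_X2 f N; apply: le_trans h (nN_le_n2 _ hf).
apply: n2_le => N; have /andP[h _] := nN_X2 f N.
exact: le_trans h (nN_le_n2 _ hX).
Qed.

Lemma n2_X1 f : H2 f -> n2 (X1 * f) = n2 f.
Proof. by move=> hf; rewrite trX2 n2_tr (n2_X2 (tr_H2 hf)) n2_tr. Qed.

(** Polarization at the level of partial sums: convergence of inner products reduces to that of
    norms, which is monotone. *)
Lemma ipN_polar N f g : ipN N f g =
  Complex ((nN N (f + g) - nN N (f - g)) / 4)
          ((nN N (f + csc 'i * g) - nN N (f - csc 'i * g)) / 4).
Proof.
have i0 : complex.Re ('i : C) = 0 by rewrite -complexiE.
have i1 : complex.Im ('i : C) = 1 by rewrite -complexiE.
apply: complex_ext => /=; rewrite /nN /ipN ?Re_sum ?Im_sum -sumrB mulr_suml;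
  apply: eq_bigr => i _; rewrite ?Re_sum ?Im_sum -sumrB mulr_suml;
  apply: eq_bigr => j _; rewrite ?fps2D ?fps2N ?cscM;
  case: (f i j) (g i j) => [a b] [c d];
  by rewrite /sqmod !(ReM, ImM, ReD, ImD, ReN, ImN, ReJ, ImJ, i0, i1) /=; field.
Qed.

Lemma ip2_cvg f g : H2 f -> H2 g -> ctends \oo (fun N => ipN N f g) (ip f g).
Proof.
move=> hf hg; pose l := Complex ((n2 (f + g) - n2 (f - g)) / 4)
          ((n2 (f + csc 'i * g) - n2 (f - csc 'i * g)) / 4).
have cl : ctends \oo (fun N => ipN N f g) l.
  split; under eq_cvg do rewrite ipN_polar /=; apply: cvgMl; apply: cvgB;
    apply: nN_cvg; by [apply: H2_D => //; exact: H2_Z|apply: H2_B => //; exact: H2_Z|exact: H2_D|exact: H2_B].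
suff -> : ip f g = l by [].
case: cl => c1 c2; apply: complex_ext; [exact: (cvg_lim _ c1)|exact: (cvg_lim _ c2)].
Qed.

Lemma ip2_polar f g : H2 f -> H2 g -> ip f g =
  Complex ((n2 (f + g) - n2 (f - g)) / 4)
          ((n2 (f + csc 'i * g) - n2 (f - csc 'i * g)) / 4).
Proof.
move=> hf hg; apply: (ctends_unique (ip2_cvg hf hg)).
split; under eq_cvg do rewrite ipN_polar /=; apply: cvgMl; apply: cvgB;
  apply: nN_cvg; by [apply: H2_D => //; exact: H2_Z|apply: H2_B => //; exact: H2_Z|exact: H2_D|exact: H2_B].
Qed.

Lemma ip2_lim f g l : H2 f -> H2 g -> ctends \oo (fun N => ipN N f g) l -> ip f g = l.
Proof. by move=> hf hg; apply: ctends_unique; exact: ip2_cvg. Qed.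

Lemma ip2C f g : H2 f -> H2 g -> ip g f = (ip f g)^*.
Proof.
move=> hf hg; apply: ip2_lim => //.
have -> : (fun N => ipN N g f) = fun N => (ipN N f g)^*.
  apply/funext => N; rewrite rmorph_sum; apply: eq_bigr => i _.
  by rewrite rmorph_sum; apply: eq_bigr => j _; rewrite rmorphM /= conjCK mulrC.
by apply: ctendsJ; exact: ip2_cvg.
Qed.

Lemma ip2Dl f g h : H2 f -> H2 g -> H2 h -> ip (f + g) h = ip f h + ip g h.
Proof.
move=> hf hg hh; apply: ip2_lim => //; first exact: H2_D.
have -> : (fun N => ipN N (f + g) h) = fun N => ipN N f h + ipN N g h.
  apply/funext => N; rewrite /ipN -big_split; apply: eq_bigr => i _ /=.
  by rewrite -big_split; apply: eq_bigr => j _ /=; rewrite mulrDl.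
by apply: ctendsD; exact: ip2_cvg.
Qed.

Lemma ip2Zl a f h : H2 f -> H2 h -> ip (csc a * f) h = a * ip f h.
Proof.
move=> hf hh; apply: ip2_lim => //; first exact: H2_Z.
have -> : (fun N => ipN N (csc a * f) h) = fun N => a * ipN N f h.
  apply/funext => N; rewrite /ipN mulr_sumr; apply: eq_bigr => i _ /=.
  by rewrite mulr_sumr; apply: eq_bigr => j _ /=; rewrite cscM mulrA.
by apply: ctendsM; [exact: ctends_cst|exact: ip2_cvg].
Qed.

Lemma ip2Nl f h : H2 f -> H2 h -> ip (- f) h = - ip f h.
Proof. by move=> hf hh; rewrite -mulN1r -csc1 -cscN ip2Zl // mulN1r. Qed.

Lemma ip2Bl f g h : H2 f -> H2 g -> H2 h -> ip (f - g) h = ip f h - ip g h.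
Proof. by move=> hf hg hh; rewrite ip2Dl ?ip2Nl //; exact: H2_N. Qed.

Lemma ip2_0l h : H2 h -> ip (0 : fps2) h = 0.
Proof. by move=> hh; have := ip2Zl 0 H2_0 hh; rewrite mulr0 mul0r. Qed.

Lemma ip2_suml (I : Type) (s : seq I) (P : pred I) (F : I -> fps2) h :
  (forall i, P i -> H2 (F i)) -> H2 h ->
  ip (\sum_(i <- s | P i) F i) h = \sum_(i <- s | P i) ip (F i) h.
Proof.
move=> hF hh; elim: s => [|i s IH]; first by rewrite !big_nil ip2_0l.
by rewrite !big_cons; case: ifP => Pi //; rewrite ip2Dl ?IH //; [exact: hF|exact: H2_sum].
Qed.

Lemma ip2Dr f g h : H2 f -> H2 g -> H2 h -> ip h (f + g) = ip h f + ip h g.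
Proof.
by move=> hf hg hh; rewrite ip2C ?ip2Dl ?rmorphD /= -?ip2C //; exact: H2_D.
Qed.
Lemma ip2Zr a f h : H2 f -> H2 h -> ip h (csc a * f) = a^* * ip h f.
Proof. by move=> hf hh; rewrite ip2C ?ip2Zl ?rmorphM /= -?ip2C //; exact: H2_Z. Qed.
Lemma ip2Nr f h : H2 f -> H2 h -> ip h (- f) = - ip h f.
Proof. by move=> hf hh; rewrite ip2C ?ip2Nl ?rmorphN /= -?ip2C //; exact: H2_N. Qed.
Lemma ip2Br f g h : H2 f -> H2 g -> H2 h -> ip h (f - g) = ip h f - ip h g.
Proof. by move=> hf hg hh; rewrite ip2Dr ?ip2Nr //; exact: H2_N. Qed.
Lemma ip2_0r h : H2 h -> ip h (0 : fps2) = 0.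
Proof. by move=> hh; rewrite ip2C ?ip2_0l ?conjC0 //; exact: H2_0. Qed.
Lemma ip2_sumr (I : Type) (s : seq I) (P : pred I) (F : I -> fps2) h :
  (forall i, P i -> H2 (F i)) -> H2 h ->
  ip h (\sum_(i <- s | P i) F i) = \sum_(i <- s | P i) ip h (F i).
Proof.
move=> hF hh; rewrite ip2C ?ip2_suml ?rmorph_sum //=; last exact: H2_sum.
by apply: eq_bigr => i Pi; rewrite -ip2C //; exact: hF.
Qed.

Lemma ip2_n2 f : H2 f -> ip f f = rc (n2 f).
Proof.
move=> hf; apply: ip2_lim => //.
under eq_fun do rewrite ipN_n2.
by apply: ctends_rc; exact: nN_cvg.
Qed.

Lemma ip2_eq0 f : H2 f -> ip f f = 0 -> f = 0.
Proof. by move=> hf; rewrite ip2_n2 // => -[] /n2_eq0; exact. Qed.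

Lemma ip2_X2 f g : H2 f -> H2 g -> ip (X2 * f) (X2 * g) = ip f g.
Proof.
move=> hf hg; have hig := H2_Z 'i hg.
rewrite !ip2_polar //; try exact: H2_X2.
rewrite (mulrCA (csc _)) -!mulrDr -!mulrBr !n2_X2 //.
all: by [exact: H2_B | exact: H2_D].
Qed.

Lemma ip2_X1 f g : H2 f -> H2 g -> ip (X1 * f) (X1 * g) = ip f g.
Proof.
move=> hf hg; have hig := H2_Z 'i hg.
rewrite !ip2_polar //; try exact: H2_X1.
rewrite (mulrCA (csc _)) -!mulrDr -!mulrBr !n2_X1 //.
all: by [exact: H2_B | exact: H2_D].
Qed.

Lemma cauchy_schwarz f g : H2 f -> H2 g -> sqmod (ip f g) <= n2 f * n2 g.
Proof.
move=> hf hg; have [g0|g0] := eqVneq (n2 g) 0.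
  rewrite g0 mulr0 (n2_eq0 hg g0) ip2_0r // sqmodE nrm0 expr0n //.
have gp : 0 < n2 g by rewrite lt_neqAle eq_sym g0 n2_ge0.
pose c := ip f g; pose t := rc (n2 g)^-1 * c.
have hcg := H2_Z t hg; have hd := H2_B hf hcg.
have := n2_ge0 hd.
suff -> : n2 (f - csc t * g) = n2 f - sqmod c / n2 g.
  by rewrite subr_ge0 ler_pdivrMr.
suff E : rc (n2 (f - csc t * g)) = rc (n2 f - sqmod c / n2 g) by case: E.
rewrite -ip2_n2 // ip2Bl // !ip2Br // !ip2Zl // !ip2Zr // (ip2C hf hg) !ip2_n2 // -/c.
rewrite /t rmorphM /= rcJ.
have -> : rc (n2 f - sqmod c / n2 g) = rc (n2 f) - (c * c^*) * rc (n2 g)^-1.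
  rewrite mulJ -rcM rcD; congr (_ + _); apply: complex_ext => //=; by rewrite oppr0.
have E : rc (n2 g)^-1 * rc (n2 g) = 1 by rewrite -rcM mulVf.
ring: E.
Qed.

End HardyTwo.

(** * Evaluation and monomials *)

Section Evaluation.
Variable R : realType.
Local Notation C := (R[i]).
Local Notation fps2 := (fps (fps C)).
Local Notation X1 := (X1 R).
Local Notation X2 := (X2 R).
Implicit Types (f g h : fps2) (a w : C).

(** [L1] and [L2] are the backward shifts, adjoint to multiplication by z1 and z2 ([ip2_L1],
    [ip2_L2]). [R2 f] is f(z1, 0). *)
Definition L1 f : fps2 := fun i j => f i.+1 j.
Definition L2 f : fps2 := fun i j => f i j.+1.
Definition R2 f : fps2 := fun i j => if j is 0 then f i 0 else 0.
Definition XX (k l : nat) : fps2 := X1 ^+ k * X2 ^+ l.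

Lemma splitX2 f : f = R2 f + X2 * L2 f.
Proof.
by apply: fps2_ext => i [|j]; rewrite fps2D X2M ?addr0 ?add0r.
Qed.

Lemma H2_L2 f : H2 f -> H2 (L2 f).
Proof.
move=> [M hM]; exists M => N; apply: le_trans (hM N.+1).
rewrite [leRHS]big_ord_recr /=; apply: ler_wpDr.
  by apply: sumr_ge0 => j _; exact: sqmod_ge0.
by apply: ler_sum => i _; rewrite [leRHS]big_ord_recl lerDr sqmod_ge0.
Qed.

Lemma H2_L1 f : H2 f -> H2 (L1 f).
Proof. by move=> /tr_H2/H2_L2/tr_H2. Qed.

Lemma H2_R2 f : H2 f -> H2 (R2 f).
Proof.
move=> hf; have -> : R2 f = f - X2 * L2 f by rewrite {2}(splitX2 f) addrK.
by apply: H2_B => //; apply/H2_X2/H2_L2.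
Qed.

Lemma ip2_L2 f g : H2 f -> H2 g -> ip f (X2 * g) = ip (L2 f) g.
Proof.
move=> hf hg; rewrite {1}(splitX2 f) ip2Dl; [|exact: H2_R2|exact/H2_X2/H2_L2|exact: H2_X2].
rewrite ip2_X2 //; last exact: H2_L2.
suff -> : ip (R2 f) (X2 * g) = 0 by rewrite add0r.
apply: ip2_lim; [exact: H2_R2|exact: H2_X2|].
have -> : (fun N => ipN N (R2 f) (X2 * g)) = fun=> 0.
  apply/funext => N; rewrite /ipN big1 // => i _; rewrite big1 // => -[[|j] ?] _ /=.
    by rewrite X2M conjC0 mulr0.
  by rewrite mul0r.
exact: ctends_cst.
Qed.

Lemma ip2_tr f g : ip (tr f) (tr g) = ip f g.
Proof. by congr (clim _); apply/funext => N; rewrite exchange_big. Qed.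

Lemma ip2_L1 f g : H2 f -> H2 g -> ip f (X1 * g) = ip (L1 f) g.
Proof.
move=> hf hg; rewrite trX2 -(trK f) ip2_tr ip2_L2; [|exact: tr_H2|exact: tr_H2].
by rewrite -[in LHS](trK (L2 (tr f))) ip2_tr.
Qed.

Lemma H2_one : H2 (1 : fps2).
Proof.
exists 1 => N; case: N => [|N]; first by rewrite big_ord0.
rewrite big_ord_recl big_ord_recl /= fps21 /= sqmodE nrm1 expr1n.
rewrite big1 => [|i _]; last by rewrite fps21 sqmodE nrm0 expr0n.
rewrite big1 ?addr0 // => i _; rewrite big1 // => j _.
by rewrite fps21 sqmodE nrm0 expr0n.
Qed.

Lemma H2_XnM (a b : nat) f : H2 f -> H2 (XX a b * f).
Proof.
move=> hf; rewrite /XX -mulrA; elim: a => [|a IH].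
  rewrite mul1r; elim: b => [|b IH]; first by rewrite mul1r.
  by rewrite exprS -mulrA; exact: H2_X2.
by rewrite exprS -mulrA; exact: H2_X1.
Qed.

Lemma H2_XX (a b : nat) : H2 (XX a b).
Proof. by rewrite -[XX a b]mulr1; apply: H2_XnM; exact: H2_one. Qed.

Lemma ip2_XnM (a b : nat) f g : H2 f -> H2 g -> ip (XX a b * f) (XX a b * g) = ip f g.
Proof.
move=> hf hg; elim: a => [|a IH].
  elim: b => [|b IH]; first by rewrite /XX !mul1r.
  have E k : XX 0 b.+1 * k = X2 * (XX 0 b * k) by rewrite /XX exprS; ring.
  by rewrite !E ip2_X2 //; exact: H2_XnM.
have E k : XX a.+1 b * k = X1 * (XX a b * k) by rewrite /XX exprS; ring.
by rewrite !E ip2_X1 //; exact: H2_XnM.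
Qed.

Lemma ip2_XX f (a b : nat) : H2 f -> ip f (XX a b) = f a b.
Proof.
elim: a f => [|a IH] f hf; last first.
  have -> : XX a.+1 b = X1 * XX a b by rewrite /XX exprS mulrA.
  by rewrite ip2_L1 ?IH //; [exact: H2_L1|exact: H2_XX].
elim: b f hf => [|b IH] f hf; last first.
  have -> : XX 0 b.+1 = X2 * XX 0 b by rewrite /XX exprS; ring.
  by rewrite ip2_L2 ?IH //; [exact: H2_L2|exact: H2_XX].
rewrite /XX !expr0 mulr1; apply: ip2_lim => //; first exact: H2_one.
apply: ctends_near (ctends_cst _); exists 1%N => // -[|N] // _.
rewrite /ipN big_ord_recl big_ord_recl /= fps21 /= conjC1 mulr1.
rewrite [X in _ + X + _]big1 => [|i _]; last by rewrite fps21 conjC0 mulr0.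
rewrite [X in _ + X]big1 ?addr0 // => i _; rewrite big1 // => j _.
by rewrite fps21 conjC0 mulr0.
Qed.

Lemma XXM (a b : nat) f i j :
  (XX a b * f) i j = if (a <= i)%N && (b <= j)%N then f (i - a)%N (j - b)%N else 0.
Proof.
rewrite /XX -mulrA fpsXnM; case: leqP => //= _.
by rewrite /X2 -rmorphXn fpsCM fpsXnM.
Qed.

Lemma XXE (a b i j : nat) : XX a b i j = ((i == a) && (j == b))%:R.
Proof.
rewrite -[XX a b]mulr1 XXM fps21 !subn_eq0 [i == a]eqn_leq [j == b]eqn_leq.
by case: (leqP a i); case: (leqP b j); rewrite /= ?andbT ?andbF.
Qed.

Lemma geometric_le (x : R) N : 0 <= x < 1 -> \sum_(i < N) x ^+ i <= (1 - x)^-1.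
Proof.
move=> /andP[x0 x1]; have h : 0 < 1 - x by rewrite subr_gt0.
rewrite -(ler_pM2l h) divff ?gt_eqF //.
by rewrite -opprB mulNr -subrX1 opprB gerBl exprn_ge0.
Qed.

Lemma H2_geometric f (A x y : R) : 0 <= x < 1 -> 0 <= y < 1 -> 0 <= A ->
  (forall i j, nrm (f i j) <= A * (x ^+ i * y ^+ j)) ->
  H2 f /\ n2 f <= A ^+ 2 * ((1 - x ^+ 2)^-1 * (1 - y ^+ 2)^-1).
Proof.
move=> hx hy A0 h.
have sq (t : R) : 0 <= t < 1 -> 0 <= t ^+ 2 < 1.
  by move=> /andP[t0 t1]; rewrite sqr_ge0 expr_lt1.
have bnd N : nN N f <= A ^+ 2 * ((1 - x ^+ 2)^-1 * (1 - y ^+ 2)^-1).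
  apply: le_trans (_ : A ^+ 2 * ((\sum_(i < N) (x ^+ 2) ^+ i) * (\sum_(j < N) (y ^+ 2) ^+ j)) <= _).
    rewrite mulr_suml mulr_sumr; apply: ler_sum => i _; rewrite !mulr_sumr.
    apply: ler_sum => j _; rewrite sqmodE.
    apply: le_trans (_ : (A * (x ^+ i * y ^+ j)) ^+ 2 <= _).
      by rewrite ler_sqr ?nnegrE ?nrm_ge0 // (le_trans (nrm_ge0 _) (h _ _)).
    by rewrite !exprMn.
  apply: ler_wpM2l; first exact: sqr_ge0.
  apply: ler_pM; rewrite ?geometric_le ?sq //; apply: sumr_ge0 => i _;
    by rewrite exprn_ge0 // sqr_ge0.
by split; [exists (A ^+ 2 * ((1 - x ^+ 2)^-1 * (1 - y ^+ 2)^-1))|exact: n2_le].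
Qed.

(** The Szego kernel 1 / ((1 - z1 conj w1) (1 - z2 conj w2)); pairing with it evaluates at (w1, w2),
    by [eval2E]. *)
Definition sz (w1 w2 : C) : fps2 := fun i j => (w1 ^+ i * w2 ^+ j)^*.

Lemma sz_bound w1 w2 i j : nrm (sz w1 w2 i j) <= 1 * (nrm w1 ^+ i * nrm w2 ^+ j).
Proof. by rewrite /sz nrmJ nrmM !nrmX mul1r. Qed.

Lemma nrm_in (w : C) : inD w -> 0 <= nrm w < 1.
Proof. by rewrite inDE nrm_ge0. Qed.

Lemma H2_sz w1 w2 : inD w1 -> inD w2 -> H2 (sz w1 w2).
Proof.
move=> h1 h2; apply: (proj1 (H2_geometric (nrm_in h1) (nrm_in h2) ler01 _)).
exact: sz_bound.
Qed.

Lemma eval2E f w1 w2 : ev f w1 w2 = ip f (sz w1 w2).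
Proof.
congr (clim _); apply/funext => N; apply: eq_bigr => i _; apply: eq_bigr => j _.
by rewrite /sz conjCK mulrA.
Qed.

Lemma eval2_tr f w1 w2 : ev (tr f) w1 w2 = ev f w2 w1.
Proof.
congr (clim _); apply/funext => N; rewrite exchange_big.
by apply: eq_bigr => i _; apply: eq_bigr => j _; rewrite /tr mulrAC.
Qed.

Lemma eval2D f g w1 w2 : inD w1 -> inD w2 -> H2 f -> H2 g ->
  ev (f + g) w1 w2 = ev f w1 w2 + ev g w1 w2.
Proof. by move=> *; rewrite !eval2E ip2Dl //; exact: H2_sz. Qed.

Lemma eval2B f g w1 w2 : inD w1 -> inD w2 -> H2 f -> H2 g ->
  ev (f - g) w1 w2 = ev f w1 w2 - ev g w1 w2.
Proof. by move=> *; rewrite !eval2E ip2Bl //; exact: H2_sz. Qed.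

Lemma eval2Z (a : C) f w1 w2 : inD w1 -> inD w2 -> H2 f ->
  ev (csc a * f) w1 w2 = a * ev f w1 w2.
Proof. by move=> *; rewrite !eval2E ip2Zl //; exact: H2_sz. Qed.

Lemma eval2_sum (I : Type) (s : seq I) (P : pred I) (F : I -> fps2) w1 w2 :
  inD w1 -> inD w2 -> (forall i, P i -> H2 (F i)) ->
  ev (\sum_(i <- s | P i) F i) w1 w2 = \sum_(i <- s | P i) ev (F i) w1 w2.
Proof.
move=> h1 h2 hF; rewrite eval2E ip2_suml //; last exact: H2_sz.
by apply: eq_bigr => i _; rewrite eval2E.
Qed.

Lemma eval2_X2 f w1 w2 : inD w1 -> inD w2 -> H2 f ->
  ev (X2 * f) w1 w2 = w2 * ev f w1 w2.
Proof.
move=> h1 h2 hf; have hs := H2_sz h1 h2.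
have E : L2 (sz w1 w2) = csc w2^* * sz w1 w2.
  by apply: fps2_ext => i j; rewrite cscM /L2 /sz exprS mulrCA rmorphM.
rewrite !eval2E ip2C //; last exact: H2_X2.
by rewrite ip2_L2 // E ip2Zl // rmorphM /= conjCK -ip2C.
Qed.

Lemma eval2_X1 f w1 w2 : inD w1 -> inD w2 -> H2 f ->
  ev (X1 * f) w1 w2 = w1 * ev f w1 w2.
Proof.
by move=> h1 h2 hf; rewrite trX2 eval2_tr (eval2_X2 h2 h1 (tr_H2 hf)) eval2_tr.
Qed.

Lemma eval2_1 w1 w2 : inD w1 -> inD w2 -> ev (1 : fps2) w1 w2 = 1.
Proof.
move=> h1 h2; rewrite eval2E ip2C; [|exact: H2_sz|exact: H2_one].
have -> : (1 : fps2) = XX 0 0 by rewrite /XX !expr0 mulr1.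
by rewrite ip2_XX /sz ?mulr1 ?conjCK //; exact: H2_sz.
Qed.

Lemma inD0 : inD (0 : C). Proof. by rewrite inDE nrm0. Qed.

Lemma eval2_R2 f w1 w2 w : ev (R2 f) w1 w2 = ev (R2 f) w1 w.
Proof.
congr (clim _); apply/funext => N; apply: eq_bigr => i _.
by apply: eq_bigr => -[[|j] ?] _ /=; rewrite ?mul0r.
Qed.

Lemma eval2_split f w1 w2 : inD w1 -> inD w2 -> H2 f ->
  ev f w1 w2 = ev f w1 0 + w2 * ev (L2 f) w1 w2.
Proof.
move=> h1 h2 hf; have hL := H2_L2 hf; have hR := H2_R2 hf; have hX := H2_X2 hL.
rewrite {1 2}(splitX2 f) !eval2D //; try exact: inD0.
rewrite !eval2_X2 //; try exact: inD0.
have -> : ev (R2 f) w1 w2 = ev (R2 f) w1 0 by exact: eval2_R2.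
by rewrite [0 * ev _ _ _]mul0r [ev _ _ 0 + 0]addr0.
Qed.

(** Since f = f(., 0) + z2 L2 f, the factor z2 can be cancelled off z2 = 0. At z2 = 0 a quantitative
    continuity argument takes over: L2 f (w1, 0) = - t L2 (L2 f) (w1, t) for small t > 0, and the
    last value stays bounded. *)
Lemma eval2_L2_eq0 f : H2 f -> (forall w1 w2, inD w1 -> inD w2 -> ev f w1 w2 = 0) ->
  forall w1 w2, inD w1 -> inD w2 -> ev (L2 f) w1 w2 = 0.
Proof.
move=> hf f0; have hL := H2_L2 hf; have hLL := H2_L2 hL.
have nz w1 w2 : inD w1 -> inD w2 -> w2 != 0 -> ev (L2 f) w1 w2 = 0.
  move=> h1 h2 w0; have := eval2_split h1 h2 hf.
  rewrite f0 // f0 //; last exact: inD0.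
  by rewrite add0r => /esym/eqP; rewrite mulf_eq0 (negPf w0) => /eqP.
move=> w1 w2 h1 h2; have [->|] := eqVneq w2 0; last exact: nz.
apply/eqP; rewrite -nrm_eq0; apply/negPn/negP => nz0.
set e := nrm _ in nz0.
have e0 : 0 < e by rewrite lt_neqAle eq_sym nz0 nrm_ge0.
(* By Cauchy-Schwarz against the Szego kernel, K bounds the squared modulus of L2 (L2 f) at (w1, t)
   for all 0 < t <= 1/2. *)
pose K := n2 (L2 (L2 f)) * ((1 - nrm w1 ^+ 2)^-1 * (1 - (2^-1) ^+ 2)^-1).
have bound (t : R) : 0 < t -> t <= 2^-1 -> e ^+ 2 <= t ^+ 2 * K.
  move=> t0 t1; have ht : inD (rc t) by rewrite inDE nrm_rc ?(ltW t0) //; lra.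
  have := eval2_split h1 ht hL; rewrite nz //; last by rewrite -nrm_gt0 nrm_rc // ltW.
  move=> /esym/eqP; rewrite addr_eq0 => /eqP E.
  rewrite /e E nrmN nrmM nrm_rc ?(ltW t0) // exprMn.
  apply: ler_wpM2l; first exact: sqr_ge0.
  rewrite eval2E -sqmodE; apply: le_trans (cauchy_schwarz hLL (H2_sz h1 ht)) _.
  apply: ler_wpM2l; first exact: n2_ge0.
  have hh : 0 <= (2^-1 : R) < 1 by apply/andP; split; lra.
  have hb i j : nrm (sz w1 (rc t) i j) <= 1 * (nrm w1 ^+ i * 2^-1 ^+ j).
    apply: le_trans (sz_bound _ _ i j) _; rewrite nrm_rc ?(ltW t0) // !mul1r.
    by rewrite ler_wpM2l ?exprn_ge0 ?nrm_ge0 // lerXn2r // nnegrE ?(ltW t0) //; lra.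
  by have [_] := H2_geometric (nrm_in h1) hh ler01 hb; rewrite expr1n mul1r.
have e2 : 0 < e ^+ 2 by rewrite exprn_gt0.
have K0 : 0 < K.
  have := bound 2^-1; rewrite lexx => /(_ _ isT) h; have {}h : e ^+ 2 <= (2^-1) ^+ 2 * K by apply: h; lra.
  have : 0 < (2^-1) ^+ 2 * K by exact: lt_le_trans h.
  by rewrite pmulr_rgt0 // exprn_gt0 //; lra.
(* With this t one gets 2 t K <= e^2 <= t^2 K <= t K / 2, which is absurd. *)
pose t := Num.min 2^-1 (e ^+ 2 / (2 * K)).
have t0 : 0 < t by rewrite lt_min; apply/andP; split; [lra|rewrite divr_gt0 // mulr_gt0].
have t1 : t <= 2^-1 by rewrite ge_min lexx.
have t2 : t <= e ^+ 2 / (2 * K) by rewrite ge_min lexx orbT.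
have {t2}: t * (2 * K) <= e ^+ 2 by rewrite -ler_pdivlMr // mulr_gt0.
have := bound t t0 t1; rewrite [t ^+ 2]expr2.
have : t * (t * K) <= 2^-1 * (t * K) by rewrite ler_pM2r // mulr_gt0.
rewrite mulrA; have : 0 < t * K by rewrite mulr_gt0.
nra.
Qed.

Lemma eval2_L1_eq0 f : H2 f -> (forall w1 w2, inD w1 -> inD w2 -> ev f w1 w2 = 0) ->
  forall w1 w2, inD w1 -> inD w2 -> ev (L1 f) w1 w2 = 0.
Proof.
move=> hf f0 w1 w2 h1 h2; have -> : L1 f = tr (L2 (tr f)) by [].
rewrite eval2_tr; apply: (eval2_L2_eq0 (tr_H2 hf)) => // v1 v2 k1 k2.
by rewrite eval2_tr f0.
Qed.

Lemma eval2_eq0 f : H2 f -> (forall w1 w2, inD w1 -> inD w2 -> ev f w1 w2 = 0) ->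
  f = 0.
Proof.
move=> hf f0; apply: fps2_ext => i j.
elim: i f hf f0 => [|i IH] f hf f0; last first.
  exact: (IH (L1 f) (H2_L1 hf) (eval2_L1_eq0 hf f0)).
elim: j f hf f0 => [|j IH] f hf f0; last first.
  exact: (IH (L2 f) (H2_L2 hf) (eval2_L2_eq0 hf f0)).
have := f0 0 0 inD0 inD0; rewrite eval2E.
have -> : sz 0 0 = XX 0 0.
  apply: fps2_ext => i j; rewrite XXE /sz !expr0n.
  by case: eqP; case: eqP; rewrite /= ?mulr0 ?mul0r ?mulr1 ?conjC0 ?conjC1.
by rewrite ip2_XX.
Qed.

Lemma eval2_inj f g : H2 f -> H2 g ->
  (forall w1 w2, inD w1 -> inD w2 -> ev f w1 w2 = ev g w1 w2) -> f = g.
Proof.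
move=> hf hg e; apply/eqP; rewrite -subr_eq0; apply/eqP; apply: eval2_eq0.
  exact: H2_B.
by move=> w1 w2 h1 h2; rewrite eval2B // e // subrr.
Qed.

End Evaluation.

(** * Polynomials acting on power series *)

#[local] Opaque H2 ip ev tr n2.

Section Polynomials.
Variable R : realType.
Local Notation C := (R[i]).
Local Notation fps2 := (fps (fps C)).
Local Notation X1 := (X1 R).
Local Notation X2 := (X2 R).
Local Notation XX := (XX R).
Implicit Types (f g h F G K : fps2) (p : {poly {poly C}}) (a w : C).

Lemma XXD (i j k l : nat) : XX i j * XX k l = XX (i + k) (j + l).
Proof. by rewrite /XX !exprD; ring. Qed.

Lemma XXMM (i j k l : nat) f : XX i j * (XX k l * f) = XX (i + k) (j + l) * f.
Proof. by rewrite -XXD; exact: mulrA. Qed.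

(** Multiplication by monomials is isometric, so only the differences of exponents i - k and j - l
    matter. The equations are additive to avoid truncated subtraction. *)
Lemma ip_XX_shift (i j k l i' j' k' l' : nat) F K : H2 F -> H2 K ->
  (k' + i = k + i')%N -> (l' + j = l + j')%N ->
  ip (XX i j * F) (XX k l * K) = ip (XX i' j' * F) (XX k' l' * K).
Proof.
move=> hF hK e1 e2.
rewrite -(ip2_XnM k' l' (H2_XnM i j hF) (H2_XnM k l hK)) XXMM XXMM.
rewrite -(ip2_XnM k l (H2_XnM i' j' hF) (H2_XnM k' l' hK)) XXMM XXMM.
by rewrite e1 e2 (addnC k') (addnC l').
Qed.

(** The indices are exchanged: z2 is the outer variable of the polynomial, whereas the outer index
    of a series is the exponent of z1. *)
Definition pol p : fps2 := fun i j => p`_j`_i.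

Fact pol_is_additive : zmod_morphism pol.
Proof. by move=> p q; apply: fps2_ext => i j; rewrite fps2B /pol !coefB. Qed.
HB.instance Definition _ := GRing.isZmodMorphism.Build _ _ pol pol_is_additive.
Fact pol_is_multiplicative : monoid_morphism pol.
Proof.
split.
  apply: fps2_ext => i [|j]; rewrite fps21 /pol (@coef1 {poly C}) /=.
    by rewrite andbT (@coef1 C).
  by rewrite andbF coef0.
move=> p q; apply: fps2_ext => i j; rewrite /pol coefM coef_sum.
under eq_bigr do rewrite coefM.
by rewrite exchange_big fpsM fps_sum; apply: eq_bigr => k _; rewrite fpsM.
Qed.
HB.instance Definition _ := GRing.isMonoidMorphism.Build _ _ pol pol_is_multiplicative.

(** Takes any coefficient array, cut to the box, so that it covers polynomials, their reflections
    and truncations of series alike. *)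
Definition fin (m n : nat) (q : nat -> nat -> C) : fps2 :=
  \sum_(t : 'I_m.+1 * 'I_n.+1) csc (q t.1 t.2) * XX t.1 t.2.
Definition fev (m n : nat) (q : nat -> nat -> C) (w1 w2 : C) : C :=
  \sum_(t : 'I_m.+1 * 'I_n.+1) q t.1 t.2 * (w1 ^+ t.1 * w2 ^+ t.2).

Lemma finM m n q f i j : (fin m n q * f) i j =
  \sum_(t : 'I_m.+1 * 'I_n.+1 | (t.1 <= i)%N && (t.2 <= j)%N)
     q t.1 t.2 * f (i - t.1)%N (j - t.2)%N.
Proof.
rewrite /fin mulr_suml fps2_sum [RHS]big_mkcond; apply: eq_bigr => t _.
by rewrite -mulrA cscM XXM; case: ifP; rewrite ?mulr0.
Qed.

Lemma finE m n q i j : fin m n q i j = if (i <= m)%N && (j <= n)%N then q i j else 0.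
Proof.
rewrite -[fin m n q]mulr1 finM; case: ifPn => [/andP[hi hj]|].
  rewrite (bigD1 (Ordinal (hi : (i < m.+1)%N), Ordinal (hj : (j < n.+1)%N))) /= ?leqnn //.
  rewrite !subnn fps21 mulr1 big1 ?addr0 // => -[k l] /= /andP[/andP[h1 h2] /eqP ne].
  rewrite fps21 !subn_eq0; case: leqP => //= h3; last by rewrite mulr0.
  case: leqP => //= h4; last by rewrite mulr0.
  by case: ne; congr pair; apply: val_inj; apply/eqP; rewrite eqn_leq ?h1 ?h2 ?h3 ?h4.
move=> ne; rewrite big1 // => -[k l] /= /andP[h1 h2].
rewrite fps21 !subn_eq0; case: leqP => //= h3; last by rewrite mulr0.
case: leqP => //= h4; last by rewrite mulr0.
case/negP: ne; rewrite (leq_trans h3) ?(leq_trans h4) // -ltnS //.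
Qed.

Lemma pol_fin m n p : bideg_le m n p -> pol p = fin m n (pcoef p).
Proof.
move=> [h1 h2]; apply: fps2_ext => i j; rewrite finE; case: ifPn => //.
rewrite negb_and -!ltnNge => /orP[hi|hj].
  by rewrite /pol nth_default // (leq_trans (h2 j)).
by rewrite /pol (nth_default _ (leq_trans h1 hj)) coef0.
Qed.

Lemma peval_fev m n p w1 w2 : bideg_le m n p -> peval p w1 w2 = fev m n (pcoef p) w1 w2.
Proof.
move=> [h1 h2]; rewrite /peval (horner_coef_wide _ h1) horner_sum /fev.
rewrite -(pair_big xpredT xpredT (fun (i : 'I_m.+1) (j : 'I_n.+1) => pcoef p i j * (w1 ^+ i * w2 ^+ j))) /=.
rewrite exchange_big /=; apply: eq_bigr => j _.
rewrite -polyC_exp hornerM hornerC (horner_coef_wide _ (h2 j)) mulr_suml.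
by apply: eq_bigr => i _; rewrite mulrA.
Qed.

Lemma bideg_ex p : exists m n, bideg_le m n p.
Proof.
exists (\max_(j < size p) size (p`_j)%R), (size p); split => // j.
case: (ltnP j (size p)) => hj; last by rewrite nth_default // size_poly0.
by apply: leqW; rewrite (leq_bigmax (Ordinal hj)).
Qed.

Lemma H2_fin m n q f : H2 f -> H2 (fin m n q * f).
Proof.
move=> hf; rewrite /fin mulr_suml; apply: H2_sum => t _.
by rewrite -mulrA; apply: H2_Z; exact: H2_XnM.
Qed.

Lemma ev_XX (i j : nat) f w1 w2 : inD w1 -> inD w2 -> H2 f ->
  ev (XX i j * f) w1 w2 = w1 ^+ i * w2 ^+ j * ev f w1 w2.
Proof.
move=> h1 h2 hf; elim: i => [|i IH].
  elim: j => [|j IH]; first by rewrite /XX !mul1r.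
  have -> : XX 0 j.+1 * f = X2 * (XX 0 j * f) by rewrite /XX exprS; ring.
  by rewrite eval2_X2 // ?IH ?exprS; [ring|exact: H2_XnM].
have -> : XX i.+1 j * f = X1 * (XX i j * f) by rewrite /XX exprS; ring.
by rewrite eval2_X1 // ?IH ?exprS; [ring|exact: H2_XnM].
Qed.

Lemma ev_fin m n q f w1 w2 : inD w1 -> inD w2 -> H2 f ->
  ev (fin m n q * f) w1 w2 = fev m n q w1 w2 * ev f w1 w2.
Proof.
move=> h1 h2 hf; rewrite /fin mulr_suml eval2_sum //; last first.
  by move=> t _; rewrite -mulrA; apply: H2_Z; exact: H2_XnM.
rewrite /fev mulr_suml; apply: eq_bigr => t _.
by rewrite -mulrA eval2Z ?ev_XX ?mulrA //; exact: H2_XnM.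
Qed.

Lemma H2_pol p f : H2 f -> H2 (pol p * f).
Proof. by have [m [n h]] := bideg_ex p; rewrite (pol_fin h); exact: H2_fin. Qed.

Lemma H2_pol1 p : H2 (pol p).
Proof. by rewrite -[pol p]mulr1; apply: H2_pol; exact: H2_one. Qed.

Lemma ev_pol p f w1 w2 : inD w1 -> inD w2 -> H2 f ->
  ev (pol p * f) w1 w2 = peval p w1 w2 * ev f w1 w2.
Proof.
move=> h1 h2 hf; have [m [n h]] := bideg_ex p.
by rewrite (pol_fin h) (peval_fev _ _ h) ev_fin.
Qed.

Lemma ev_pol1 p w1 w2 : inD w1 -> inD w2 -> ev (pol p) w1 w2 = peval p w1 w2.
Proof.
move=> h1 h2; rewrite -[pol p]mulr1 ev_pol //; last exact: H2_one.
by rewrite eval2_1 // mulr1.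
Qed.

Lemma ip_fin m n q q' F K : H2 F -> H2 K ->
  ip (fin m n q * F) (fin m n q' * K) =
  \sum_(t : 'I_m.+1 * 'I_n.+1) \sum_(s : 'I_m.+1 * 'I_n.+1)
    q t.1 t.2 * (q' s.1 s.2)^* * ip (XX t.1 t.2 * F) (XX s.1 s.2 * K).
Proof.
move=> hF hK; have hF' (t : 'I_m.+1 * 'I_n.+1) : H2 (XX t.1 t.2 * F) by exact: H2_XnM.
have hK' (t : 'I_m.+1 * 'I_n.+1) : H2 (XX t.1 t.2 * K) by exact: H2_XnM.
rewrite {1}/fin mulr_suml ip2_suml;
  [|by move=> t _; rewrite -mulrA; apply: H2_Z|exact: H2_fin].
apply: eq_bigr => t _; rewrite -mulrA ip2Zl //; last exact: H2_fin.
rewrite /fin mulr_suml ip2_sumr //; last by move=> s _; rewrite -mulrA; apply: H2_Z.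
by rewrite mulr_sumr; apply: eq_bigr => s _; rewrite -mulrA ip2Zr // mulrA.
Qed.

Definition refl (m n : nat) (q : nat -> nat -> C) : nat -> nat -> C :=
  fun i j => (q (m - i)%N (n - j)%N)^*.

Lemma pol_refl m n p : pol (prefl m n p) = fin m n (refl m n (pcoef p)).
Proof.
apply: fps2_ext => i j; rewrite finE /pol /prefl coef_poly !ltnS andbC.
by case: (leqP j n) => hj /=; rewrite ?coef0 // coef_poly ltnS.
Qed.

Lemma peval_refl m n p w1 w2 :
  peval (prefl m n p) w1 w2 = fev m n (refl m n (pcoef p)) w1 w2.
Proof.
have bd : bideg_le m n (prefl m n p).
  split=> [|j]; first exact: size_poly.
  by rewrite coef_poly; case: ifP => _; rewrite ?size_poly0 // size_poly.
rewrite (peval_fev _ _ bd) /fev; apply: eq_bigr => t _; congr (_ * _).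
by rewrite /pcoef /prefl coef_poly ltn_ord coef_poly ltn_ord.
Qed.

(** On the torus a polynomial and its reflection have the same modulus. In coefficients: reversing
    the exponents turns the difference t - s into s - t, and the conjugation exchanges the two sums
    back. *)
Lemma refl_isometry m n q F K : H2 F -> H2 K ->
  ip (fin m n (refl m n q) * F) (fin m n (refl m n q) * K) =
  ip (fin m n q * F) (fin m n q * K).
Proof.
move=> hF hK; rewrite !ip_fin //.
pose r (t : 'I_m.+1 * 'I_n.+1) := (rev_ord t.1, rev_ord t.2).
have rK : involutive r by move=> [t1 t2]; rewrite /r /= !rev_ordK.
rewrite (reindex_inj (inv_inj rK)).
under eq_bigr do rewrite (reindex_inj (inv_inj rK)).
rewrite exchange_big; apply: eq_bigr => t _; apply: eq_bigr => s _.
have cK (x : nat) (y : 'I_x.+1) : (x - (x.+1 - y.+1))%N = y.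
  by rewrite subSS subKn // -ltnS.
rewrite /refl /= !cK conjCK [_ * q _ _]mulrC; congr (_ * _).
have hs1 : (s.1 <= m)%N by rewrite -ltnS. have hs2 : (s.2 <= n)%N by rewrite -ltnS.
have ht1 : (t.1 <= m)%N by rewrite -ltnS. have ht2 : (t.2 <= n)%N by rewrite -ltnS.
by apply: ip_XX_shift; rewrite ?subSS ?subnK ?subnKC // addnC subnK.
Qed.

End Polynomials.

(** * Bezout relation for coprime bivariate polynomials *)

Section Bezout.
Variable F : closedFieldType.
Local Notation A := {poly F}.
Implicit Types (p q g a : {poly A}) (k : A) (x : F).

Lemma vanish_divisible g x : map_poly (horner_eval x) g = 0 ->
  exists g1, g = ('X - x%:P) *: g1.
Proof.
move=> g0; exists (map_poly (fun c => c %/ ('X - x%:P)) g); apply/polyP => i.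
rewrite coefZ coef_map_id0 ?div0p // mulrC divpK // dvdp_XsubCl.
have := congr1 (fun h : A => h`_i) g0.
by rewrite coef_map /= coef0 /horner_eval => /eqP.
Qed.

(** Over an algebraically closed field, nonzero coefficients have a nonconstant common factor
    exactly when they have a common root x. *)
Definition primitive g := forall x, map_poly (horner_eval x) g != 0.

(** Each common root x of the coefficients is divided out, which lowers the degree of the leading
    coefficient. *)
Lemma primitive_part g : g != 0 ->
  exists (h : A) (g0 : {poly A}), g = h *: g0 /\ primitive g0.
Proof.
have [N] := ubnP (size (lead_coef g)); elim: N g => // N IH g; rewrite ltnS => szg g0.
have [pg|] := pselect (primitive g); first by exists 1, g; rewrite scale1r.
move=> /existsNP[x /negP/negPn/eqP/vanish_divisible[g1 gE]].
have g10 : g1 != 0 by apply: contraNneq g0 => g1E; rewrite gE g1E scaler0.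
have lt : (size (lead_coef g1) < N)%N.
  apply: leq_trans szg; rewrite gE lead_coefZ size_mul ?polyXsubC_eq0 ?lead_coef_eq0 //.
  by rewrite size_XsubC.
have [h [g2 [g1E pg2]]] := IH g1 lt g10.
by exists (('X - x%:P) * h), g2; rewrite gE g1E scalerA.
Qed.

(* Gauss' lemma, one linear factor of the scalar at a time. *)
Lemma primitive_divides k p a g : primitive g -> k != 0 -> k *: p = a * g ->
  exists a', p = g * a'.
Proof.
move=> pg; have [N] := ubnP (size k); elim: N k a => // N IH k a; rewrite ltnS => szk k0 E.
have [sz1|sz1] := boolP (size k == 1)%N.
  have [c c0 kE] := size_poly1P _ sz1.
  exists (c^-1%:P *: a); rewrite -scalerAr mulrC -E scalerA kE -polyCM mulVf // scale1r.
  by [].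
have [x /factor_theorem[k1 kE]] := closed_rootP _ sz1.
have k10 : k1 != 0 by apply: contraNneq k0 => k1E; rewrite kE k1E mul0r.
have : map_poly (horner_eval x) a * map_poly (horner_eval x) g = 0.
  rewrite -rmorphM /= -E; apply/polyP => i; rewrite coef_map coefZ coef0 /= /horner_eval.
  by rewrite hornerM kE hornerM hornerXsubC subrr mulr0 mul0r.
move=> /eqP; rewrite mulf_eq0 (negPf (pg x)) orbF => /eqP/vanish_divisible[a1 aE].
apply: (IH k1 a1) => //.
  by apply: leq_trans szk; rewrite kE size_mul ?polyXsubC_eq0 // size_XsubC addn2.
have X0 : 'X - x%:P != 0 :> A by rewrite polyXsubC_eq0.
have /eqP : ('X - x%:P) *: (k1 *: p - a1 * g) = 0.
  by rewrite scalerBr scalerA mulrC -kE E aE -scalerAl subrr.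
by rewrite -mul_polyC mulf_eq0 polyC_eq0 (negPf X0) subr_eq0 => /eqP.
Qed.

(** The resultant lies in the ideal. If it were zero, the gcd of p and q in the outer variable would
    be nonconstant, and its primitive part would be a forbidden common factor. The cases of outer
    degree 0 are apart because the resultant identity asks for positive degrees. *)
Lemma bezout_outer p q : p != 0 ->
  (forall d a b, p = d * a -> q = d * b -> exists c : F, d = c%:P%:P) ->
  exists (u v : {poly A}) (r : A), r != 0 /\ u * p + v * q = r%:P.
Proof.
move=> p0 ncf.
have [szp|szp] := leqP (size p) 1.
  exists 1, 0, p`_0; rewrite mul1r mul0r addr0 -size1_polyC //; split => //.
  by apply: contraNneq p0 => E; rewrite (size1_polyC szp) E.
have q0 : q != 0.
  apply/eqP => q0; have [||c pE] := ncf p 1 0; rewrite ?mulr1 ?mulr0 //.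
  by move: szp; rewrite pE ltnNge size_polyC_leq1.
have [szq|szq] := leqP (size q) 1.
  exists 0, 1, q`_0; rewrite mul1r mul0r add0r -size1_polyC //; split => //.
  by apply: contraNneq q0 => E; rewrite (size1_polyC szq) E.
have [[u v] /= _ E] := resultant_in_ideal szp szq.
exists u, v, (resultant p q); split => //; rewrite resultant_eq0 -leqNgt.
set g := Pdiv.Idomain.gcdp p q.
have g0 : g != 0 by rewrite Pdiv.Idomain.gcdp_eq0 negb_and p0.
have [h [g1 [gE pg1]]] := primitive_part g0.
have h0 : h != 0 by apply: contraNneq g0 => hE; rewrite gE hE scale0r.
(* The gcd comes from pseudo-division and divides s only up to a scalar k; primitivity of [g1]
   removes k. *)
have div s : s \in [:: p; q] -> exists a, s = g1 * a.
  move=> hs; have /Pdiv.Idomain.dvdpP[[k a] /= k0 ka] : Pdiv.Idomain.dvdp g s.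
    by move: hs; rewrite !inE => /orP[]/eqP->; [exact: Pdiv.Idomain.dvdp_gcdl|exact: Pdiv.Idomain.dvdp_gcdr].
  apply: (@primitive_divides k s (h *: a)) => //.
  by rewrite ka gE -scalerAl -scalerAr.
have [|a pE] := div p; first by rewrite !inE eqxx.
have [|b qE] := div q; first by rewrite !inE eqxx orbT.
have [c g1E] := ncf _ _ _ pE qE.
apply: leq_trans (size_polyC_leq1 (h * c%:P)).
by rewrite gE g1E -mul_polyC -polyCM.
Qed.

End Bezout.

(** * Coefficient bounds for the inverse of a zero-free polynomial *)

Section InverseBound.
Variable R : realType.
Local Notation C := (R[i]).
Local Notation fps2 := (fps (fps C)).
Implicit Types (P Q : {poly C}) (a w z : C) (f g : fps2).

(** Cauchy's estimate without integrals. Write P(z) = E(z^2) + z O(z^2); half the sum and half the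
    difference of P(z) and P(-z) bound E and O by M on the circle, all of whose points are squares.
    Every coefficient of P is one of E or O, which have lower degree. *)
Lemma coef_le_sup P (M : R) : (forall z, nrm z = 1 -> nrm P.[z] <= M) ->
  forall i, nrm P`_i <= M.
Proof.
have [N] := ubnP (size P); elim: N P => // N IH P; rewrite ltnS => szP hP i.
have M0 : 0 <= M by apply: le_trans (hP 1 (nrm1 R)); exact: nrm_ge0.
have [sz1|sz1] := leqP (size P) 1.
  case: i => [|i]; last by rewrite nth_default ?nrm0 // (leq_trans sz1).
  by have := hP 1 (nrm1 R); rewrite [in P.[1]](size1_polyC sz1) hornerC.
have EO := poly_even_odd P.
have two : nrm (2^-1 : C) = 2^-1.
  by rewrite nrmV (_ : (2 : C) = rc 2) ?nrm_rc //; apply: complex_ext; rewrite //= addr0.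
have half z : nrm z = 1 -> nrm (even_poly P).[z ^+ 2] <= M /\
    nrm (odd_poly P).[z ^+ 2] <= M.
  move=> hz; have h1 := hP z hz.
  have h2 : nrm P.[- z] <= M by apply: hP; rewrite nrmN.
  have e1 : P.[z] = (even_poly P).[z ^+ 2] + (odd_poly P).[z ^+ 2] * z.
    by rewrite -{1}EO hornerD hornerM !horner_comp hornerXn hornerX.
  have e2 : P.[- z] = (even_poly P).[z ^+ 2] - (odd_poly P).[z ^+ 2] * z.
    by rewrite -{1}EO hornerD hornerM !horner_comp hornerXn hornerX sqrrN mulrN.
  have f1 : (even_poly P).[z ^+ 2] = 2^-1 * (P.[z] + P.[- z]).
    by rewrite e1 e2; field.
  have f2 : (odd_poly P).[z ^+ 2] * z = 2^-1 * (P.[z] - P.[- z]).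
    by rewrite e1 e2; field.
  split.
    rewrite f1 nrmM two; have := nrmD P.[z] P.[- z]; lra.
  rewrite -[nrm _]mulr1 -hz -nrmM f2 nrmM two.
  have := nrmD P.[z] (- P.[- z]); rewrite nrmN; lra.
have sq w : nrm w = 1 -> exists2 z, nrm z = 1 & z ^+ 2 = w.
  move=> hw; exists (sqrtc w); last exact: sqr_sqrtc.
  apply/eqP; rewrite -(@eqrXn2 _ 2) ?nrm_ge0 // -nrmX sqr_sqrtc hw expr1n //.
have lte : (size (even_poly P) < N)%N.
  apply: leq_trans szP; apply: leq_ltn_trans (size_even_poly P) _.
  by rewrite uphalf_half; have := odd_double_half (size P); lia.
have lto : (size (odd_poly P) < N)%N.
  apply: leq_trans szP; apply: leq_ltn_trans (size_odd_poly P) _.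
  by have := odd_double_half (size P); lia.
rewrite -(odd_double_half i); case: (odd i) => /=.
  rewrite add1n -coef_odd_poly; apply: IH => // w /sq[z hz <-].
  by have [] := half z hz.
rewrite add0n -coef_even_poly; apply: IH => // w /sq[z hz <-].
by have [] := half z hz.
Qed.

Definition pol1 P : fps C := fun i => P`_i.
Fact pol1_is_additive : zmod_morphism pol1.
Proof. by move=> p q; apply/funext => i; rewrite fpsB /pol1 coefB. Qed.
HB.instance Definition _ := GRing.isZmodMorphism.Build _ _ pol1 pol1_is_additive.
Fact pol1_is_multiplicative : monoid_morphism pol1.
Proof.
split; first by apply/funext => i; rewrite /pol1 coef1.
by move=> p q; apply/funext => i; rewrite /pol1 coefM.
Qed.
HB.instance Definition _ := GRing.isMonoidMorphism.Build _ _ pol1 pol1_is_multiplicative.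

Lemma pol1C a : pol1 a%:P = fpsC a.
Proof. by apply/funext => -[|i]; rewrite /pol1 coefC. Qed.
Lemma pol1X : pol1 'X = fpsX C.
Proof. by apply/funext => i; rewrite /pol1 coefX. Qed.

Lemma pol1_XsubCM a (k : fps C) i :
  (pol1 ('X - a%:P) * k) i = (if i is i'.+1 then k i' else 0) - a * k i.
Proof. by rewrite rmorphB /= pol1C pol1X mulrBl fpsB fpsXM fpsCM. Qed.

(** One root at a time: h = (z - a) k means a k_i = k_(i-1) - h_i. Summing moduli gives (|a| - 1) S
    <= sum of |h_i|, where S is the sum of the |k_i|, and |a| - 1 >= |a| (1 - b). *)
Lemma div_l1 (rs : seq C) (b : R) (k : fps C) : 0 <= b < 1 ->
  {in rs, forall a, 1 <= b * nrm a} ->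
  forall N, \sum_(i < N) nrm (k i) <= (\prod_(a <- rs) (nrm a * (1 - b))^-1) *
     \sum_(i < N) nrm ((pol1 (\prod_(a <- rs) ('X - a%:P)) * k) i).
Proof.
move=> /andP[b0 b1]; elim: rs k => [|a rs IH] k hrs N.
  by rewrite !big_nil mul1r rmorph1 mul1r.
have ha : 1 <= b * nrm a by apply: hrs; rewrite mem_head.
have na : 0 < nrm a.
  by rewrite lt_neqAle nrm_ge0 andbT; apply/eqP => E; move: ha; rewrite -E mulr0 ler10.
rewrite !big_cons rmorphM /= -mulrA.
set Q : {poly C} := \prod_(j <- rs) ('X - j%:P); set h := pol1 ('X - a%:P) * (pol1 Q * k).
have {}IH := IH k _ N; set K := \prod_(j <- rs) _ in IH *.
have K0 : 0 <= K.
  by apply: prodr_ge0 => j _; rewrite invr_ge0 mulr_ge0 ?nrm_ge0 // subr_ge0 ltW.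
apply: le_trans (IH _) _; first by move=> x hx; apply: hrs; rewrite in_cons hx orbT.
rewrite -mulrA mulrCA; apply: ler_wpM2l => //.
have pos : 0 < nrm a * (1 - b) by rewrite mulr_gt0 // subr_gt0.
rewrite ler_pdivlMl //.
set l := pol1 Q * k; pose S := \sum_(i < N) nrm (l i); rewrite -/S.
have main : nrm a * S <= S + \sum_(i < N) nrm (h i).
  apply: le_trans (_ : \sum_(i < N) (nrm (if (i : nat) is i'.+1 then l i' else 0) + nrm (h i)) <= _).
    rewrite /S mulr_sumr; apply: ler_sum => i _; rewrite -nrmM.
    have -> : a * l i = (if (i : nat) is i'.+1 then l i' else 0) + - h i.
      by rewrite /h -/l pol1_XsubCM opprB addrC subrK.
    by rewrite -[nrm (h i)]nrmN nrmD.
  rewrite big_split /=; apply: lerD => //; rewrite /S; case: (N) => [|N']; first by rewrite !big_ord0.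
  rewrite big_ord_recl nrm0 add0r big_ord_recr /= lerDl; exact: nrm_ge0.
have S0 : 0 <= S by apply: sumr_ge0 => i _; exact: nrm_ge0.
have : S * 1 <= S * (b * nrm a) by apply: ler_wpM2l.
nra.
Qed.

(** The bound involves only P(0), M and b, hence is uniform over all lines through the origin to
    which p is restricted below. *)
Lemma inv_l1 P (b : R) (u : fps C) M : 0 <= b < 1 -> P != 0 -> (size P <= M.+1)%N ->
  (forall z, P.[z] = 0 -> 1 <= b * nrm z) -> pol1 P * u = 1 ->
  forall N, \sum_(i < N) nrm (u i) <= (nrm P`_0)^-1 * (1 - b)^-1 ^+ M.
Proof.
move=> hb P0 szP hz Pu N; have [rs PE] := closed_field_poly_normal P.
set c := lead_coef P in PE; have c0 : c != 0 by rewrite lead_coef_eq0.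
have /andP[b0 b1] := hb.
have hrs : {in rs, forall a, 1 <= b * nrm a}.
  move=> a ha; apply: hz; rewrite PE hornerZ; apply/eqP; rewrite mulf_eq0.
  by apply/orP; right; have := root_prod_XsubC rs a; rewrite ha => /rootP ->.
have szr : (size rs <= M)%N.
  by move: szP; rewrite PE size_scale // size_prod_XsubC ltnS.
have P00 : nrm P`_0 = nrm c * \prod_(a <- rs) nrm a.
  rewrite -horner_coef0 {1}PE hornerZ nrmM horner_prod nrm_prod; congr (_ * _).
  by apply: eq_bigr => a _; rewrite hornerXsubC sub0r nrmN.
apply: le_trans (div_l1 u hb hrs N) _.
have Qu : pol1 (\prod_(a <- rs) ('X - a%:P)) * u = fpsC c^-1.
  have E : fpsC c * (pol1 (\prod_(a <- rs) ('X - a%:P)) * u) = 1.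
    by rewrite mulrA -Pu {1}PE -mul_polyC rmorphM /= pol1C.
  by rewrite -[RHS]mulr1 -E [RHS]mulrA -rmorphM /= mulVf // rmorph1 mul1r.
have -> : \prod_(a <- rs) (nrm a * (1 - b))^-1 =
   (\prod_(a <- rs) nrm a)^-1 * (1 - b)^-1 ^+ size rs.
  elim: (rs) => [|a s IH]; first by rewrite !big_nil invr1 mulr1.
  by rewrite !big_cons IH /= exprS !invfM; ring.
have S1 : \sum_(i < N) nrm ((pol1 (\prod_(a <- rs) ('X - a%:P)) * u) i) <= (nrm c)^-1.
  rewrite Qu; case: (N) => [|N']; first by rewrite big_ord0 invr_ge0 nrm_ge0.
  by rewrite big_ord_recl /= nrmV big1 ?addr0 // => i _; exact: nrm0.
rewrite P00 invfM.
apply: le_trans (ler_wpM2l _ S1) _.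
  by rewrite mulr_ge0 ?invr_ge0 ?exprn_ge0 ?invr_ge0 ?subr_ge0 ?(ltW b1) // prodr_ge0 // => a _; exact: nrm_ge0.
rewrite [leLHS]mulrC [leLHS]mulrA; apply: ler_wpM2l.
  by rewrite mulr_ge0 ?invr_ge0 ?nrm_ge0 // prodr_ge0 // => a _; exact: nrm_ge0.
apply: ler_weXn2l => //; rewrite invf_ge1 ?subr_gt0 //; lra.
Qed.

(** * Restriction to complex lines through the origin *)

Definition scl (y : C) (a : fps C) : fps C := fun n => a n * y ^+ n.
Lemma sclM y (a b : fps C) : scl y (a * b) = scl y a * scl y b.
Proof.
apply/funext => n; rewrite /scl fpsM mulr_suml; apply: eq_bigr => i _.
have -> : y ^+ n = y ^+ i * y ^+ (n - i) by rewrite -exprD subnKC // -ltnS.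
by ring.
Qed.
Lemma scl_sum y (I : Type) (s : seq I) (Pr : pred I) (F : I -> fps C) :
  scl y (\sum_(i <- s | Pr i) F i) = \sum_(i <- s | Pr i) scl y (F i).
Proof. by apply/funext => n; rewrite /scl !fps_sum mulr_suml. Qed.

(* the one-variable series f(x1 t, x2 t) in t *)
Definition dg (x1 x2 : C) f : fps C :=
  fun k => \sum_(i < k.+1) f i (k - i)%N * (x1 ^+ i * x2 ^+ (k - i)).

(** f truncated in z1, with z2 = x2 t put into its coefficients. Its value at x1 t agrees with [dg]
    below order N, so [dg] is multiplicative because evaluation of polynomials is. *)
Definition outer (N : nat) (x2 : C) f : {poly fps C} := \poly_(i < N) scl x2 (f i).

Lemma horner_line (x1 : C) (D : {poly fps C}) k N : (k < N)%N ->
  D.[fpsC x1 * fpsX C] k = \sum_(i < k.+1) D`_i (k - i)%N * x1 ^+ i.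
Proof.
move=> kN; rewrite (@horner_coef_wide _ (maxn k.+1 (size D))) ?leq_maxr // fps_sum.
have E i : (D`_i * (fpsC x1 * fpsX C) ^+ i) k = if (i <= k)%N then D`_i (k - i)%N * x1 ^+ i else 0.
  rewrite exprMn mulrCA -rmorphXn fpsCM mulrC [D`_i * _]mulrC fpsXnM.
  by case: ifP; rewrite ?mul0r.
under eq_bigr do rewrite E.
rewrite -big_mkcond /= (big_ord_widen _ (fun i => D`_i (k - i)%N * x1 ^+ i) (leq_maxl k.+1 (size D))).
by apply: eq_bigl => i; rewrite ltnS.
Qed.

Lemma dg_outer x1 x2 f k N : (k < N)%N -> dg x1 x2 f k = (outer N x2 f).[fpsC x1 * fpsX C] k.
Proof.
move=> kN; rewrite (horner_line _ _ kN); apply: eq_bigr => i _.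
have iN : (i < N)%N by apply: leq_ltn_trans kN; rewrite -ltnS.
by rewrite /outer coef_poly iN /scl [x1 ^+ _ * _]mulrC mulrA.
Qed.

Lemma dgM x1 x2 f g : dg x1 x2 (f * g) = dg x1 x2 f * dg x1 x2 g.
Proof.
apply/funext => k; rewrite (@dg_outer _ _ _ _ k.+1) //.
have -> : (dg x1 x2 f * dg x1 x2 g) k =
   ((outer k.+1 x2 f * outer k.+1 x2 g).[fpsC x1 * fpsX C]) k.
  rewrite hornerM !fpsM; apply: eq_bigr => i _.
  by rewrite !(@dg_outer _ _ _ _ k.+1) // ?ltnS ?leq_subr // -ltnS.
rewrite !(@horner_line _ _ _ k.+1) //; apply: eq_bigr => i _.
rewrite coefM coef_poly ltn_ord fpsM scl_sum fps_sum fps_sum; congr (_ * _).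
apply: eq_bigr => j _; rewrite sclM !coef_poly.
have ji : (j < k.+1)%N by rewrite (leq_ltn_trans _ (ltn_ord i)) // -ltnS.
by rewrite ji (leq_ltn_trans (leq_subr _ _) (ltn_ord i)).
Qed.

Lemma dg1 x1 x2 : dg x1 x2 1 = 1.
Proof.
apply/funext => k; rewrite /dg fps1 big_ord_recl fps21 subn0 /= !mul1r big1 ?addr0.
  by case: k => [|k] /=; rewrite ?mul0r // expr0 mulr1.
by move=> i _; rewrite fps21 /= mul0r.
Qed.

Lemma dgD x1 x2 f g : dg x1 x2 (f + g) = dg x1 x2 f + dg x1 x2 g.
Proof.
by apply/funext => k; rewrite fpsD /dg -big_split; apply: eq_bigr => i _ /=; rewrite mulrDl.
Qed.

Lemma dg_sum x1 x2 (I : Type) (s : seq I) (Pr : pred I) (F : I -> fps2) :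
  dg x1 x2 (\sum_(i <- s | Pr i) F i) = \sum_(i <- s | Pr i) dg x1 x2 (F i).
Proof.
apply: (big_morph (dg x1 x2)); first exact: dgD.
by apply/funext => k; rewrite /dg big1 // => i _; rewrite mul0r.
Qed.

Lemma dg_mono x1 x2 a (i j : nat) :
  dg x1 x2 (csc a * XX R i j) = pol1 ((a * (x1 ^+ i * x2 ^+ j)) *: 'X^(i + j)).
Proof.
apply/funext => k; rewrite /pol1 coefZ coefXn /dg.
have E (l : 'I_k.+1) : (csc a * XX R i j) l (k - l)%N * (x1 ^+ l * x2 ^+ (k - l)) =
   if ((l : nat) == i) && (k == i + j)%N then a * (x1 ^+ i * x2 ^+ j) else 0.
  rewrite cscM XXE; have lk : (l <= k)%N by rewrite -ltnS.
  case: (altP ((l : nat) =P i)) => [li|]; rewrite /= ?mulr0 ?mul0r //.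
  rewrite -li -(eqn_add2l l) subnKC //.
  case: eqP => [kE|_]; rewrite /= ?mulr0 ?mul0r // mulr1.
  by have -> : (k - l)%N = j by move: (l : nat) kE => x ->; rewrite addKn.
under eq_bigr do rewrite E.
case: eqP => [kE|_]; last by rewrite mulr0 big1 // => l _; rewrite andbF.
have hi : (i < k.+1)%N by rewrite ltnS kE leq_addr.
rewrite mulr1 (bigD1 (Ordinal hi)) //= eqxx /= big1 ?addr0 // => l.
by rewrite -val_eqE /= => /negPf ->.
Qed.

(** On a line s -> (b s, b z s) with |z| = 1, p has no zero for |s| < 1/b, so [inv_l1] bounds the
    coefficients of 1/p along the line, uniformly in z. As a function of z such a coefficient is a
    polynomial, and [coef_le_sup] isolates its coefficients. *)
Lemma inverse_coef_bound m n (p : {poly {poly C}}) (c : fps2) (b : R) :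
  bideg_le m n p -> no_zeros_D2 p -> pol p * c = 1 -> 0 < b < 1 ->
  exists A : R, 0 <= A /\ forall i j, nrm (c i j) * b ^+ (i + j) <= A.
Proof.
move=> bd nz pc /andP[b0 b1]; pose A := (nrm p`_0`_0)^-1 * (1 - b)^-1 ^+ (m + n).
have A0 : 0 <= A by rewrite mulr_ge0 ?invr_ge0 ?nrm_ge0 // exprn_ge0 // invr_ge0 subr_ge0 ltW.
exists A; split => // i j; pose k := (i + j)%N.
(* The homogeneous part of c of degree k = i + j at (b, b z), as a polynomial in z. *)
pose q : {poly C} := \poly_(l < k.+1) (rc (b ^+ k) * c (k - l)%N l).
have -> : nrm (c i j) * b ^+ (i + j) = nrm q`_j.
  rewrite coef_poly ltnS leq_addl /k addnK nrmM nrm_rc ?exprn_ge0 ?(ltW b0) //.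
  by rewrite mulrC.
apply: coef_le_sup => z hz.
pose t1 := rc b; pose t2 := rc b * z.
have -> : q.[z] = dg t1 t2 c k.
  rewrite horner_poly (reindex_inj rev_ord_inj) /dg; apply: eq_bigr => l _ /=.
  have lk : (l <= k)%N by rewrite -ltnS.
  rewrite subSS subKn // /t1 /t2 exprMn rcX.
  have -> : rc b ^+ k = rc b ^+ l * rc b ^+ (k - l) by rewrite -exprD subnKC.
  ring.
pose Q : {poly C} := \sum_(t : 'I_m.+1 * 'I_n.+1)
   (pcoef p t.1 t.2 * (t1 ^+ t.1 * t2 ^+ t.2)) *: 'X^(t.1 + t.2).
have QE : dg t1 t2 (pol p) = pol1 Q.
  rewrite (pol_fin bd) /fin dg_sum rmorph_sum; apply: eq_bigr => t _.
  exact: dg_mono.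
have Qu : pol1 Q * dg t1 t2 c = 1 by rewrite -QE -dgM pc dg1.
have Qz s : Q.[s] = peval p (s * t1) (s * t2).
  rewrite (peval_fev _ _ bd) /fev horner_sum; apply: eq_bigr => t _.
  by rewrite hornerZ hornerXn !exprMn exprD; ring.
have nt1 : nrm t1 = b by rewrite nrm_rc // ltW.
have nt2 : nrm t2 = b by rewrite nrmM hz mulr1 nrm_rc // ltW.
have Q0 : Q`_0 = p`_0`_0.
  by rewrite -horner_coef0 Qz !mul0r /peval polyC0 !horner_coef0.
have nzQ s : Q.[s] = 0 -> 1 <= b * nrm s.
  rewrite Qz => E; rewrite leNgt; apply/negP => h.
  have := nz (s * t1) (s * t2); rewrite E eqxx !inDE [nrm (s * t1)]nrmM [nrm (s * t2)]nrmM nt1 nt2 mulrC h.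
  by move=> /(_ isT isT).
have Qn0 : Q != 0.
  apply: contraTneq (nz 0 0 (inD0 R) (inD0 R)) => Q00.
  by have := Qz 0; rewrite Q00 horner0 !mul0r => <-; rewrite eqxx.
have szQ : (size Q <= (m + n).+1)%N.
  apply: (leq_trans (size_sum _ _ _)); apply/bigmax_leqP => t _.
  apply: leq_trans (size_scale_leq _ _) _; by rewrite size_polyXn ltnS; apply: leq_add; rewrite -ltnS.
have := inv_l1 (b := b) _ Qn0 szQ nzQ Qu k.+1.
rewrite Q0 (ltW b0) b1 => /(_ isT); apply: le_trans.
rewrite big_ord_recr /= lerDr; apply: sumr_ge0 => l _; exact: nrm_ge0.
Qed.

End InverseBound.

(** * Truncation and weak decay *)

Section Truncation.
Variable R : realType.
Local Notation C := (R[i]).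
Local Notation fps2 := (fps (fps C)).
Local Notation XX := (XX R).
Implicit Types (f g F G K : fps2).

Lemma fps2M f g i j : (f * g) i j =
  \sum_(a < i.+1) \sum_(b < j.+1) f a b * g (i - a)%N (j - b)%N.
Proof. by rewrite fpsM fps_sum; apply: eq_bigr => a _; rewrite fpsM. Qed.

Lemma ip_XXl F (i j : nat) : H2 F -> ip (XX i j) F = (F i j)^*.
Proof. by move=> hF; rewrite ip2C ?ip2_XX //; exact: H2_XX. Qed.

Lemma fin_ord m n q (t : 'I_m.+1 * 'I_n.+1) : fin m n q t.1 t.2 = q t.1 t.2 :> C.
Proof.
have h1 : (t.1 <= m)%N by rewrite -ltnS.
have h2 : (t.2 <= n)%N by rewrite -ltnS.
by rewrite finE h1 h2.
Qed.

Lemma H2_fin1 m n q : H2 (fin m n q : fps2).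
Proof. by rewrite -[fin m n q]mulr1; apply: H2_fin; exact: H2_one. Qed.

Lemma ip_finl m n q F G : H2 F -> H2 G -> ip (fin m n q * F) G =
  \sum_(t : 'I_m.+1 * 'I_n.+1) q t.1 t.2 * ip (XX t.1 t.2 * F) G.
Proof.
move=> hF hG; rewrite /fin mulr_suml ip2_suml //; last first.
  by move=> t _; rewrite -mulrA; apply: H2_Z; exact: H2_XnM.
by apply: eq_bigr => t _; rewrite -mulrA ip2Zl //; exact: H2_XnM.
Qed.

Lemma ip_fin1l m n q G : H2 G -> ip (fin m n q) G =
  \sum_(t : 'I_m.+1 * 'I_n.+1) q t.1 t.2 * (G t.1 t.2)^*.
Proof.
move=> hG; rewrite -[fin m n q]mulr1 ip_finl //; last exact: H2_one.
by apply: eq_bigr => t _; rewrite mulr1 ip_XXl.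
Qed.

Lemma nN_pair N f : nN N.+1 f = \sum_(t : 'I_N.+1 * 'I_N.+1) sqmod (f t.1 t.2).
Proof.
by rewrite /nN (pair_big xpredT xpredT (fun (i j : 'I_N.+1) => sqmod (f i j))).
Qed.

Lemma n2_trunc f N : H2 f -> n2 (f - fin N N f) = n2 f - nN N.+1 f.
Proof.
move=> hf; have hT := H2_fin1 N N f; have hD := H2_B hf hT.
have E1 : ip (fin N N f) f = rc (nN N.+1 f).
  rewrite ip_fin1l // nN_pair rc_sum; apply: eq_bigr => t _; exact: mulJ.
have E2 : ip (fin N N f) (fin N N f) = rc (nN N.+1 f).
  rewrite ip_fin1l // nN_pair rc_sum; apply: eq_bigr => t _.
  by rewrite fin_ord mulJ.
suff E : rc (n2 (f - fin N N f)) = rc (n2 f - nN N.+1 f) by case: E.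
rewrite -ip2_n2 // ip2Bl // !ip2Br // E1 E2 (ip2C hT hf) E1 rcJ subrr subr0 ip2_n2 //.
by apply: complex_ext; rewrite ?ReD ?ImD /= ?oppr0 ?addr0.
Qed.

Lemma n2_fin_le f N : H2 f -> n2 (fin N N f) <= n2 f.
Proof.
move=> hf; have hT := H2_fin1 N N f.
suff -> : n2 (fin N N f) = nN N.+1 f by exact: nN_le_n2.
suff E : rc (n2 (fin N N f)) = rc (nN N.+1 f) by case: E.
rewrite -ip2_n2 // ip_fin1l // nN_pair rc_sum; apply: eq_bigr => t _.
by rewrite fin_ord mulJ.
Qed.

Lemma trunc_small f (e : R) : H2 f -> 0 < e ->
  exists N0, forall N, (N0 <= N)%N -> n2 (f - fin N N f) <= e.
Proof.
move=> hf e0; have /cvgrPdist_le/(_ e e0)[N0 _ h] := nN_cvg hf.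
exists N0 => N hN; rewrite n2_trunc //; apply: le_trans (ler_norm _) _.
by apply: h => /=; exact: leqW.
Qed.

Lemma sqmod_small (z : C) (K : R) : (forall e : R, 0 < e -> sqmod z <= K * e) -> z = 0.
Proof.
move=> h; apply/eqP; rewrite -nrm_eq0 -sqrf_eq0 -sqmodE; apply/negPn/negP => z0.
have zp : 0 < sqmod z by rewrite lt_neqAle eq_sym z0 sqmod_ge0.
have K0 : 0 < K by rewrite -(mulr1 K); apply: lt_le_trans zp (h 1 ltr01).
have := h (sqmod z / (2 * K)) (divr_gt0 zp (mulr_gt0 (ltr0Sn R 1) K0)).
rewrite (_ : K * _ = sqmod z / 2); last by field; rewrite gt_eqF.
lra.
Qed.

(** Up to a small error G is a polynomial, and z2^k F is orthogonal to it once k exceeds its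
    z2-degree. *)
Lemma shift_decay F G (e : R) : H2 F -> H2 G -> 0 < e ->
  exists k0, forall k, (k0 <= k)%N -> sqmod (ip (XX 0 k * F) G) <= n2 F * e.
Proof.
move=> hF hG e0; have [N0 hN] := trunc_small hG e0; exists N0.+1 => k hk.
have hT := H2_fin1 N0 N0 G; have hD := H2_B hG hT; have hX := H2_XnM 0 k hF.
have -> : ip (XX 0 k * F) G = ip (XX 0 k * F) (G - fin N0 N0 G).
  rewrite ip2Br // [X in _ - X](_ : _ = 0) ?subr0 //.
  rewrite ip2C // ip_fin1l // big1 ?conjC0 // => t _.
  rewrite XXM /= [(k <= _)%N]leqNgt (leq_trans (ltn_ord t.2) hk) /= conjC0 mulr0 //.
apply: le_trans (cauchy_schwarz hX hD) _.
have -> : n2 (XX 0 k * F) = n2 F.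
  by suff E : rc (n2 (XX 0 k * F)) = rc (n2 F); [case: E|rewrite -!ip2_n2 // ip2_XnM].
by apply: ler_wpM2l; [exact: n2_ge0|exact: hN].
Qed.

Lemma near01 : \forall r \near (1 : R)^'-, 0 < r < 1.
Proof.
by near=> r; apply/andP; split; near: r; [exact: nbhs_left_gt|exact: nbhs_left_lt].
Unshelve. all: by end_near. Qed.

Lemma radial_id : ctends ((1 : R)^'- : set_system R) (fun r => rc r) 1.
Proof. by apply: (ctends_rc (x := id)); apply: cvg_within. Qed.

Lemma pol_of_fin m n q : exists a, pol a = fin m n q :> fps2.
Proof.
exists (\poly_(j < n.+1) \poly_(i < m.+1) q i j); apply: fps2_ext => i j.
rewrite finE /pol coef_poly !ltnS andbC.
by case: (leqP j n) => hj /=; rewrite ?coef0 // coef_poly ltnS.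
Qed.

Lemma pol_XX (i j : nat) : exists a, pol a = XX i j :> fps2.
Proof.
have [a aE] := pol_of_fin i j (XX i j); exists a; rewrite aE; apply: fps2_ext => k l.
by rewrite finE XXE; case: ifPn => //; case: eqP => // ->; case: eqP => // ->; rewrite !leqnn.
Qed.

(** The coefficient form of p~ = z1^m z2^n conj p on the torus. *)
Lemma refl_adjoint m n q F K : H2 F -> H2 K ->
  ip (fin m n (refl m n q) * F) K = ip (XX m n * F) (fin m n q * K).
Proof.
move=> hF hK; have hXF := H2_XnM m n hF.
rewrite ip_finl // ip2C //; last exact: H2_fin.
rewrite ip_finl // rmorph_sum.
pose r (t : 'I_m.+1 * 'I_n.+1) := (rev_ord t.1, rev_ord t.2).
have rK : involutive r by move=> [t1 t2]; rewrite /r /= !rev_ordK.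
rewrite (reindex_inj (inv_inj rK)); apply: eq_bigr => t _.
have h1 : (t.1 <= m)%N by rewrite -ltnS.
have h2 : (t.2 <= n)%N by rewrite -ltnS.
rewrite /refl rmorphM /= !subSS !subKn //; congr (_ * _).
rewrite -ip2C //; last exact: H2_XnM.
have KE : K = XX 0 0 * K by rewrite /XX !expr0 !mul1r.
rewrite {1}KE; by apply: ip_XX_shift => //; rewrite add0n subnKC.
Qed.

End Truncation.

(** * Multiplication by Theta is isometric *)

Section InnerIsometry.
Variable R : realType.
Local Notation C := (R[i]).
Local Notation fps2 := (fps (fps C)).
Local Notation XX := (XX R).
Local Notation rF := ((1 : R)^'- : set_system R).
Implicit Types (f g F G K : fps2).

(** [bezout_outer] eliminates the outer variable, which is z2; exchanging the variables first leaves
    a polynomial in z2 alone. *)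
Lemma bezout_z2 (p q : {poly {poly C}}) : p != 0 -> no_common_factor p q ->
  exists (u v : {poly {poly C}}) (r : {poly C}),
    r != 0 /\ u * p + v * q = map_poly polyC r.
Proof.
move=> p0 ncf; have sp0 : swapXY p != 0 by rewrite swapXY_eq0.
have [|u [v [r [r0 E]]]] := bezout_outer sp0 (q := swapXY q).
  move=> d a b pE qE; have [||c cE] := ncf (swapXY d) (swapXY a) (swapXY b).
  - by rewrite -(swapXYK p) pE rmorphM.
  - by rewrite -(swapXYK q) qE rmorphM.
  by exists c; rewrite -(swapXYK d) cE swapXY_polyC map_polyC.
exists (swapXY u), (swapXY v), r; split => //.
by rewrite -swapXY_polyC -E rmorphD !rmorphM /= !swapXYK.
Qed.

Variables (m n : nat) (p : {poly {poly C}}).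
Hypotheses (bd : bideg_le m n p) (nz : no_zeros_D2 p)
  (ncf : no_common_factor p (prefl m n p)).

Lemma p00_neq0 : p`_0`_0 != 0.
Proof.
by have := nz (inD0 R) (inD0 R); rewrite /peval polyC0 !horner_coef0.
Qed.

Lemma p_neq0 : p != 0.
Proof. by apply: contraNneq p00_neq0 => ->; rewrite !coef0. Qed.

Lemma pol_inverse : exists c : fps2, pol p * c = 1.
Proof.
have [y hy] : exists y : fps C, pol p 0%N * y = 1.
  apply: (@fps_inv_exists _ _ (p`_0`_0)^-1); exact: (mulfV p00_neq0).
exact: fps_inv_exists hy.
Qed.

Variable c : fps2.
Hypothesis pc : pol p * c = 1.

(** A product of formal series. Since [c] need not be in [H2], that [theta] is in [H2] requires an
    argument, given by [H2_theta]. *)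
Definition theta : fps2 := pol (prefl m n p) * c.

Lemma pol_theta : pol p * theta = pol (prefl m n p).
Proof. by rewrite /theta mulrCA pc mulr1. Qed.

(** * Dilates, and the pairing of Theta with polynomials *)

Definition sc (x : C) f : fps2 := fun i j => f i j * (x ^+ i * x ^+ j).

Lemma scM x f g : sc x (f * g) = sc x f * sc x g.
Proof.
apply: fps2_ext => i j; rewrite fps2M /sc fps2M mulr_suml; apply: eq_bigr => a _.
rewrite mulr_suml; apply: eq_bigr => b _.
have -> : x ^+ i = x ^+ a * x ^+ (i - a) by rewrite -exprD subnKC // -ltnS.
have -> : x ^+ j = x ^+ b * x ^+ (j - b) by rewrite -exprD subnKC // -ltnS.
ring.
Qed.

Let qr (x : C) i j : C := pcoef p i j * (x ^+ i * x ^+ j).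

Lemma sc_pol x : sc x (pol p) = fin m n (qr x).
Proof.
by apply: fps2_ext => i j; rewrite /sc (pol_fin bd) !finE /qr; case: ifP; rewrite ?mul0r.
Qed.

Lemma qr_inv x : fin m n (qr x) * sc x c = 1.
Proof.
rewrite -sc_pol -scM pc; apply: fps2_ext => i j; rewrite /sc fps21.
by case: i j => [|i] [|j]; rewrite /= ?mul0r // !expr0 !mulr1.
Qed.

Lemma H2_scc (r : R) : 0 < r < 1 -> H2 (sc (rc r) c).
Proof.
(* Any b strictly between r and 1 would do: the coefficients of c are at most A / b^(i+j), so the
   dilated ones decay like (r/b)^(i+j). *)
move=> /andP[r0 r1]; pose b := (1 + r) / 2.
have b0 : 0 < b by rewrite /b; lra.
have b1 : b < 1 by rewrite /b; lra.
have hb : 0 < b < 1 by rewrite b0 b1.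
have [A [A0 hA]] := inverse_coef_bound bd nz pc hb.
have hx : 0 <= r / b < 1.
  by rewrite divr_ge0 ?(ltW r0) ?(ltW b0) // ltr_pdivrMr // mul1r /b; lra.
apply: (proj1 (H2_geometric hx hx A0 _)) => i j.
rewrite /sc nrmM -exprD nrmX nrm_rc ?(ltW r0) // -exprD expr_div_n mulrA ler_pdivlMr ?exprn_gt0 //.
by rewrite mulrAC; apply: ler_wpM2r; [rewrite exprn_ge0 ?(ltW r0)|exact: hA].
Qed.

(** The reflection of the dilated polynomial over the dilated polynomial. This is not the dilate of
    [theta]: dilating first and reflecting afterwards makes [refl_isometry] applicable, and the norm
    is exactly 1. *)
Let thr (x : C) : fps2 := fin m n (refl m n (qr x)) * sc x c.

Lemma n2_1 : n2 (1 : fps2) = 1.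
Proof.
have h1 := @H2_one R; suff E : rc (n2 (1 : fps2)) = rc 1 by case: E.
rewrite -ip2_n2 // {2}(_ : 1 = XX 0 0) ?ip2_XX //.
by rewrite /XX !expr0 mulr1.
Qed.

Lemma n2_thr (r : R) : 0 < r < 1 -> H2 (thr (rc r)) /\ n2 (thr (rc r)) = 1.
Proof.
move=> hr; have hc := H2_scc hr; have hth : H2 (thr (rc r)) by exact: H2_fin.
split => //; suff E : rc (n2 (thr (rc r))) = rc 1 by case: E.
rewrite -ip2_n2 // /thr refl_isometry // qr_inv ip2_n2 ?n2_1 //; exact: H2_one.
Qed.

Lemma ctends_mono (a : C) i j : ctends rF
  (fun r => a * (rc r ^+ i * rc r ^+ j)) a.
Proof.
have : ctends rF
    (fun r => a * (rc r ^+ i * rc r ^+ j)) (a * (1 ^+ i * 1 ^+ j)).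
  apply: ctendsM; first exact: ctends_cst.
  by apply: ctendsM; apply: ctendsX; exact: radial_id.
by rewrite !expr1n !mulr1.
Qed.

Lemma ctends_thr i j : ctends rF (fun r => thr (rc r) i j) (theta i j).
Proof.
rewrite /theta pol_refl finM.
under eq_fun do rewrite /thr finM.
apply: ctends_sum => t _; apply: ctendsM; first by apply: ctendsJ; exact: ctends_mono.
exact: ctends_mono.
Qed.

(** Fatou: every partial sum for [theta] is a limit of partial sums for [thr], which are at most
    1. *)
Lemma H2_theta : H2 theta.
Proof.
apply: (@H2_bounded _ _ 1) => N.
have cv : nN N (thr (rc r)) @[r --> (1 : R)^'-] --> nN N theta.
  have E f : nN N f = complex.Re (ipN N f f) by rewrite ipN_n2.
  rewrite E; under eq_fun do rewrite E.
  suff: ctends rF (fun r => ipN N (thr (rc r)) (thr (rc r)))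
    (ipN N theta theta) by case.
  apply: ctends_sum => i _; apply: ctends_sum => j _; apply: ctendsM.
    exact: ctends_thr.
  by apply: ctendsJ; exact: ctends_thr.
rewrite -[X in X <= _](cvg_lim _ cv) //; apply: limr_le.
  by apply/cvg_ex; exists (nN N theta).
near=> r; have [|h1 h2] := @n2_thr r; first by near: r; exact: near01.
by rewrite -h2; exact: nN_le_n2.
Unshelve. all: by end_near. Qed.

Lemma H2_theta_pol a : H2 (theta * pol a).
Proof. by rewrite mulrC; apply: H2_pol; exact: H2_theta. Qed.

(** Pairing with a polynomial involves finitely many coefficients of G, hence passes to
    coefficientwise limits. *)
Lemma ip_fin_pol q a m' n' G : bideg_le m' n' a -> H2 G -> ip (fin m n q * pol a) G =
  \sum_(t : 'I_m.+1 * 'I_n.+1) \sum_(s : 'I_m'.+1 * 'I_n'.+1)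
   q t.1 t.2 * (pcoef a s.1 s.2 * (G (s.1 + t.1)%N (s.2 + t.2)%N)^*).
Proof.
move=> bda hG.
rewrite ip_finl //; last exact: H2_pol1.
apply: eq_bigr => t _; rewrite (pol_fin bda) [XX t.1 t.2 * _]mulrC ip_finl //; last exact: H2_XX.
by rewrite mulr_sumr; apply: eq_bigr => s _; rewrite XXD ip_XXl.
Qed.

Lemma ip_thr_pol a b (r : R) : 0 < r < 1 ->
  ip (fin m n (refl m n (qr (rc r))) * pol a) (thr (rc r) * pol b) =
  ip (fin m n (qr (rc r)) * pol a) (pol b).
Proof.
move=> hr; have hc := H2_scc hr.
have hK : H2 (sc (rc r) c * pol b) by rewrite mulrC; exact: H2_pol.
rewrite /thr -mulrA refl_isometry //; last exact: H2_pol1.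
by rewrite [fin m n _ * (_ * pol b)]mulrA qr_inv mul1r.
Qed.

Lemma ip_theta_pol a b : ip (pol (prefl m n p) * pol a) (theta * pol b) =
  ip (pol p * pol a) (pol b).
Proof.
have [m' [n' bda]] := bideg_ex a; have [m2 [n2 bdb]] := bideg_ex b.
have h1 : ctends rF (fun r => ip (fin m n (refl m n (qr (rc r))) * pol a) (thr (rc r) * pol b))
   (ip (pol (prefl m n p) * pol a) (theta * pol b)).
  rewrite pol_refl (ip_fin_pol _ bda); last exact: H2_theta_pol.
  have : ctends rF (fun r => \sum_(t : 'I_m.+1 * 'I_n.+1) \sum_(s : 'I_m'.+1 * 'I_n'.+1)
      refl m n (qr (rc r)) t.1 t.2 *
      (pcoef a s.1 s.2 * ((thr (rc r) * pol b) (s.1 + t.1)%N (s.2 + t.2)%N)^*))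
   (\sum_(t : 'I_m.+1 * 'I_n.+1) \sum_(s : 'I_m'.+1 * 'I_n'.+1)
      refl m n (pcoef p) t.1 t.2 *
      (pcoef a s.1 s.2 * ((theta * pol b) (s.1 + t.1)%N (s.2 + t.2)%N)^*)).
    apply: ctends_sum => t _; apply: ctends_sum => s _.
    apply: ctendsM; first by apply: ctendsJ; exact: ctends_mono.
    apply: ctendsM; first exact: ctends_cst.
    apply: ctendsJ; rewrite (pol_fin bdb) [theta * _]mulrC finM.
    under eq_fun do rewrite [thr _ * _]mulrC finM.
    apply: ctends_sum => u _; apply: ctendsM; first exact: ctends_cst.
    exact: ctends_thr.
  apply: ctends_near; near=> r; rewrite (ip_fin_pol _ bda) //.
  rewrite mulrC; apply: H2_pol; apply: (proj1 (n2_thr _)).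
  by near: r; exact: near01.
apply: (ctends_unique h1); apply: (@ctends_near _ _ _ _
    (fun r => ip (fin m n (qr (rc r)) * pol a) (pol b))).
  near=> r; rewrite ip_thr_pol //; by near: r; exact: near01.
rewrite (pol_fin bd) (ip_fin_pol _ bda); last exact: H2_pol1.
under eq_fun do (rewrite (ip_fin_pol _ bda); last exact: H2_pol1).
apply: ctends_sum => t _; apply: ctends_sum => s _.
apply: ctendsM; [exact: ctends_mono|exact: ctends_cst].
Unshelve. all: by end_near. Qed.

(* [defect] vanishes on the ideal generated by [p] and its reflection, hence on
   multiples of a polynomial in z2 alone; its roots are then peeled off using
   the weak decay of the powers of z2. *)
Definition defect a b : C := ip (pol a) (pol b) - ip (theta * pol a) (theta * pol b).

Lemma defectC a b : defect a b = (defect b a)^*.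
Proof.
rewrite /defect (ip2C (H2_pol1 b) (H2_pol1 a)).
have E2 := ip2C (H2_theta_pol b) (H2_theta_pol a).
by rewrite E2; exact/esym/rmorphB.
Qed.

Lemma defectD a a' b : defect (a + a') b = defect a b + defect a' b.
Proof.
have h1 := @H2_pol1 R; have h2 := H2_theta_pol.
by rewrite /defect rmorphD /= mulrDr !ip2Dl //; ring.
Qed.

Lemma pol_C (x : C) : pol x%:P%:P = csc x.
Proof.
by apply: fps2_ext => i j; rewrite -[csc x]mulr1 cscM fps21 /pol coefC;
   case: j => [|j]; rewrite ?coefC ?coef0 ?andbT ?andbF ?mulr0 //; case: i => [|i];
   rewrite ?mulr1 ?mulr0.
Qed.

Lemma defectZ (x : C) a b : defect (x%:P%:P * a) b = x * defect a b.
Proof.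
have h1 := @H2_pol1 R; have h2 := H2_theta_pol.
by rewrite /defect rmorphM /= pol_C mulrCA !ip2Zl //; ring.
Qed.

Lemma pol_X2 k : pol ('X ^+ k) = XX 0 k :> fps2.
Proof.
apply: fps2_ext => i j; rewrite XXE /pol coefXn.
case: eqP => _; rewrite ?andbT ?andbF; [exact: coef1|exact: coef0].
Qed.

Lemma defect_shift k a b : defect ('X ^+ k * a) ('X ^+ k * b) = defect a b.
Proof.
have h1 := @H2_pol1 R; have h2 := H2_theta_pol.
by rewrite /defect !rmorphM /= pol_X2 ![theta * (XX 0 k * _)]mulrCA !ip2_XnM.
Qed.

Lemma defect_p a b : defect (p * a) b = 0.
Proof.
rewrite /defect rmorphM /= -ip_theta_pol -pol_theta.
by rewrite [theta * (_ * _)]mulrCA mulrA subrr.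
Qed.

(** [refl_adjoint] moves the reflection to the other argument as p, at the price of the monomial
    z1^m z2^n, and [defect_p] applies there. *)
Lemma defect_prefl a b : defect (prefl m n p * a) b = 0.
Proof.
have h1 := @H2_pol1 R; have h2 := H2_theta_pol; have [x xE] := @pol_XX R m n.
have <- : defect (x * a) (p * b) = 0 by rewrite defectC defect_p conjC0.
rewrite /defect !rmorphM /= pol_refl (pol_fin bd) xE.
by rewrite ![theta * (_ * _)]mulrCA !refl_adjoint.
Qed.

Lemma defect_decay a b (e : R) : 0 < e -> exists k0, forall k, (k0 <= k)%N ->
  sqmod (defect ('X ^+ k * a) b) <= (2 * n2 (pol a) + 2 * n2 (theta * pol a)) * e.
Proof.
move=> e0; have h1 := @H2_pol1 R; have h2 := H2_theta_pol.
have [k1 hk1] := shift_decay (h1 a) (h1 b) e0.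
have [k2 hk2] := shift_decay (h2 a) (h2 b) e0.
exists (maxn k1 k2) => k; rewrite geq_max => /andP[/hk1 b1 /hk2 b2].
rewrite /defect rmorphM /= pol_X2 [theta * (_ * _)]mulrCA.
apply: le_trans (sqmodD_le _ _) _; rewrite [sqmod (- _)]sqmodE nrmN -sqmodE.
lra.
Qed.

(** The hypothesis gives [defect] (z2^k Q a, b) = x^k [defect] (Q a, b). If |x| >= 1, weak decay of
    the left side forces 0. If |x| < 1, shift both arguments by z2^k first: the value equals x^k
    [defect] (Q a, z2^k b), and the last factor decays. *)
Lemma defect_peel (x : C) (Q : {poly {poly C}}) :
  (forall a b, defect (('X - x%:P%:P) * Q * a) b = 0) ->
  forall a b, defect (Q * a) b = 0.
Proof.
move=> h; have step a b : defect ('X * (Q * a)) b = x * defect (Q * a) b.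
  have E : ('X - x%:P%:P) * Q * a = 'X * (Q * a) + (- x)%:P%:P * (Q * a).
    by rewrite !polyCN; ring.
  have := h a b; rewrite E defectD defectZ mulNr => /eqP.
  by rewrite subr_eq0 => /eqP.
have stepk k a b : defect ('X ^+ k * (Q * a)) b = x ^+ k * defect (Q * a) b.
  elim: k a => [|k IH] a; first by rewrite !mul1r.
  have -> : 'X ^+ k.+1 * (Q * a) = 'X ^+ k * (Q * ('X * a)) by rewrite exprSr; ring.
  by rewrite IH [Q * _]mulrCA step exprSr mulrA.
move=> a b; have [x1|x1] := leP 1 (nrm x).
  apply: sqmod_small => e e0; have [k0 hk] := defect_decay (Q * a) b e0.
  apply: le_trans (hk k0 (leqnn _)); rewrite stepk sqmodE [leRHS]sqmodE nrmM nrmX exprMn.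
  by rewrite ler_peMl ?sqr_ge0 // exprn_ege1 // exprn_ege1.
apply: sqmod_small => e e0; have [k0 hk] := defect_decay b (Q * a) e0.
apply: le_trans (hk k0 (leqnn _)); rewrite -(defect_shift k0) stepk.
rewrite [defect _ ('X ^+ k0 * b)]defectC !sqmodE nrmM nrmX nrmJ exprMn.
by rewrite ler_piMl ?sqr_ge0 // exprn_ile1 ?exprn_ge0 ?nrm_ge0 // exprn_ile1 ?nrm_ge0 ?ltW.
Qed.

Lemma defect_eq0 a b : defect a b = 0.
Proof.
have [u [v [r [r0 E]]]] := bezout_z2 p_neq0 ncf.
have h0 a' b' : defect (map_poly polyC r * a') b' = 0.
  by rewrite -E mulrDl defectD -[u * p * a']mulrA -[v * _ * a']mulrA (mulrCA u) (mulrCA v) defect_p defect_prefl addr0.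
have [rs rE] := closed_field_poly_normal r.
have l0 : lead_coef r != 0 by rewrite lead_coef_eq0.
move: (lead_coef r) rE l0 => l rE l0.
have h1 a' b' : defect (\prod_(z <- rs) ('X - z%:P%:P) * a') b' = 0.
  have ME : map_poly polyC r = l%:P%:P * \prod_(z <- rs) ('X - z%:P%:P).
    rewrite rE -mul_polyC rmorphM /= map_polyC rmorph_prod; congr (_ * _).
    by apply: eq_bigr => z _; rewrite rmorphB /= map_polyX map_polyC.
  have /eqP := h0 a' b'; rewrite ME -mulrA defectZ.
  by rewrite mulf_eq0 (negPf l0) => /eqP.
suff : forall a' b', defect (1 * a') b' = 0 by move=> /(_ a b); rewrite mul1r.
elim: (rs) h1 => [|z s IH] h1; first by move: h1; rewrite big_nil.
apply: IH; apply: (@defect_peel z) => a' b'.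
by have := h1 a' b'; rewrite big_cons.
Qed.

Lemma ip_theta_pols a b : ip (theta * pol a) (theta * pol b) = ip (pol a) (pol b).
Proof. by apply/esym/eqP; rewrite -subr_eq0; apply/eqP; exact: defect_eq0. Qed.

Lemma n2_theta_fin N f : n2 (theta * fin N N f) = n2 (fin N N f).
Proof.
have [a aE] := pol_of_fin N N f; rewrite -aE.
suff E : rc (n2 (theta * pol a)) = rc (n2 (pol a)) by case: E.
rewrite -!ip2_n2 ?ip_theta_pols //; by [exact: H2_pol1|exact: H2_theta_pol].
Qed.

Lemma theta_contraction f : H2 f -> H2 (theta * f) /\ n2 (theta * f) <= n2 f.
Proof.
move=> hf; have bnd N : nN N (theta * f) <= n2 f.
  (* Coefficients of low order of [theta * f] depend only on a truncation of f, and polynomials are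
     already settled. *)
  have -> : nN N (theta * f) = nN N (theta * fin N N f).
    apply: eq_bigr => i _; apply: eq_bigr => j _; congr (sqmod _).
    rewrite !fps2M; apply: eq_bigr => k _; apply: eq_bigr => l _; congr (_ * _).
    by rewrite finE (leq_trans (leq_subr _ _) (ltnW (ltn_ord i))) (leq_trans (leq_subr _ _) (ltnW (ltn_ord j))).
  have [a aE] := pol_of_fin N N f.
  apply: le_trans (nN_le_n2 N _) _; first by rewrite -aE; exact: H2_theta_pol.
  by rewrite n2_theta_fin; exact: n2_fin_le.
by split; [exact: H2_bounded bnd|exact: n2_le].
Qed.

Let dfct f g : C := ip (theta * f) (theta * g) - ip f g.

(** Density of polynomials in one argument; by conjugate symmetry [theta_isometry] uses it for
    both. *)
Lemma dfct_trunc f g : H2 f -> H2 g -> (forall N, dfct f (fin N N g) = 0) -> dfct f g = 0.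
Proof.
move=> hf hg h; apply: (@sqmod_small _ _ (4 * n2 f)) => e e0.
have [N0 hN] := trunc_small hg e0; have {}hN := hN N0 (leqnn _).
have hT := H2_fin1 N0 N0 g; have hD := H2_B hg hT.
have [hf1 hf2] := theta_contraction hf; have [hg1 hg2] := theta_contraction hg.
have [hT1 hT2] := theta_contraction hT; have [hD1 hD2] := theta_contraction hD.
have -> : dfct f g = dfct f (g - fin N0 N0 g).
  rewrite -[LHS]subr0 -(h N0) /dfct mulrBr !ip2Br //; ring.
apply: le_trans (sqmodD_le _ _) _; rewrite [sqmod (- _)]sqmodE nrmN -sqmodE.
have b1 : sqmod (ip (theta * f) (theta * (g - fin N0 N0 g))) <= n2 f * e.
  apply: le_trans (cauchy_schwarz hf1 hD1) _; apply: ler_pM => //; try exact: n2_ge0.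
  exact: le_trans hD2 hN.
have b2 : sqmod (ip f (g - fin N0 N0 g)) <= n2 f * e.
  apply: le_trans (cauchy_schwarz hf hD) _; apply: ler_wpM2l => //; exact: n2_ge0.
nra.
Qed.

Lemma theta_isometry f g : H2 f -> H2 g -> ip (theta * f) (theta * g) = ip f g.
Proof.
move=> hf hg; have [hf1 _] := theta_contraction hf; have [hg1 _] := theta_contraction hg.
apply/eqP; rewrite -subr_eq0; apply/eqP; apply: dfct_trunc => // N.
have [b bE] := pol_of_fin N N g; rewrite -bE.
have hb := H2_pol1 b; have [hb1 _] := theta_contraction hb.
rewrite /dfct (ip2C hb1 hf1) (ip2C hb hf) -rmorphB /=.
rewrite [X in X^*](_ : _ = 0) ?conjC0 //; apply: dfct_trunc => // M.
have [a aE] := pol_of_fin M M f; rewrite -aE /dfct ip_theta_pols subrr //.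
Qed.

End InnerIsometry.

(** * The model space and the wandering subspace *)

Section ModelSpace.
Variable R : realType.
Local Notation C := (R[i]).
Local Notation fps2 := (fps (fps C)).
Local Notation XX := (XX R).
Local Notation X1 := (X1 R).
Local Notation X2 := (X2 R).
Implicit Types (f g h F G K : fps2).

(** Bundled because the bundle is preserved by exchanging the variables ([setup_swap]), so every
    consequence holds for the other variable too. *)
Definition setup (m n : nat) (p : {poly {poly C}}) (S1 S2 : set (coef2 R)) : Prop :=
  [/\ [/\ bideg_le m n p, no_zeros_D2 p & no_common_factor p (prefl m n p)],
      closed_subspace2 S1 /\ closed_subspace2 S2,
      (forall f, S1 f -> S1 (shift1 f)) /\ (forall f, S2 f -> S2 (shift2 f)) &
      orth_decomp (KTheta m n p) S1 S2].

Variables (m n : nat) (p : {poly {poly C}}) (S1 S2 : set (coef2 R)).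
Hypothesis hs : setup m n p S1 S2.

Let bd : bideg_le m n p. Proof. by case: hs => -[]. Qed.
Let nz : no_zeros_D2 p. Proof. by case: hs => -[]. Qed.
Let ncf : no_common_factor p (prefl m n p). Proof. by case: hs => -[]. Qed.

Lemma S1_X1 f : S1 f -> S1 (X1 * f).
Proof. by case: hs => _ _ [h _] _ /h; rewrite shift1E. Qed.
Lemma S2_X2 f : S2 f -> S2 (X2 * f).
Proof. by case: hs => _ _ [_ h] _ /h; rewrite shift2E. Qed.
Lemma S1_K f : S1 f -> KTheta m n p f. Proof. by case: hs => _ _ _ [h _ _ _]; exact: h. Qed.
Lemma S2_K f : S2 f -> KTheta m n p f. Proof. by case: hs => _ _ _ [_ h _ _]; exact: h. Qed.
Lemma K_H2 f : KTheta m n p f -> H2 f. Proof. by case. Qed.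
Lemma S2_H2 f : S2 f -> H2 f. Proof. by move=> /S2_K/K_H2. Qed.
Lemma S1_H2 f : S1 f -> H2 f. Proof. by move=> /S1_K/K_H2. Qed.
Lemma S12_orth f g : S1 f -> S2 g -> ip f g = 0.
Proof. by case: hs => _ _ _ [_ _ h _]; exact: h. Qed.
Lemma K_decomp f : KTheta m n p f -> exists u v : fps2, [/\ S1 u, S2 v & f = u + v].
Proof. by case: hs => _ _ _ [_ _ _ h] /h[u [v [hu hv ->]]]; exists u, v. Qed.
Lemma S2_D f g : S2 f -> S2 g -> S2 (f + g).
Proof. by case: hs => _ [_ [_ _ h _ _]] _ _; exact: h. Qed.
Lemma S2_Z (a : C) f : S2 f -> S2 (csc a * f).
Proof.
case: hs => _ [_ [_ _ _ h _]] _ _ /(h a).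
by rewrite (_ : (fun i j => a * f i j) = csc a * f) //; apply: fps2_ext => i j; rewrite cscM.
Qed.
Lemma S2_B f g : S2 f -> S2 g -> S2 (f - g).
Proof. by move=> hf hg; apply: S2_D => //; rewrite -mulN1r -csc1 -cscN; exact: S2_Z. Qed.
Lemma S2_0 : S2 (0 : fps2). Proof. by case: hs => _ [_ [_ h _ _ _]] _ _. Qed.

Lemma K_intro f : H2 f ->
  (forall g h, H2 g -> H2 h -> (forall z1 z2, inD z1 -> inD z2 ->
     ev g z1 z2 = Theta m n p z1 z2 * ev h z1 z2) -> ip f g = 0) -> KTheta m n p f.
Proof. by move=> hf h; split => // g h' hg hh' e; exact: h. Qed.

Lemma K_elim f g h : KTheta m n p f -> H2 g -> H2 h ->
  (forall z1 z2, inD z1 -> inD z2 -> ev g z1 z2 = Theta m n p z1 z2 * ev h z1 z2) ->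
  ip f g = 0.
Proof. by move=> [_ k] hg hh e; exact: (k g h). Qed.

Lemma K_quadrant f i j : KTheta m n p f -> (m <= i)%N -> (n <= j)%N -> (pol p * f) i j = 0.
Proof.
move=> kf hi hj; have hf := K_H2 kf.
(* On the bidisk g = Theta h. By [refl_adjoint] the pairing of g with f is the conjugate of the (i,
   j) coefficient of p f. *)
pose g := pol (prefl m n p) * XX (i - m) (j - n); pose h := pol p * XX (i - m) (j - n).
have hX := @H2_XX R (i - m) (j - n).
have hg : H2 g by exact: H2_pol.
have hh : H2 h by exact: H2_pol.
have : ip f g = 0.
  apply: (K_elim kf hg hh) => z1 z2 h1 h2; rewrite !ev_pol // /Theta.
  by rewrite mulrA divfK // nz.
rewrite ip2C // /g pol_refl refl_adjoint // XXD !subnKC // -(pol_fin bd).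
rewrite ip2C; [|exact: H2_pol|exact: H2_XX].
by rewrite conjCK ip2_XX //; exact: H2_pol.
Qed.

Lemma K_L2 f : KTheta m n p f -> KTheta m n p (L2 f).
Proof.
move=> kf; have hf := K_H2 kf; apply: K_intro; first exact: H2_L2.
move=> g h hg hh e; rewrite -ip2_L2 //.
apply: (K_elim kf (H2_X2 hg) (H2_X2 hh)) => z1 z2 h1 h2.
by rewrite !eval2_X2 // e // mulrCA.
Qed.

Lemma S2_XX k f : S2 f -> S2 (XX 0 k * f).
Proof.
move=> hf; elim: k => [|k IH]; first by rewrite /XX !mul1r.
have -> : XX 0 k.+1 * f = X2 * (XX 0 k * f) by rewrite /XX exprS; ring.
exact: S2_X2.
Qed.
Lemma S1_XX k f : S1 f -> S1 (XX k 0 * f).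
Proof.
move=> hf; elim: k => [|k IH]; first by rewrite /XX !mul1r.
have -> : XX k.+1 0 * f = X1 * (XX k 0 * f) by rewrite /XX exprS; ring.
exact: S1_X1.
Qed.

(** Multiplying by z2^n stays in S2 and moves every z2-exponent to at least n, where [K_quadrant]
    applies. *)
Lemma S2_degree f i j : S2 f -> (m <= i)%N -> (pol p * f) i j = 0.
Proof.
move=> hf hi; have /S2_K k := S2_XX n hf.
have := K_quadrant k hi (leq_addl j n).
by rewrite mulrCA XXM leq_addl addnK subn0.
Qed.

Lemma S1_degree f i j : S1 f -> (n <= j)%N -> (pol p * f) i j = 0.
Proof.
move=> hf hj; have /S1_K k := S1_XX m hf.
have := K_quadrant k (leq_addl i m) hj.
by rewrite mulrCA XXM leq_addl addnK subn0.
Qed.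

Local Notation W2 := (wandering2 S2).

Lemma W2_S2 f : W2 f -> S2 f. Proof. by case. Qed.
Lemma W2_H2 f : W2 f -> H2 f. Proof. by move=> /W2_S2/S2_H2. Qed.
Lemma W2_orth f g : W2 f -> S2 g -> ip f (X2 * g) = 0.
Proof. by case=> _ h /h; rewrite shift2E. Qed.
Lemma W2_intro f : S2 f -> (forall g, S2 g -> ip f (X2 * g) = 0) -> W2 f.
Proof. by move=> hf h; split => // g hg; rewrite shift2E; exact: h. Qed.

(** Split L2 f = u + v along S1 and S2. Then <v, v> = <L2 f, v> = <f, z2 v> = 0. *)
Lemma W2_L2 f : W2 f -> S1 (L2 f).
Proof.
move=> wf; have hf := W2_H2 wf; have [u [v [hu hv E]]] := K_decomp (K_L2 (S2_K (W2_S2 wf))).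
suff v0 : v = 0 by rewrite E v0 addr0.
have hvH := S2_H2 hv; apply: ip2_eq0 => //.
have := W2_orth wf hv; rewrite ip2_L2 // E ip2Dl ?(S12_orth hu hv) ?add0r //.
exact: S1_H2.
Qed.

Lemma R2M f (i j : nat) : (n < j)%N -> (pol p * R2 f) i j = 0.
Proof.
move=> hj; rewrite fps2M big1 // => a _; rewrite big1 // => b _.
case: (ltnP b j) => hb.
  have -> : (j - b)%N = (j - b).-1.+1 by rewrite prednK // subn_gt0.
  by rewrite mulr0.
have bj : (b : nat) = j by apply/eqP; rewrite eqn_leq hb -ltnS ltn_ord.
case: bd => h1 _; have hb' : (size p <= b)%N by rewrite bj; exact: leq_trans h1 hj.
by rewrite /pol (nth_default 0 hb') coef0 mul0r.
Qed.

(** In f = f(., 0) + z2 L2 f the first term times p has z2-degree at most n; p L2 f has z2-degree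
    below n because L2 f is in S1, and the factor z2 restores one degree. *)
Lemma W2_degree f i j : W2 f -> ((m <= i) || (n < j))%N -> (pol p * f) i j = 0.
Proof.
move=> wf /orP[hi|hj]; first exact: S2_degree (W2_S2 wf) hi.
rewrite (splitX2 f) mulrDr fps2D R2M // add0r mulrCA X2M.
by case: j hj => // j hj; apply: S1_degree => //; exact: W2_L2.
Qed.

Lemma W2_fin f : W2 f -> pol p * f = fin m n (pol p * f).
Proof.
move=> wf; apply: fps2_ext => i j; rewrite finE; case: ifPn => //.
rewrite negb_and -!ltnNge => h; apply: W2_degree => //.
by case/orP: h => [/ltnW->|->]; rewrite ?orbT.
Qed.

Lemma W2_D f g : W2 f -> W2 g -> W2 (f + g).
Proof.
move=> wf wg; apply: W2_intro; first by apply: S2_D; exact: W2_S2.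
move=> h hh; rewrite ip2Dl ?(W2_orth wf) ?(W2_orth wg) ?addr0 //; try exact: W2_H2.
by apply: H2_X2; exact: S2_H2.
Qed.
Lemma W2_Z (a : C) f : W2 f -> W2 (csc a * f).
Proof.
move=> wf; apply: W2_intro; first by apply: S2_Z; exact: W2_S2.
move=> h hh; rewrite ip2Zl ?(W2_orth wf) ?mulr0 //; first exact: W2_H2.
by apply: H2_X2; exact: S2_H2.
Qed.
Lemma W2_B f g : W2 f -> W2 g -> W2 (f - g).
Proof. by move=> hf hg; apply: W2_D => //; rewrite -mulN1r -csc1 -cscN; exact: W2_Z. Qed.
Lemma W2_0 : W2 (0 : fps2).
Proof.
apply: W2_intro; first exact: S2_0.
by move=> g hg; apply: ip2_0l; apply: H2_X2; exact: S2_H2.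
Qed.
Lemma W2_sum (I : Type) (s : seq I) (P : pred I) (F : I -> fps2) :
  (forall i, P i -> W2 (F i)) -> W2 (\sum_(i <- s | P i) F i).
Proof. by move=> h; elim/big_ind: _ => //; [exact: W2_0 | exact: W2_D]. Qed.

(** * Orthonormal families of the wandering subspace *)

Lemma W2_shift_orth f g k l : W2 f -> W2 g ->
  ip (XX 0 k * f) (XX 0 l * g) = if k == l then ip f g else 0.
Proof.
have gt f' g' k' : W2 f' -> W2 g' -> ip (XX 0 k'.+1 * f') g' = 0.
  move=> wf wg; have hX := H2_XnM 0 k' (W2_H2 wf).
  have -> : XX 0 k'.+1 * f' = X2 * (XX 0 k' * f') by rewrite /XX exprS; ring.
  rewrite ip2C ?(W2_orth wg) ?conjC0 //; [|exact: W2_H2|exact: H2_X2].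
  by apply: S2_XX; exact: W2_S2.
have add0 k' l' f' : XX 0 (k' + l') * f' = XX 0 k' * (XX 0 l' * f') by rewrite XXMM.
move=> wf wg; have hf := W2_H2 wf; have hg := W2_H2 wg.
case: (ltngtP k l) => [kl|kl|->]; last by rewrite ip2_XnM.
- have -> : l = (k + (l - k).-1.+1)%N by rewrite prednK ?subn_gt0 // subnKC // ltnW.
  rewrite add0 ip2_XnM //; last exact: H2_XnM.
  by rewrite ip2C ?gt ?conjC0 //; exact: H2_XnM.
- have -> : k = (l + (k - l).-1.+1)%N by rewrite prednK ?subn_gt0 // subnKC // ltnW.
  by rewrite add0 ip2_XnM ?gt //; exact: H2_XnM.
Qed.

(** Orthonormality only; spanning is stated separately where it is needed. *)
Definition onb d (e : 'I_d -> fps2) := (forall k, W2 (e k)) /\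
  forall k l, ip (e k) (e l) = (k == l)%:R.

Lemma polz2M (v : {poly C}) f i j :
  (pol (map_poly polyC v) * f) i j = \sum_(b < j.+1) v`_b * f i (j - b)%N.
Proof.
rewrite fps2M big_ord_recl [X in _ + X]big1 => [|a _]; last first.
  by rewrite big1 // => b _; rewrite /pol coef_map /= coefC mul0r.
by rewrite addr0; apply: eq_bigr => b _; rewrite /pol coef_map /= coefC subn0.
Qed.

Lemma polz2 (v : {poly C}) :
  pol (map_poly polyC v) = \sum_(j < size v) csc v`_j * XX 0 j :> fps2.
Proof.
rewrite -[RHS]mulr1 mulr_suml -[LHS]mulr1.
apply: fps2_ext => i j; rewrite polz2M fps2_sum.
have E (b : nat) : (csc v`_b * XX 0 b * 1) i j = if (b <= j)%N then v`_b * (1 : fps2) i (j - b)%N else 0.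
  by rewrite -mulrA cscM XXM /= subn0; case: ifP; rewrite ?mulr0.
under [RHS]eq_bigr do rewrite E.
rewrite -big_mkcond /=.
have szl := leq_maxl (size v) j.+1; have szr := leq_maxr (size v) j.+1.
rewrite (big_ord_widen _ (fun b => v`_b * (1 : fps2) i (j - b)%N) szr).
rewrite (big_ord_widen_cond _ (fun b => (b <= j)%N) (fun b => v`_b * (1 : fps2) i (j - b)%N) szl).
rewrite big_mkcond [RHS]big_mkcond; apply: eq_bigr => b _.
rewrite ltnS; case: (ltnP b (size v)) => hb; first by rewrite andbT.
by rewrite andbF (nth_default 0 hb) mul0r if_same.
Qed.

(** Independence over C[z2]: all z2^j e_k are orthonormal, so pairing with z2^j0 e_k0 isolates a
    single coefficient. *)
Lemma onb_indep d (e : 'I_d -> fps2) (v : 'I_d -> {poly C}) : onb e ->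
  \sum_k pol (map_poly polyC (v k)) * e k = 0 -> forall k, v k = 0.
Proof.
move=> [we oe] E k0; apply/polyP => j0; rewrite coef0.
case: (ltnP j0 (size (v k0))) => hj; last by rewrite nth_default.
have hX k : H2 (XX 0 j0 * e k) by apply: H2_XnM; exact: W2_H2.
have := congr1 (fun s => ip s (XX 0 j0 * e k0)) E; rewrite ip2_0l //.
rewrite ip2_suml //; last by move=> k _; apply: H2_pol; exact: W2_H2.
have E1 k : ip (pol (map_poly polyC (v k)) * e k) (XX 0 j0 * e k0) =
    if k == k0 then (v k)`_j0 else 0.
  rewrite polz2 mulr_suml ip2_suml //; last first.
    by move=> j _; rewrite -mulrA; apply: H2_Z; apply: H2_XnM; exact: W2_H2.
  under eq_bigr => j _.
    rewrite -mulrA ip2Zl //; last by apply: H2_XnM; exact: W2_H2.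
    rewrite W2_shift_orth // oe; over.
  case: eqP => [->|_]; last by rewrite big1 // => j _; rewrite if_same mulr0.
  rewrite (bigD1 (Ordinal hj)) //= eqxx mulr1 big1 ?addr0 // => j.
  by rewrite -val_eqE /= => /negPf ->; rewrite mulr0.
under eq_bigr do rewrite E1.
by rewrite -big_mkcond /= big_pred1_eq.
Qed.

Lemma onb_le d (e : 'I_d -> fps2) : onb e -> (d <= m)%N.
Proof.
move=> [we oe]; rewrite leqNgt; apply/negP => md.
pose e' (k : 'I_m.+1) := e (widen_ord md k).
have oe' : onb e'.
  by split=> [k|k l]; [exact: we|rewrite oe -val_eqE /= val_eqE].
(* Entry (k, i) is the coefficient of z1^i in p e_k, a polynomial in z2. Column m vanishes since the
   z1-degree is below m, so M is singular. *)
pose M : 'M[{poly C}]_m.+1 := \matrix_(k, i) \poly_(j < n.+1) (pol p * e' k) i j.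
have Mc k i j : (M k i)`_j = (pol p * e' k) i j.
  rewrite mxE coef_poly; case: ltnP => // hj.
  by rewrite W2_degree ?hj ?orbT //; exact: we.
have : \det M == 0.
  rewrite (expand_det_col _ ord_max) big1 // => k _.
  suff -> : M k ord_max = 0 by rewrite mul0r.
  by apply/polyP => j; rewrite Mc coef0 W2_degree ?leqnn //; exact: we.
move=> /det0P[v v0 vM].
have s0 : \sum_k pol (map_poly polyC (v 0 k)) * e' k = 0.
  (* p is invertible as a formal series, so a relation among the p e_k is one among the e_k. *)
  have [c pc] := pol_inverse nz.
  rewrite -[LHS]mul1r -pc mulrAC [X in X * _](_ : _ = 0) ?mul0r //.
  rewrite mulr_sumr; apply: fps2_ext => i j; rewrite fps2_sum fps20.
  under eq_bigr do rewrite mulrCA polz2M.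
  case: (ltnP i m.+1) => hi; last first.
    rewrite big1 // => k _; rewrite big1 // => b _.
    by rewrite W2_degree ?(ltnW hi) ?mulr0 //; exact: we.
  have E0 : \sum_k v 0 k * M k (Ordinal hi) = 0.
    by have /rowP/(_ (Ordinal hi)) := vM; rewrite mxE => ->; rewrite mxE.
  have := congr1 (fun q : {poly C} => q`_j) E0.
  rewrite coef_sum coef0 => E1; rewrite -[RHS]E1; apply: eq_bigr => k _.
  by rewrite coefM; apply: eq_bigr => b _; rewrite Mc.
case/eqP: v0; apply/rowP => k; rewrite mxE.
exact: (onb_indep oe' s0).
Qed.

(** Sizes of orthonormal families are bounded by [onb_le]; a family of largest size spans, because a
    nonzero remainder, once normalized, would enlarge it. *)
Lemma onb_exists : exists d (e : 'I_d -> fps2), [/\ (d <= m)%N, onb e &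
  forall f, W2 f -> f = \sum_k csc (ip f (e k)) * e k].
Proof.
pose P d := `[< exists e : 'I_d -> fps2, onb e >].
have P0 : exists d, P d.
  by exists 0%N; apply/asboolP; exists (fun=> 0); split=> [[]|[]].
have Pm d : P d -> (d <= m)%N by move=> /asboolP[e /onb_le].
case: (ex_maxnP P0 Pm) => d /asboolP[e oe] dmax; exists d, e; split => //.
  exact: onb_le oe.
move=> f wf; have [we ee] := oe; have hf := W2_H2 wf.
have he k : H2 (e k) by exact: W2_H2.
set s := \sum_k _; have ws : W2 s by apply: W2_sum => k _; exact: W2_Z.
apply/eqP; rewrite -subr_eq0; apply/eqP; set g := f - s.
have wg : W2 g by exact: W2_B.
have hg := W2_H2 wg; have hS := W2_H2 ws.
have ge k : ip g (e k) = 0.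
  rewrite ip2Bl // ip2_suml //; last by move=> l _; exact: H2_Z.
  under eq_bigr => l _ do rewrite ip2Zl // ee.
  rewrite (bigD1 k) //= eqxx mulr1 big1 ?addr0 ?subrr // => l /negPf ->.
  by rewrite mulr0.
apply: n2_eq0 => //; apply/eqP/negPn/negP => g0.
have gp : 0 < n2 g by rewrite lt_neqAle eq_sym g0 n2_ge0.
have [t tE t0] : exists2 t, n2 g = t * t & t != 0.
  exists (Num.sqrt (n2 g)); last by rewrite gt_eqF // sqrtr_gt0.
  by rewrite -expr2 sqr_sqrtr // ltW.
pose g' := csc (rc t^-1) * g.
have hg' : H2 g' by exact: H2_Z.
pose e' (k : 'I_d.+1) := if unlift ord_max k is Some k' then e k' else g'.
suff /dmax : P d.+1 by rewrite ltnn.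
apply/asboolP; exists e'; split=> [k|k l]; rewrite /e'.
  by case: unliftP => [k' _|_]; [exact: we|exact: W2_Z].
case: (unliftP ord_max k) => [k' ->|->]; case: (unliftP ord_max l) => [l' ->|->] /=.
- by rewrite ee (inj_eq lift_inj).
- by rewrite ip2C // ip2Zl // ge mulr0 conjC0 eq_sym (negPf (neq_lift _ _)).
- by rewrite ip2Zl // ge mulr0 (negPf (neq_lift _ _)).
rewrite eqxx ip2Zl // ip2Zr // ip2_n2 // rcJ -!rcM tE.
by rewrite (_ : t^-1 * (t^-1 * (t * t)) = 1) //; field.
Qed.

End ModelSpace.

(** * Kernels, exchange of variables and the Agler identity *)

Section Kernel.
Variable R : realType.
Local Notation C := (R[i]).
Local Notation fps2 := (fps (fps C)).
Local Notation XX := (XX R).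
Local Notation X1 := (X1 R).
Local Notation X2 := (X2 R).
Implicit Types (f g h F G K : fps2).

Lemma ev_sz (w1 w2 z1 z2 : C) : inD w1 -> inD w2 -> inD z1 -> inD z2 ->
  (1 - z1 * w1^*) * (1 - z2 * w2^*) * ev (sz w1 w2) z1 z2 = 1.
Proof.
move=> hw1 hw2 hz1 hz2; have hs := H2_sz hw1 hw2.
(* The Szego kernel freed of its z1 factor. Telescoping on coefficients replaces summing the
   geometric series. *)
pose s1 : fps2 := sz w1 w2 - csc w1^* * (X1 * sz w1 w2).
have hs1 : H2 s1 by apply: H2_B => //; apply: H2_Z; exact: H2_X1.
have E : s1 - csc w2^* * (X2 * s1) = 1.
  have s1E i j : s1 i j = if i is 0 then (w2 ^+ j)^* else 0.
    rewrite /s1 fps2B cscM X1M /sz; case: i => [|i]; first by rewrite mulr0 subr0 mul1r.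
    by rewrite -rmorphM /= mulrA -exprS subrr.
  apply: fps2_ext => i j; rewrite fps2B cscM X2M fps21 s1E.
  case: i j => [|i] [|j] /=; rewrite ?s1E ?mulr0 ?subr0 ?expr0 ?conjC1 //.
  by rewrite -rmorphM -exprS subrr.
have h0 := eval2_1 hz1 hz2; rewrite -E eval2B // in h0; last by apply: H2_Z; exact: H2_X2.
rewrite eval2Z ?eval2_X2 // in h0; last exact: H2_X2.
have e1 : ev s1 z1 z2 = (1 - z1 * w1^*) * ev (sz w1 w2) z1 z2.
  rewrite eval2B //; last by apply: H2_Z; exact: H2_X1.
  by rewrite eval2Z ?eval2_X1 //; [ring|exact: H2_X1].
by rewrite -[RHS]h0 e1; ring.
Qed.

Variables (m n : nat) (p : {poly {poly C}}) (S1 S2 : set (coef2 R)).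
Hypothesis hs : setup m n p S1 S2.

Let bd : bideg_le m n p. Proof. by case: hs => -[]. Qed.
Let nz : no_zeros_D2 p. Proof. by case: hs => -[]. Qed.
Let ncf : no_common_factor p (prefl m n p). Proof. by case: hs => -[]. Qed.

(** Turns the pointwise relation in the definition of [KTheta] into an identity of series, as
    [theta_isometry] requires. *)
Lemma theta_factor c g h : pol p * c = 1 -> H2 g -> H2 h ->
  (forall z1 z2, inD z1 -> inD z2 -> ev g z1 z2 = Theta m n p z1 z2 * ev h z1 z2) ->
  g = theta m n p c * h.
Proof.
move=> pc hg hh e.
have E : pol p * g = pol (prefl m n p) * h.
  apply: eval2_inj; [exact: H2_pol|exact: H2_pol|] => w1 w2 h1 h2.
  by rewrite !ev_pol // e // /Theta mulrA mulrCA divff ?mulr1 // nz.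
by rewrite /theta mulrAC -E mulrC mulrA [c * _]mulrC pc mul1r.
Qed.

Lemma ev_theta c f w1 w2 : pol p * c = 1 -> inD w1 -> inD w2 -> H2 f ->
  ev (theta m n p c * f) w1 w2 = Theta m n p w1 w2 * ev f w1 w2.
Proof.
move=> pc h1 h2 hf; have [hth _] := theta_contraction bd nz ncf pc hf.
have p0 := nz h1 h2; apply: (mulfI p0).
by rewrite -ev_pol // mulrA pol_theta // ev_pol // /Theta mulrA mulrCA divff ?mulr1.
Qed.

Local Notation W2 := (wandering2 S2).
Local Notation W1 := (wandering1 S1).

(** The parts u in S1 and v in S2 of the kernel of K_Theta at w reproduce values on S1 and S2. On S2
    (-) z2 S2 the kernel is (1 - z2 conj w2) v, since z2 v is orthogonal to that space. Multiplying
    u + v by both Szego denominators gives the last identity. *)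
Lemma kernel w1 w2 : inD w1 -> inD w2 -> exists K1 K2 : fps2,
  [/\ W1 K1, W2 K2, (forall f, W1 f -> ip f K1 = ev f w1 w2),
      (forall f, W2 f -> ip f K2 = ev f w1 w2) &
      forall z1 z2, inD z1 -> inD z2 ->
        1 - Theta m n p z1 z2 * (Theta m n p w1 w2)^* =
        (1 - z1 * w1^*) * ev K2 z1 z2 + (1 - z2 * w2^*) * ev K1 z1 z2].
Proof.
move=> hw1 hw2; have [c pc] := pol_inverse nz; pose th := theta m n p c.
pose T := Theta m n p w1 w2; have hsz := H2_sz hw1 hw2.
have [hth _] := theta_contraction bd nz ncf pc hsz.
have hcth : H2 (csc T^* * (th * sz w1 w2)) by exact: H2_Z.
pose k := sz w1 w2 - csc T^* * (th * sz w1 w2).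
have hk : H2 k by exact: H2_B.
(* For g = Theta h, pairing the Szego kernel s with g gives conj g(w), and <Theta s, Theta h> = <s,
   h> = conj h(w) by isometry. The factor conj T makes the two cancel. *)
have Kk : KTheta m n p k.
  apply: K_intro => // g h hg hh e; have gE := theta_factor pc hg hh e.
  rewrite ip2Bl // ip2Zl // {2}gE theta_isometry //.
  rewrite (ip2C hg hsz) (ip2C hh hsz) -!eval2E e // rmorphM /=.
  exact: subrr.
have repr g : KTheta m n p g -> ip g k = ev g w1 w2.
  move=> kg; have hg := K_H2 kg; rewrite ip2Br // ip2Zr //.
  rewrite [ip g (th * _)](K_elim kg hth hsz) ?mulr0 ?subr0 ?eval2E //.
  by move=> z1 z2 h1 h2; rewrite ev_theta.
have [u [v [hu hv kE]]] := K_decomp hs Kk.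
have hu2 := S1_H2 hs hu; have hv2 := S2_H2 hs hv.
have rv g : S2 g -> ip g v = ev g w1 w2.
  move=> sg; have hg := S2_H2 hs sg; rewrite -repr ?kE; last exact: S2_K hs _ sg.
  by rewrite ip2Dr // (ip2C hu2 hg) (S12_orth hs hu sg) conjC0 add0r.
have ru g : S1 g -> ip g u = ev g w1 w2.
  move=> sg; have hg := S1_H2 hs sg; rewrite -repr ?kE; last exact: S1_K hs _ sg.
  by rewrite ip2Dr // (S12_orth hs sg hv) addr0.
pose K2 := v - csc w2^* * (X2 * v); pose K1 := u - csc w1^* * (X1 * u).
have hXv := H2_X2 hv2; have hXu := H2_X1 hu2.
have hcv := H2_Z w2^* hXv; have hcu := H2_Z w1^* hXu.
exists K1, K2; split.
- split.
    case: (hs) => _ [[_ _ hD hZ _] _] _ _.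
    have h1 : S1 (csc (- w1^*) * (X1 * u)).
      have := hZ (- w1^*) _ (S1_X1 hs hu).
      by rewrite (_ : (fun i j => _) = csc (- w1^*) * (X1 * u)) //; apply: fps2_ext => i j; rewrite cscM.
    have := hD _ _ hu h1; rewrite (_ : (fun i j => _) = K1) //.
    by rewrite /K1 cscN mulNr.
  move=> g sg; have hg := S1_H2 hs sg; rewrite shift1E.
  have hXg := H2_X1 hg.
  change (ip K1 (X1 * g) = 0); rewrite ip2Bl // ip2Zl // ip2_X1 //.
  rewrite (ip2C hXg hu2) (ip2C hg hu2) (ru _ (S1_X1 hs sg)) (ru _ sg) eval2_X1 // rmorphM.
  exact: subrr.
- apply: W2_intro.
    apply: (S2_B hs) => //; apply: (S2_Z hs); exact: S2_X2 hs _ hv.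
  move=> g sg; have hg := S2_H2 hs sg; have hXg := H2_X2 hg.
  rewrite ip2Bl // ip2Zl // ip2_X2 //.
  rewrite (ip2C hXg hv2) (ip2C hg hv2) (rv _ (S2_X2 hs sg)) (rv _ sg) eval2_X2 // rmorphM.
  exact: subrr.
- move=> f [sf orth]; have hf := S1_H2 hs sf; rewrite ip2Br // ip2Zr // (ru _ sf).
  have -> : ip f (X1 * u) = 0 by have := orth _ hu; rewrite shift1E.
  by rewrite mulr0 subr0.
- move=> f wf; have hf := W2_H2 hs wf; rewrite ip2Br // ip2Zr // (rv _ (W2_S2 wf)).
  by rewrite (W2_orth wf hv) mulr0 subr0.
move=> z1 z2 hz1 hz2.
have e0 : ev k z1 z2 = ev u z1 z2 + ev v z1 z2 by rewrite kE eval2D.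
have e1 : ev k z1 z2 = (1 - Theta m n p z1 z2 * T^*) * ev (sz w1 w2) z1 z2.
  by rewrite eval2B // eval2Z // ev_theta //; ring.
have e2 := ev_sz hw1 hw2 hz1 hz2.
have e3 : ev K2 z1 z2 = (1 - z2 * w2^*) * ev v z1 z2.
  by rewrite eval2B // eval2Z // eval2_X2 //; ring.
have e4 : ev K1 z1 z2 = (1 - z1 * w1^*) * ev u z1 z2.
  by rewrite eval2B // eval2Z // eval2_X1 //; ring.
rewrite e3 e4 -/T; transitivity ((1 - Theta m n p z1 z2 * T^*) *
  ((1 - z1 * w1^*) * (1 - z2 * w2^*) * ev (sz w1 w2) z1 z2)); first by rewrite e2 mulr1.
have -> : (1 - z1 * w1^*) * ((1 - z2 * w2^*) * ev v z1 z2) +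
   (1 - z2 * w2^*) * ((1 - z1 * w1^*) * ev u z1 z2) =
   (1 - z1 * w1^*) * (1 - z2 * w2^*) * (ev u z1 z2 + ev v z1 z2) by ring.
by rewrite -e0 e1; ring.
Qed.

End Kernel.

(** * Exchange of the two variables, and the Agler identity *)

Section Swap.
Variable R : realType.
Local Notation C := (R[i]).
Local Notation fps2 := (fps (fps C)).
Implicit Types (f g h F G K : fps2) (p : {poly {poly C}}).

Definition trS (S : set (coef2 R)) : set (coef2 R) := [set f | S (fun i j => f j i)].

Lemma peval_swap p z1 z2 : peval (swapXY p) z1 z2 = peval p z2 z1.
Proof. exact: horner2_swapXY. Qed.

Lemma prefl_swap m n p : prefl n m (swapXY p) = swapXY (prefl m n p).
Proof.
apply/polyP => i; apply/polyP => j; rewrite coef_swapXY /prefl !coef_poly.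
case: (ltnP i m.+1) => hi; case: (ltnP j n.+1) => hj;
  rewrite ?coef0 ?coef_poly ?hi ?hj //= ?(leq_gtF hi) ?(leq_gtF hj) ?coef0 //.
by rewrite /pcoef coef_swapXY.
Qed.

Lemma Theta_swap m n p z1 z2 : Theta n m (swapXY p) z1 z2 = Theta m n p z2 z1.
Proof. by rewrite /Theta prefl_swap !peval_swap. Qed.

Lemma KTheta_swap m n p f : KTheta m n p f -> KTheta n m (swapXY p) (tr f).
Proof.
move=> kf; have hf := K_H2 kf; apply: K_intro; first exact: tr_H2.
move=> g h hg hh e; rewrite -[g]trK ip2_tr.
apply: (K_elim kf (tr_H2 hg) (tr_H2 hh)) => z1 z2 h1 h2.
by rewrite (eval2_tr g) (eval2_tr h) (e _ _ h2 h1) Theta_swap.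
Qed.

Lemma bideg_swap m n p : bideg_le m n p -> bideg_le n m (swapXY p).
Proof.
move=> [h1 h2]; split.
  apply/leq_sizeP => i hi; apply/polyP => j; rewrite coef_swapXY coef0.
  by rewrite nth_default // (leq_trans (h2 j)).
move=> i; apply/leq_sizeP => j hj; rewrite coef_swapXY.
by rewrite (nth_default 0 (leq_trans h1 hj)) coef0.
Qed.

Lemma ncf_swap p q : no_common_factor p q -> no_common_factor (swapXY p) (swapXY q).
Proof.
move=> ncf d a b pE qE; have [||c cE] := ncf (swapXY d) (swapXY a) (swapXY b).
- by rewrite -(swapXYK p) pE rmorphM.
- by rewrite -(swapXYK q) qE rmorphM.
by exists c; rewrite -(swapXYK d) cE swapXY_polyC map_polyC.
Qed.

Lemma closed_swap S : closed_subspace2 S -> closed_subspace2 (trS S).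
Proof.
move=> [hH h0 hD hZ hC]; split => //.
- by move=> f /hH; exact: tr_H2.
- by move=> f g; exact: hD.
- by move=> c f; exact: hZ.
move=> u f hu hf cv; apply: (hC (fun k => tr (u k)) (tr f)) => //; first exact: tr_H2.
have E k : ip2 (fun i j => tr (u k) i j - tr f i j) (fun i j => tr (u k) i j - tr f i j) =
  ip2 (fun i j => u k i j - f i j) (fun i j => u k i j - f i j).
  exact: (@ip2_tr _ (u k - f : fps2) (u k - f : fps2)).
by under eq_fun do rewrite E.
Qed.

Lemma setup_swap m n p S1 S2 : setup m n p S1 S2 ->
  setup n m (swapXY p) (trS S2) (trS S1).
Proof.
move=> hs; have [[bd nz ncf] [c1 c2] [s1 s2] [k1 k2 o dc]] := hs; split.
- split; [exact: bideg_swap| |by rewrite prefl_swap; exact: ncf_swap].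
  by move=> z1 z2 h1 h2; rewrite peval_swap nz.
- by split; exact: closed_swap.
- by split=> f; [exact: s2|exact: s1].
split.
- by move=> f /k2/KTheta_swap.
- by move=> f /k1/KTheta_swap.
- move=> f g sf sg; change (ip f g = 0).
  have hf : H2 (tr f) by exact: (S2_H2 hs sf).
  have hg : H2 (tr g) by exact: (S1_H2 hs sg).
  rewrite -(ip2_tr f g) (ip2C hg hf) (_ : ip (tr g) (tr f) = 0) ?conjC0 //.
  exact: (o _ _ sg sf).
move=> h kh; have : KTheta m n p (tr h).
  by have := KTheta_swap kh; rewrite swapXYK.
move=> /dc[f [g [sf sg E]]]; exists (tr g), (tr f); split => //.
apply: fps2_ext => i j; have := congr1 (fun F : fps2 => F j i) E.
by rewrite [tr h j i](_ : _ = h i j) // => ->; rewrite addrC.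
Qed.

Lemma wandering_swap S f : wandering2 (trS S) f -> wandering1 S (tr f).
Proof.
move=> [sf h]; split => // g sg; have := h (tr g) sg => E.
rewrite -[RHS]E; exact: (@ip2_tr _ f (shift2 (tr g))).
Qed.

Lemma trM f g : tr (f * g) = tr f * tr g.
Proof.
apply: fps2_ext => i j; rewrite fps2M [tr _ i j](_ : _ = (f * g) j i) //.
by rewrite fps2M exchange_big.
Qed.

Lemma pol_swap p : pol (swapXY p) = tr (pol p).
Proof. by apply: fps2_ext => i j; rewrite /pol coef_swapXY. Qed.

Lemma W1_swap S f : wandering1 S f -> wandering2 (trS S) (tr f).
Proof.
move=> [sf h]; split => // g sg; have := h (tr g) sg => E.
rewrite -[RHS]E; exact: (@ip2_tr _ f (shift1 (tr g))).
Qed.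

Lemma onb1_exists m n p S1 S2 : setup m n p S1 S2 ->
  exists d (e : 'I_d -> fps2), [/\ (forall k, wandering1 S1 (e k)),
    (forall k, H2 (e k)), (forall k, pol p * e k = fin m n (pol p * e k)) &
  forall f, wandering1 S1 f -> f = \sum_k csc (ip f (e k)) * e k].
Proof.
move=> hs; have hs' := setup_swap hs.
have [d [e [_ [we oe] sp]]] := onb_exists hs'.
exists d, (fun k => tr (e k)); split.
- by move=> k; exact: wandering_swap.
- by move=> k; apply: tr_H2; exact: (W2_H2 hs' (we k)).
- move=> k; have := W2_fin hs' (we k); rewrite pol_swap => E.
  apply: fps2_ext => i j; have := congr1 (fun F : fps2 => F j i) E.
  rewrite !finE andbC => E1.
  have -> : (pol p * tr (e k)) i j = (tr (pol p) * e k) j i.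
    by rewrite -[e k in RHS]trK -trM.
  exact: E1.
move=> f wf; have E := sp _ (W1_swap wf).
rewrite -[LHS]trK E; apply: fps2_ext => i j.
rewrite [tr _ i j](_ : _ = (\sum_k csc (ip (tr f) (e k)) * e k) j i) // !fps2_sum.
apply: eq_bigr => k _; rewrite !cscM -[in LHS](trK (e k)) ip2_tr //.
Qed.

Lemma ev_finform m n p f z1 z2 : inD z1 -> inD z2 -> H2 f ->
  pol p * f = fin m n (pol p * f) ->
  peval p z1 z2 * ev f z1 z2 = fev m n (pol p * f) z1 z2.
Proof.
move=> h1 h2 hf E; rewrite -ev_pol // E -[fin m n _ in LHS]mulr1 ev_fin //; last exact: H2_one.
by rewrite eval2_1 // mulr1 -E.
Qed.

(** The identity of [kernel] multiplied by p(z) conj p(w), with the kernels expanded in the bases.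
    All terms are then polynomials in z and conj w, so boundary values can be taken term by term. *)
Lemma agler m n p S1 S2 d (e : 'I_d -> fps2) : setup m n p S1 S2 ->
  onb S2 e -> (forall f, wandering2 S2 f -> f = \sum_k csc (ip f (e k)) * e k) ->
  exists d' (e' : 'I_d' -> fps2), forall z1 z2 w1 w2,
   inD z1 -> inD z2 -> inD w1 -> inD w2 ->
   peval p z1 z2 * (peval p w1 w2)^* -
     peval (prefl m n p) z1 z2 * (peval (prefl m n p) w1 w2)^* =
   (1 - z1 * w1^*) * (\sum_k fev m n (pol p * e k) z1 z2 * (fev m n (pol p * e k) w1 w2)^*)
   + (1 - z2 * w2^*) * (\sum_l fev m n (pol p * e' l) z1 z2 * (fev m n (pol p * e' l) w1 w2)^*).
Proof.
move=> hs [we oe] sp; have [d' [e' [we' he' fe' sp']]] := onb1_exists hs.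
have he k : H2 (e k) by exact: W2_H2 hs _ (we k).
exists d', e' => z1 z2 w1 w2 hz1 hz2 hw1 hw2.
have nz : no_zeros_D2 p by case: hs => -[].
have pz := nz _ _ hz1 hz2; have pw := nz _ _ hw1 hw2.
have [K1 [K2 [wK1 wK2 r1 r2 E]]] := kernel hs hw1 hw2.
have hK2 : H2 K2 by exact: W2_H2 hs _ wK2.
have hK1 : H2 K1 by case: wK1 => /(S1_H2 hs).
have e2 : ev K2 z1 z2 = \sum_k (ev (e k) w1 w2)^* * ev (e k) z1 z2.
  rewrite {1}(sp _ wK2) eval2_sum // => [|k _]; last exact: H2_Z.
  by apply: eq_bigr => k _; rewrite eval2Z // (ip2C (he k) hK2) r2.
have e1 : ev K1 z1 z2 = \sum_k (ev (e' k) w1 w2)^* * ev (e' k) z1 z2.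
  rewrite {1}(sp' _ wK1) eval2_sum // => [|k _]; last exact: H2_Z.
  by apply: eq_bigr => k _; rewrite eval2Z // (ip2C (he' k) hK1) r1.
have {}E := E z1 z2 hz1 hz2.
have f2 : \sum_k fev m n (pol p * e k) z1 z2 * (fev m n (pol p * e k) w1 w2)^* =
   peval p z1 z2 * (peval p w1 w2)^* * ev K2 z1 z2.
  rewrite e2 mulr_sumr; apply: eq_bigr => k _.
  by rewrite -!ev_finform //; try exact: W2_fin hs _ (we k); rewrite rmorphM /=; ring.
have f1 : \sum_k fev m n (pol p * e' k) z1 z2 * (fev m n (pol p * e' k) w1 w2)^* =
   peval p z1 z2 * (peval p w1 w2)^* * ev K1 z1 z2.
  rewrite e1 mulr_sumr; apply: eq_bigr => k _.
  by rewrite -!ev_finform // rmorphM /=; ring.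
rewrite f1 f2.
have -> : (1 - z1 * w1^*) * (peval p z1 z2 * (peval p w1 w2)^* * ev K2 z1 z2) +
  (1 - z2 * w2^*) * (peval p z1 z2 * (peval p w1 w2)^* * ev K1 z1 z2) =
  peval p z1 z2 * (peval p w1 w2)^* *
  ((1 - z1 * w1^*) * ev K2 z1 z2 + (1 - z2 * w2^*) * ev K1 z1 z2) by ring.
rewrite -E /Theta rmorphM /= fmorphV /=; field.
by rewrite conjC_eq0 pw pz.
Qed.

End Swap.

(** * One variable *)

Section OneVariable.
Variable R : realType.
Local Notation C := (R[i]).
Local Notation fsr := (fps C).
Local Notation fps2 := (fps (fps C)).
Local Notation XX := (XX R).
Implicit Types (a b k h : fsr) (P Q : {poly C}) (z w : C).

(** A series in z1 as a series constant in z2. It preserves products, inner products and values, so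
    the one-variable theory is read off from the bidisk. *)
Definition emb a : fps2 := fun i => fpsC (a i).
Definition h2 a : Prop := H2_1 a.
Definition ip' a b : C := ip1 a b.
Definition ev1 a z : C := eval1 a z.

Lemma embE a i j : emb a i j = if j is 0 then a i else 0. Proof. by []. Qed.
Lemma embM a b : emb (a * b) = emb a * emb b.
Proof.
apply/funext => i; rewrite [RHS]fpsM /emb fpsM rmorph_sum.
by apply: eq_bigr => j _; rewrite rmorphM.
Qed.
Lemma embD a b : emb (a + b) = emb a + emb b.
Proof. by apply/funext => i; rewrite /emb fpsD rmorphD. Qed.
Lemma embB a b : emb (a - b) = emb a - emb b.
Proof. by apply/funext => i; rewrite /emb fpsB rmorphB. Qed.
Lemma embC (x : C) : emb (fpsC x) = csc x.
Proof. by apply/funext => -[|i]; rewrite /emb /csc //= rmorph0. Qed.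
Lemma emb_pol P : emb (pol1 P) = pol P%:P.
Proof.
apply: fps2_ext => i j; rewrite embE /pol coefC; case: j => [|j] //=.
by rewrite coef0.
Qed.
Lemma emb_inj a b : emb a = emb b -> a = b.
Proof. by move=> e; apply/funext => i; have := congr1 (fun F : fps2 => F i 0%N) e. Qed.
Lemma emb_XX i : emb (fpsX C ^+ i) = XX i 0.
Proof.
apply: fps2_ext => k l; rewrite embE XXE -[_ ^+ i]mulr1 fpsXnM fps1.
case: l => [|l]; last by rewrite andbF.
by rewrite andbT subn_eq0 eqn_leq andbC; case: leqP.
Qed.

Lemma sum_emb (V : nmodType) N (F : C -> V) a : F 0 = 0 ->
  \sum_(i < N) \sum_(j < N) F (emb a i j) = \sum_(i < N) F (a i).
Proof.
move=> F0; case: N => [|N]; first by rewrite !big_ord0.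
apply: eq_bigr => i _; rewrite big_ord_recl embE big1 ?addr0 //.
Qed.

Lemma h2E a : h2 a <-> H2 (emb a).
Proof.
have E N : \sum_(i < N) \sum_(j < N) sqmod (emb a i j) = \sum_(i < N) sqmod (a i).
  by apply: sum_emb; rewrite sqmodE nrm0 expr0n.
split=> [[M hM]|hE].
  by apply: (@H2_bounded _ _ M) => N; rewrite /nN E; exact: hM.
by exists (n2 (emb a)) => N; rewrite -E; exact: nN_le_n2.
Qed.

Lemma ip1E a b : ip' a b = ip (emb a) (emb b).
Proof.
change (ip1 a b = ip2 (emb a) (emb b)).
congr (clim _); apply/funext => N; case: N => [|N]; first by rewrite !big_ord0.
apply: eq_bigr => i _; rewrite big_ord_recl /= [X in _ = _ + X]big1 ?addr0 // => j _.
by rewrite mul0r.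
Qed.

Lemma ev1E a z w : ev1 a z = ev (emb a) z w.
Proof.
change (eval1 a z = eval2 (emb a) z w).
congr (clim _); apply/funext => N; case: N => [|N]; first by rewrite !big_ord0.
apply: eq_bigr => i _; rewrite big_ord_recl /= mulr1 [X in _ = _ + X]big1 ?addr0 // => j _.
by rewrite !mul0r.
Qed.

Lemma h2_D a b : h2 a -> h2 b -> h2 (a + b).
Proof. by move=> /h2E ha /h2E hb; apply/h2E; rewrite embD; exact: H2_D. Qed.
Lemma h2_B a b : h2 a -> h2 b -> h2 (a - b).
Proof. by move=> /h2E ha /h2E hb; apply/h2E; rewrite embB; exact: H2_B. Qed.
Lemma h2_Z (x : C) a : h2 a -> h2 (fpsC x * a).
Proof. by move=> /h2E ha; apply/h2E; rewrite embM embC; exact: H2_Z. Qed.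
Lemma h2_pol P a : h2 a -> h2 (pol1 P * a).
Proof. by move=> /h2E ha; apply/h2E; rewrite embM emb_pol; exact: H2_pol. Qed.
Lemma h2_pol1 P : h2 (pol1 P).
Proof. by apply/h2E; rewrite emb_pol; exact: H2_pol1. Qed.
Lemma h2_0 : h2 (0 : fsr).
Proof. have -> : (0 : fsr) = pol1 0 by rewrite rmorph0.
exact: h2_pol1. Qed.
Lemma h2_sum (I : Type) (s : seq I) (Pr : pred I) (F : I -> fsr) :
  (forall i, Pr i -> h2 (F i)) -> h2 (\sum_(i <- s | Pr i) F i).
Proof. by move=> h; elim/big_ind: _ => //; [exact: h2_0 | exact: h2_D]. Qed.

Lemma ev1B a b z : inD z -> h2 a -> h2 b -> ev1 (a - b) z = ev1 a z - ev1 b z.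
Proof.
move=> hz /h2E ha /h2E hb; rewrite !(ev1E _ _ 0) embB eval2B //; exact: inD0.
Qed.
Lemma ev1D a b z : inD z -> h2 a -> h2 b -> ev1 (a + b) z = ev1 a z + ev1 b z.
Proof.
move=> hz /h2E ha /h2E hb; rewrite !(ev1E _ _ 0) embD eval2D //; exact: inD0.
Qed.
Lemma ev1Z (x : C) a z : inD z -> h2 a -> ev1 (fpsC x * a) z = x * ev1 a z.
Proof.
move=> hz /h2E ha; rewrite !(ev1E _ _ 0) embM embC eval2Z //; exact: inD0.
Qed.
Lemma ev1_pol P a z : inD z -> h2 a -> ev1 (pol1 P * a) z = P.[z] * ev1 a z.
Proof.
move=> hz /h2E ha; rewrite !(ev1E _ _ 0) embM emb_pol ev_pol //; last exact: inD0.
by rewrite /peval hornerC.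
Qed.
Lemma ev1_pol1 P z : inD z -> ev1 (pol1 P) z = P.[z].
Proof.
move=> hz; rewrite (ev1E _ _ 0) emb_pol ev_pol1 //; last exact: inD0.
by rewrite /peval hornerC.
Qed.
Lemma ev1_0 z : inD z -> ev1 0 z = 0.
Proof.
move=> hz; have -> : (0 : fsr) = pol1 0 by rewrite rmorph0.
by rewrite ev1_pol1 // horner0.
Qed.
Lemma ev1_sum (I : Type) (s : seq I) (Pr : pred I) (F : I -> fsr) z :
  inD z -> (forall i, Pr i -> h2 (F i)) ->
  ev1 (\sum_(i <- s | Pr i) F i) z = \sum_(i <- s | Pr i) ev1 (F i) z.
Proof.
move=> hz hF; elim: s => [|i s IH]; first by rewrite !big_nil ev1_0.
by rewrite !big_cons; case: ifP => Pi //; rewrite ev1D ?IH //; [exact: hF|exact: h2_sum].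
Qed.
Lemma ev1_inj a b : h2 a -> h2 b -> (forall z, inD z -> ev1 a z = ev1 b z) -> a = b.
Proof.
move=> ha hb e; apply: emb_inj; apply: eval2_inj; [exact/h2E|exact/h2E|].
by move=> w1 w2 h1 _; rewrite -!ev1E e.
Qed.

Lemma ip1Zr (x : C) a b : h2 a -> h2 b -> ip' a (fpsC x * b) = x^* * ip' a b.
Proof. by move=> /h2E ha /h2E hb; rewrite !ip1E embM embC ip2Zr. Qed.
Lemma ip1Zl (x : C) a b : h2 a -> h2 b -> ip' (fpsC x * a) b = x * ip' a b.
Proof. by move=> /h2E ha /h2E hb; rewrite !ip1E embM embC ip2Zl. Qed.
Lemma ip1Br a b k : h2 a -> h2 b -> h2 k -> ip' k (a - b) = ip' k a - ip' k b.
Proof. by move=> /h2E ha /h2E hb /h2E hk; rewrite !ip1E embB ip2Br. Qed.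
Lemma emb_sum (I : Type) (s : seq I) (Pr : pred I) (F : I -> fsr) :
  emb (\sum_(i <- s | Pr i) F i) = \sum_(i <- s | Pr i) emb (F i).
Proof.
apply: (big_morph emb); first exact: embD.
by apply/funext => i; rewrite /emb rmorph0.
Qed.
Lemma ip1_sumr (I : Type) (s : seq I) (Pr : pred I) (F : I -> fsr) a :
  (forall i, Pr i -> h2 (F i)) -> h2 a ->
  ip' a (\sum_(i <- s | Pr i) F i) = \sum_(i <- s | Pr i) ip' a (F i).
Proof.
move=> hF /h2E ha; rewrite ip1E emb_sum ip2_sumr //; last by move=> i /hF/h2E.
by apply: eq_bigr => i _; rewrite ip1E.
Qed.
Lemma ip1_suml (I : Type) (s : seq I) (Pr : pred I) (F : I -> fsr) a :
  (forall i, Pr i -> h2 (F i)) -> h2 a ->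
  ip' (\sum_(i <- s | Pr i) F i) a = \sum_(i <- s | Pr i) ip' (F i) a.
Proof.
move=> hF /h2E ha; rewrite ip1E emb_sum ip2_suml //; last by move=> i /hF/h2E.
by apply: eq_bigr => i _; rewrite ip1E.
Qed.

Definition sz1 w : fsr := fun i => (w ^+ i)^*.
Lemma emb_sz1 w : emb (sz1 w) = sz w 0.
Proof.
apply: fps2_ext => i j; rewrite embE /sz /sz1 expr0n.
by case: j => [|j] /=; rewrite ?mulr1 ?mulr0 ?conjC0.
Qed.
Lemma h2_sz1 w : inD w -> h2 (sz1 w).
Proof. by move=> hw; apply/h2E; rewrite emb_sz1; apply: H2_sz => //; exact: inD0. Qed.
Lemma ip1_sz1 a w : ip' a (sz1 w) = ev1 a w.
Proof. by rewrite ip1E emb_sz1 (ev1E _ _ 0) eval2E. Qed.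
Lemma ev1_sz1 w z : inD w -> inD z -> (1 - z * w^*) * ev1 (sz1 w) z = 1.
Proof.
move=> hw hz; have h0 := inD0 R; have := ev_sz hw h0 hz h0.
by rewrite (ev1E _ _ 0) emb_sz1 mul0r subr0 mulr1.
Qed.

(* From |x|^2 |k_i|^2 <= (|k_(i-1)| + |h_i|)^2 <= |x| |k_(i-1)|^2 + |x|/(|x|-1) |h_i|^2,
   summed over i, where h = (z - x) k. *)
Lemma div_l2_1 (x : C) k : 1 < nrm x -> h2 (pol1 ('X - x%:P) * k) -> h2 k.
Proof.
move=> x1 [M hM]; set h := pol1 _ * k in hM; set y := nrm x in x1.
have y0 : 0 < y - 1 by rewrite subr_gt0.
exists (M / (y - 1) ^+ 2) => N.
rewrite ler_pdivlMr ?exprn_gt0 //.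
pose S := \sum_(i < N) sqmod (k i); rewrite -/S; pose H := \sum_(i < N) sqmod (h i).
have hH : H <= M by exact: hM.
pose kp (i : nat) := if i is i'.+1 then k i' else 0.
have term i : y ^+ 2 * (y - 1) * sqmod (k i) <= y * (y - 1) * sqmod (kp i) + y * sqmod (h i).
  have kE : x * k i = kp i - h i by rewrite /h pol1_XsubCM /kp opprB addrC subrK.
  have : y * nrm (k i) <= nrm (kp i) + nrm (h i).
    by rewrite -nrmM kE -[nrm (h i)]nrmN; exact: nrmD.
  rewrite !sqmodE; move: (nrm_ge0 (k i)) (nrm_ge0 (kp i)) (nrm_ge0 (h i)).
  move: (nrm (k i)) (nrm (kp i)) (nrm (h i)) => s t u s0 t0 u0 le.
  have le2 : (y * s) ^+ 2 <= (t + u) ^+ 2.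
    by rewrite ler_sqr ?nnegrE ?addr_ge0 // mulr_ge0 //; lra.
  have : (y - 1) * (y * s) ^+ 2 <= (y - 1) * (t + u) ^+ 2 by rewrite ler_pM2l.
  have := sqr_ge0 ((y - 1) * t - u); nra.
have sumle : y ^+ 2 * (y - 1) * S <= y * (y - 1) * S + y * H.
  apply: le_trans (_ : y * (y - 1) * (\sum_(i < N) sqmod (kp i)) + y * H <= _); last first.
    rewrite lerD2r ler_pM2l ?mulr_gt0 //; last by lra.
    rewrite /S; case: (N) => [|N']; first by rewrite !big_ord0.
    rewrite big_ord_recl /= sqmodE nrm0 expr0n add0r [leRHS]big_ord_recr /= lerDl.
    exact: sqmod_ge0.
  by rewrite /S /H !mulr_sumr -big_split; apply: ler_sum => i _; exact: term.
have : y * ((y - 1) ^+ 2 * S) <= y * H.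
  rewrite (_ : y * _ = y ^+ 2 * (y - 1) * S - y * (y - 1) * S); last by ring.
  by rewrite lerBlDl.
rewrite ler_pM2l; last by lra.
by move=> le; rewrite mulrC; exact: le_trans le hH.
Qed.

Lemma div_l2 P k : P != 0 -> (forall z, P.[z] = 0 -> 1 < nrm z) -> h2 (pol1 P * k) -> h2 k.
Proof.
move=> P0 hz; have [rs PE] := closed_field_poly_normal P.
have c0 : lead_coef P != 0 by rewrite lead_coef_eq0.
have hrs : {in rs, forall al, 1 < nrm al}.
  move=> al ha; apply: hz; rewrite PE hornerZ; apply/eqP; rewrite mulf_eq0.
  by apply/orP; right; have := root_prod_XsubC rs al; rewrite ha => /rootP ->.
rewrite PE; move: (lead_coef P) c0 => c c0; rewrite -mul_polyC rmorphM /= pol1C -mulrA => hk.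
have {hk} : h2 (pol1 (\prod_(al <- rs) ('X - al%:P)) * k).
  have := h2_Z c^-1 hk; rewrite mulrA -rmorphM /= mulVf // rmorph1 mul1r //.
elim: rs hrs {PE} k => [|al rs IH] hrs k; first by rewrite big_nil rmorph1 mul1r.
rewrite big_cons rmorphM /= -mulrA => /(div_l2_1 (hrs _ (mem_head _ _))).
by apply: IH => x hx; apply: hrs; rewrite in_cons hx orbT.
Qed.

(** Root by root: with t = (1 - |z|)/2 and |al| >= 1 one has |z - al| >= |al| - |z| >= t (1 + |al|)
    >= t |w - al|. The constant depends only on z and m, so the inequality survives a limit of
    polynomials. *)
Lemma zero_free_lower_bound P m z w : (size P <= m.+1)%N ->
  (forall x, inD x -> P.[x] != 0) -> inD z -> nrm w <= 1 ->
  ((1 - nrm z) / 2) ^+ m * nrm P.[w] <= nrm P.[z].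
Proof.
move=> szP hP hz hw; have [rs PE] := closed_field_poly_normal P.
have P0 : P != 0 by apply: contraTneq (hP 0 (inD0 R)) => ->; rewrite horner0 eqxx.
set c := lead_coef P in PE; have c0 : c != 0 by rewrite lead_coef_eq0.
have hrs : {in rs, forall al, 1 <= nrm al}.
  move=> al ha; rewrite leNgt -inDE; apply/negP => /hP; rewrite PE hornerZ.
  by have := root_prod_XsubC rs al; rewrite ha => /rootP ->; rewrite mulr0 eqxx.
have szr : (size rs <= m)%N.
  by move: szP; rewrite PE size_scale // size_prod_XsubC ltnS.
set t := (1 - nrm z) / 2.
have [z0 z1] : 0 <= nrm z /\ nrm z < 1 by rewrite nrm_ge0 -inDE.
have t0 : 0 <= t by rewrite /t; lra.
have t1 : t <= 1 by rewrite /t; lra.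
have ev x : nrm P.[x] = nrm c * \prod_(al <- rs) nrm (x - al).
  rewrite {1}PE hornerZ nrmM horner_prod nrm_prod; congr (_ * _).
  by apply: eq_bigr => al _; rewrite hornerXsubC.
rewrite !ev mulrCA; apply: ler_wpM2l; first exact: nrm_ge0.
apply: le_trans (_ : t ^+ size rs * \prod_(al <- rs) nrm (w - al) <= _).
  apply: ler_wpM2r; first by apply: prodr_ge0 => al _; exact: nrm_ge0.
  exact: ler_wiXn2l.
elim: (rs) hrs => [|al s IH] hrs; first by rewrite !big_nil mul1r.
rewrite !big_cons /= exprS mulrACA; apply: ler_pM.
- by apply: mulr_ge0 => //; exact: nrm_ge0.
- apply: mulr_ge0; first exact: exprn_ge0.
  by apply: prodr_ge0 => x _; exact: nrm_ge0.
- have ha : 1 <= nrm al by apply: hrs; rewrite mem_head.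
  have h1 : nrm al - nrm z <= nrm (z - al) by rewrite -[nrm (z - al)]nrmN opprB; exact: nrmB_ge.
  have h2 : nrm (w - al) <= 1 + nrm al.
    by apply: le_trans (nrmD _ _) _; rewrite nrmN lerD2r.
  apply: le_trans h1; apply: le_trans (_ : t * (1 + nrm al) <= _); first exact: ler_wpM2l.
  rewrite /t; nra.
by apply: IH => x hx; apply: hrs; rewrite in_cons hx orbT.
Qed.

(** Q(z) = t z^m conj P(1 / conj z) for z != 0, so each root al of P gives the zero 1 / conj al of
    Q, inside the disk. If P has degree below m, the missing zeros of Q sit at 0. *)
Lemma blaschke_refl P Q m (t : C) : onT t -> (size P <= m.+1)%N -> (size Q <= m.+1)%N ->
  (forall i, (i <= m)%N -> Q`_i = t * (P`_(m - i))^*) ->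
  (forall z, nrm z <= 1 -> P.[z] != 0) -> blaschke (fun z => Q.[z] / P.[z]) m.
Proof.
move=> ht szP szQ QE hP; have [rs PE] := closed_field_poly_normal P.
have P0 : P != 0 by apply: contraTneq (hP 0 _) => [->|]; rewrite ?horner0 ?eqxx // nrm0.
set c := lead_coef P in PE; have c0 : c != 0 by rewrite lead_coef_eq0.
have szP' : size P = (size rs).+1 by rewrite PE size_scale // size_prod_XsubC.
have szr : (size rs <= m)%N by rewrite -ltnS -szP'.
have hrs : {in rs, forall al, 1 < nrm al}.
  move=> al ha; rewrite ltNge; apply/negP => /hP; rewrite PE hornerZ.
  by have := root_prod_XsubC rs al; rewrite ha => /rootP ->; rewrite mulr0 eqxx.
have rs0 : {in rs, forall al, al != 0}.
  by move=> al /hrs h; rewrite -nrm_gt0; apply: lt_trans h.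
have Pz z : P.[z] = c * \prod_(al <- rs) (z - al).
  by rewrite {1}PE hornerZ horner_prod; congr (_ * _); apply: eq_bigr => al _; rewrite hornerXsubC.
have Qz z : Q.[z] = t * c^* * (z ^+ (m - size rs) * \prod_(al <- rs) (1 - al^* * z)).
  have [->|z0] := eqVneq z 0.
    rewrite horner_coef0 QE // subn0.
    have -> : \prod_(al <- rs) (1 - al^* * 0) = 1.
      by rewrite big1 // => al _; rewrite mulr0 subr0.
    rewrite mulr1 -mulrA; congr (_ * _); rewrite expr0n subn_eq0.
    case: leqP => h; last by rewrite mulr0 nth_default ?conjC0 // szP'.
    have -> : m = size rs by apply/eqP; rewrite eqn_leq h szr.
    by rewrite mulr1 /c /lead_coef szP'.
  have -> : Q.[z] = t * (z ^+ m * (P.[(z^*)^-1])^*).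
    rewrite (horner_coef_wide _ szQ) (horner_coef_wide _ szP) rmorph_sum mulr_sumr mulr_sumr.
    rewrite (reindex_inj rev_ord_inj); apply: eq_bigr => i _ /=.
    have him : (i <= m)%N by rewrite -ltnS.
    rewrite subSS QE ?leq_subr // subKn // rmorphM rmorphXn /= fmorphV /= conjCK -!mulrA.
    congr (_ * _); rewrite mulrCA; congr (_ * _).
    rewrite exprVn; have -> : z ^+ m = z ^+ (m - i) * z ^+ i by rewrite -exprD subnK.
    by rewrite mulfK // expf_neq0.
  rewrite Pz rmorphM /= rmorph_prod -mulrA; congr (_ * _); rewrite mulrCA; congr (_ * _).
  rewrite -{1}(subnK szr) exprD -mulrA; congr (_ * _).
  elim: (rs) => [|al s IH]; first by rewrite !big_nil mulr1.
  rewrite !big_cons /= exprS -IH rmorphB /= fmorphV /= conjCK.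
  have -> : z * z ^+ size s * ((z^-1 - al^*) * \prod_(i <- s) ((z^*)^-1 - i)^*) =
    z * (z^-1 - al^*) * (z ^+ size s * \prod_(i <- s) ((z^*)^-1 - i)^*) by ring.
  by rewrite mulrBr mulfV // [z * al^*]mulrC.
(* Past the end of [rs] the default 0 has inverse 0, which makes the remaining m - size rs Blaschke
   factors equal to z. *)
exists (t * (c^* / c) * \prod_(al <- rs) (al^* / al)), (fun l => ((nth 0 rs l)^*)^-1); split.
- have nt : nrm t = 1 by apply/eqP; rewrite -onTE.
  have : nrm (t * (c^* / c) * \prod_(al <- rs) (al^* / al)) = 1.
    rewrite !nrmM nrmV nrmJ nt mul1r mulfV ?nrm_eq0 // mul1r nrm_prod big_seq big1 // => al ha.
    by rewrite nrmM nrmV nrmJ mulfV // nrm_eq0 rs0.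
  by rewrite normE => ->.
- move=> l; rewrite inDE nrmV nrmJ; case: (ltnP l (size rs)) => hk.
    have h := hrs _ (mem_nth 0 hk); rewrite invf_lt1 //; exact: lt_trans h.
  by rewrite nth_default // nrm0 invr0.
move=> z hz; rewrite Pz Qz.
pose F (al : C) := (z - (al^*)^-1) / (1 - ((al^*)^-1)^* * z).
have -> : \prod_(l < m) ((z - ((nth 0 rs l)^*)^-1) / (1 - (((nth 0 rs l)^*)^-1)^* * z)) =
   (\prod_(al <- rs) F al) * z ^+ (m - size rs).
  rewrite -(big_mkord xpredT (fun l => F (nth 0 rs l))) (@big_cat_nat _ _ _ (size rs)) //=.
  rewrite [X in _ = X * _](big_nth 0); congr (_ * _).
  rewrite -prodr_const_nat; apply: eq_big_nat => l /andP[hk _].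
  by rewrite nth_default // /F conjC0 invr0 conjC0 mul0r !subr0 divr1.
have zn : nrm z < 1 by rewrite -inDE.
have FE : \prod_(al <- rs) F al = \prod_(al <- rs) (al / al^*) * (\prod_(al <- rs) (1 - al^* * z) / \prod_(al <- rs) (z - al)).
  rewrite -prodf_div -big_split /= big_seq [RHS]big_seq; apply: eq_bigr => al ha.
  have a0 := rs0 _ ha; have aJ0 : al^* != 0 by rewrite conjC_eq0.
  have za : z - al != 0.
    by rewrite subr_eq0; apply: contraTneq zn => ->; rewrite -leNgt ltW // hrs.
  rewrite /F fmorphV /= conjCK.
  have az : 1 - al^-1 * z != 0.
    by apply: contraNneq za => e; rewrite -oppr_eq0 opprB -[al - z]mul1r -(mulfV a0) -mulrA mulrBr mulVf // e mulr0.
  field; rewrite aJ0 za a0 /=; move: za; rewrite -oppr_eq0 opprB //.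
have aa : \prod_(al <- rs) (al^* / al) * \prod_(al <- rs) (al / al^*) = 1.
  rewrite -big_split /= big_seq big1 // => al ha.
  by have a0 := rs0 _ ha; field; rewrite conjC_eq0 a0.
have Pn : \prod_(al <- rs) (z - al) != 0.
  by have := hP z (ltW zn); rewrite Pz mulf_eq0 negb_or => /andP[].
rewrite FE; transitivity (t * (c^* / c) * (\prod_(al <- rs) (al^* / al) * \prod_(al <- rs) (al / al^*)) *
  (\prod_(al <- rs) (1 - al^* * z) / \prod_(al <- rs) (z - al)) * z ^+ (m - size rs)).
  by rewrite aa mulr1; field; rewrite c0 Pn.
ring.
Qed.

End OneVariable.

(** * Slices *)

#[local] Opaque h2 ip' ev1.

Section Slice.
Variable R : realType.
Local Notation C := (R[i]).
Local Notation fsr := (fps C).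
Local Notation fps2 := (fps (fps C)).
Local Notation XX := (XX R).
Local Notation rF := ((1 : R)^'- : set_system R).
Implicit Types (f g : fps2) (b h : fsr) (z w : C).

Lemma ctends_fev m n q z (tau : C) :
  ctends rF (fun r => fev m n q z (rc r * tau)) (fev m n q z tau).
Proof.
apply: ctends_sum => t _; apply: ctendsM; first exact: ctends_cst.
apply: ctendsM; first exact: ctends_cst.
apply: ctendsX; rewrite -[X in ctends _ _ X]mul1r.
by apply: ctendsM; [exact: radial_id|exact: ctends_cst].
Qed.

Lemma inD_radial (r : R) (tau : C) : onT tau -> 0 < r < 1 -> inD (rc r * tau).
Proof.
move=> ht /andP[r0 r1]; rewrite inDE nrmM nrm_rc ?(ltW r0) //.
by move: ht; rewrite onTE => /eqP ->; rewrite mulr1.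
Qed.

Variables (m n : nat) (p : {poly {poly C}}) (S1 S2 : set (coef2 R)).
Hypothesis hs : setup m n p S1 S2.
Variable tau : C.
Hypotheses (htau : onT tau) (hE : ~ (exists tau1, onT tau1 /\ peval p tau1 tau = 0)).

Let bd : bideg_le m n p. Proof. by case: hs => -[]. Qed.
Let nz : no_zeros_D2 p. Proof. by case: hs => -[]. Qed.

Let P : {poly C} := p.[tau%:P].
Let Q : {poly C} := (prefl m n p).[tau%:P].

Lemma slice_coef (q : {poly {poly C}}) i : (size q <= n.+1)%N ->
  (q.[tau%:P])`_i = \sum_(j < n.+1) pcoef q i j * tau ^+ j.
Proof.
move=> sq; rewrite (horner_coef_wide _ sq) coef_sum; apply: eq_bigr => j _.
by rewrite -polyC_exp coefMC.
Qed.

(** Because |tau| = 1, the z2-part of the reflection contributes just the factor tau^n. *)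
Lemma slice_refl_coef i : (i <= m)%N -> Q`_i = tau ^+ n * (P`_(m - i))^*.
Proof.
move=> im; rewrite slice_coef; last exact: size_poly.
rewrite slice_coef; last by case: bd.
rewrite rmorph_sum mulr_sumr (reindex_inj rev_ord_inj); apply: eq_bigr => j _ /=.
have jn : (j <= n)%N by rewrite -ltnS.
rewrite subSS /pcoef /prefl coef_poly ltnS leq_subr coef_poly ltnS im subKn // /pcoef.
rewrite rmorphM rmorphXn /= mulrCA; congr (_ * _).
have -> : tau ^+ n = tau ^+ (n - j) * tau ^+ j by rewrite -exprD subnK.
by rewrite -mulrA -exprMn onT_mulJ // expr1n mulr1.
Qed.

Lemma slice_sizeP : (size P <= m.+1)%N.
Proof.
apply/leq_sizeP => i hi; rewrite slice_coef; last by case: bd.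
rewrite big1 // => j _; case: bd => _ h2; rewrite /pcoef nth_default ?mul0r //.
exact: leq_trans (h2 j) hi.
Qed.

Lemma slice_sizeQ : (size Q <= m.+1)%N.
Proof.
apply/leq_sizeP => i hi; rewrite slice_coef; last exact: size_poly.
rewrite big1 // => j _; rewrite /pcoef /prefl coef_poly ltn_ord coef_poly.
by rewrite ltnNge hi mul0r.
Qed.

(** On the circle this is the choice of tau. Inside, a Hurwitz argument: the p(., r tau) have no
    zeros in the disk, so [zero_free_lower_bound] compares their values at z and at 1 uniformly in
    r, and P(1) != 0. *)
Lemma slice_nonzero z : nrm z <= 1 -> P.[z] != 0.
Proof.
rewrite le_eqVlt => /orP[z1|z1].
  by apply/eqP => E; apply: hE; exists z; rewrite onTE.
have onT1 : onT (1 : C) by rewrite onTE nrm1.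
have P1 : P.[1] != 0 by apply/eqP => E; apply: hE; exists 1.
apply/eqP => Pz.
pose k := ((1 - nrm z) / 2) ^+ m.
have k0 : 0 < k by rewrite exprn_gt0 // divr_gt0 // subr_gt0.
have cz : sqmod (peval p z (rc r * tau)) @[r --> rF] --> 0.
  have := ctends_fev m n (pcoef p) z tau; rewrite -(peval_fev _ _ bd).
  have -> : (fun r => fev m n (pcoef p) z (rc r * tau)) = fun r => peval p z (rc r * tau).
    by apply/funext => r; rewrite (peval_fev _ _ bd).
  have E : sqmod (peval p z tau) = 0 by rewrite [peval p z tau]Pz sqmodE nrm0 expr0n.
  by move=> /cvg_sqmod; rewrite E.
have c1 : k ^+ 2 * sqmod (peval p 1 (rc r * tau)) @[r --> rF] --> k ^+ 2 * sqmod P.[1].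
  apply: cvgM; first exact: cvg_cst.
  have := ctends_fev m n (pcoef p) 1 tau; rewrite -(peval_fev _ _ bd).
  have -> : (fun r => fev m n (pcoef p) 1 (rc r * tau)) = fun r => peval p 1 (rc r * tau).
    by apply/funext => r; rewrite (peval_fev _ _ bd).
  exact: cvg_sqmod.
have := ler_cvg_to c1 cz; rewrite leNgt => h.
have pos : 0 < k ^+ 2 * sqmod P.[1].
  apply: mulr_gt0; first exact: exprn_gt0.
  by rewrite sqmodE exprn_gt0 // nrm_gt0.
suff : k ^+ 2 * sqmod P.[1] <= 0 by rewrite leNgt pos.
rewrite leNgt; apply: h; near=> r.
have hr : inD (rc r * tau) by apply: inD_radial => //; near: r; exact: near01.
pose Pr := p.[(rc r * tau)%:P].
have szr : (size Pr <= m.+1)%N.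
  apply/leq_sizeP => i hi; rewrite /Pr horner_coef coef_sum big1 // => j _.
  rewrite -polyC_exp coefMC nth_default ?mul0r //.
  by case: bd => _ h2; exact: leq_trans (h2 j) hi.
have hPr x : inD x -> Pr.[x] != 0 by move=> hx; exact: nz hx hr.
have := @zero_free_lower_bound R Pr m z 1 szr hPr _ _.
rewrite inDE z1 nrm1 lexx => /(_ isT isT) le.
rewrite !sqmodE -exprMn ler_sqr ?nnegrE ?nrm_ge0 //.
by rewrite mulr_ge0 ?nrm_ge0 // ltW.
Unshelve. all: by end_near. Qed.

Lemma slice_blaschke : blaschke (fun z => Theta m n p z tau) m.
Proof.
apply: (@blaschke_refl R P Q m (tau ^+ n)).
- by move: htau; rewrite !onTE nrmX => /eqP ->; rewrite expr1n.
- exact: slice_sizeP.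
- exact: slice_sizeQ.
- exact: slice_refl_coef.
- exact: slice_nonzero.
Qed.

Lemma P0_neq0 : P`_0 != 0.
Proof. by rewrite -horner_coef0; apply: slice_nonzero; rewrite nrm0. Qed.
Lemma Pslice_neq0 : P != 0.
Proof. by apply: contraNneq P0_neq0 => ->; rewrite coef0. Qed.

Lemma div_slice b : h2 (pol1 P * b) -> h2 b.
Proof.
apply: div_l2; first exact: Pslice_neq0.
move=> z Pz; rewrite ltNge; apply/negP => /slice_nonzero.
by rewrite Pz eqxx.
Qed.

Lemma inD_le (z : C) : inD z -> nrm z <= 1. Proof. by rewrite inDE => /ltW. Qed.

(** P in the format of [fin] for the box m by 0, which makes [refl_adjoint] available in one
    variable. *)
Let qP : nat -> nat -> C := fun i _ => P`_i.

Lemma emb_P : emb (pol1 P) = fin m 0 qP.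
Proof.
apply: fps2_ext => i j; rewrite embE finE; case: j => [|j]; last by rewrite andbF.
rewrite andbT; case: leqP => // hi.
by rewrite /pol1 nth_default // (leq_trans slice_sizeP).
Qed.

Lemma emb_Q : emb (pol1 Q) = csc (tau ^+ n) * fin m 0 (refl m 0 qP).
Proof.
apply: fps2_ext => i j; rewrite embE cscM finE; case: j => [|j]; last by rewrite andbF mulr0.
rewrite andbT; case: leqP => hi; first by rewrite /pol1 slice_refl_coef.
by rewrite mulr0 /pol1 nth_default // (leq_trans slice_sizeQ).
Qed.

Lemma ip_Q b h : h2 b -> h2 h ->
  ip' b (pol1 Q * h) = (tau ^+ n)^* * (ip (XX m 0 * emb h) (emb (pol1 P * b)))^*.
Proof.
move=> /h2E hb /h2E hh.
have hF : H2 (fin m 0 (refl m 0 qP) * emb h) by exact: H2_fin.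
by rewrite ip1E embM emb_Q -mulrA ip2Zr // (ip2C hF hb) refl_adjoint // embM emb_P.
Qed.

Lemma model_degree b i : Kmodel1 (fun z => Theta m n p z tau) b -> (m <= i)%N ->
  (pol1 P * (b : fsr)) i = 0.
Proof.
move=> [hb kb] hi; have hX : h2 (fpsX C ^+ (i - m)).
  by apply/h2E; rewrite emb_XX; exact: H2_XX.
have E : ip' b (pol1 Q * fpsX C ^+ (i - m)) = 0.
  apply: (kb _ (pol1 P * fpsX C ^+ (i - m))); [exact: h2_pol|exact: h2_pol|].
  move=> z hz; change (ev1 (pol1 Q * fpsX C ^+ (i - m)) z =
    Theta m n p z tau * ev1 (pol1 P * fpsX C ^+ (i - m)) z).
  rewrite !ev1_pol // mulrA; congr (_ * _).
  by rewrite /Theta divfK //; apply: slice_nonzero; exact: inD_le.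
move: E; rewrite ip_Q // emb_XX XXD addn0 subnKC // ip_XXl; last first.
  by apply/h2E; exact: h2_pol.
rewrite conjCK embE => /eqP; rewrite mulf_eq0 conjC_eq0 expf_eq0.
by rewrite (negPf (onT_neq0 htau)) andbF => /eqP.
Qed.

Lemma model_orth b h : h2 b -> (forall i, (m <= i)%N -> (pol1 P * b) i = 0) -> h2 h ->
  ip' b (pol1 Q * h) = 0.
Proof.
move=> hb hd hh; rewrite ip_Q // [ip _ _](_ : _ = 0) ?conjC0 ?mulr0 //.
have h1 : H2 (emb (pol1 P * b)) by apply/h2E; exact: h2_pol.
apply: ip2_lim => //; first by apply: H2_XnM; exact/h2E.
have -> : (fun N => ipN N (XX m 0 * emb h) (emb (pol1 P * b))) = fun=> 0.
  apply/funext => N; rewrite /ipN big1 // => i _; rewrite big1 // => j _.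
  rewrite XXM [emb (pol1 P * b) i j]embE; case: (leqP m i) => hi; last by rewrite mul0r.
  by case: (nat_of_ord j) => [|j'] /=; rewrite ?(hd _ hi) conjC0 mulr0.
exact: ctends_cst.
Qed.

(** Converse of [model_degree]: the model space of the slice consists of the fractions q/P with deg
    q < m. *)
Lemma model_intro b : h2 b -> (forall i, (m <= i)%N -> (pol1 P * b) i = 0) ->
  Kmodel1 (fun z => Theta m n p z tau) b.
Proof.
move=> hb hd; split => // g h hg hh e; change (ip' b g = 0).
have {}hg : h2 g by []. have {}hh : h2 h by [].
have [u Pu] : exists u : fsr, pol1 P * u = 1.
  by apply: (@fps_inv_exists _ _ (P`_0)^-1); exact: (mulfV P0_neq0).
have Pg : pol1 P * (g : fsr) = pol1 Q * (h : fsr).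
  apply: ev1_inj; [exact: h2_pol|exact: h2_pol|] => z hz.
  rewrite !ev1_pol // [ev1 g z](e z hz) mulrA; congr (_ * _).
  by rewrite /Theta mulrCA divff ?mulr1 //; apply: slice_nonzero; exact: inD_le.
have gE : (g : fsr) = pol1 Q * (u * h).
  by rewrite mulrCA -Pg mulrA [u * _]mulrC Pu mul1r.
rewrite gE; apply: model_orth => //; apply: div_slice.
by rewrite mulrA Pu mul1r.
Qed.

Variable u : fsr.
Hypothesis Pu : pol1 P * u = 1.

(** The numerator p f at z2 = tau. Stopping at j = n loses nothing on the wandering subspace, by
    [W2_degree]; [restr] divides by P, and [restr_slice] identifies the result with the radial
    limit. *)
Definition num f : fsr := fun i => \sum_(j < n.+1) (pol p * f) i j * tau ^+ j.
Definition restr f : fsr := u * num f.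

Lemma P_restr f : pol1 P * restr f = num f.
Proof. by rewrite /restr mulrA Pu mul1r. Qed.

Lemma num_degree f i : wandering2 S2 f -> (m <= i)%N -> num f i = 0.
Proof.
by move=> wf hi; rewrite /num big1 // => j _; rewrite (W2_degree hs wf) ?hi ?mul0r.
Qed.

Lemma num_pol f : wandering2 S2 f -> num f = pol1 (\poly_(i < m.+1) num f i).
Proof.
move=> wf; apply/funext => i; rewrite /pol1 coef_poly; case: ltnP => // hi.
by apply: num_degree => //; exact: ltnW.
Qed.

Lemma h2_restr f : wandering2 S2 f -> h2 (restr f).
Proof. by move=> wf; apply: div_slice; rewrite P_restr num_pol //; exact: h2_pol1. Qed.

Lemma restr_ev f z : wandering2 S2 f -> inD z ->
  P.[z] * ev1 (restr f) z = fev m n (pol p * f) z tau.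
Proof.
move=> wf hz; rewrite -ev1_pol //; last exact: h2_restr.
rewrite P_restr num_pol // ev1_pol1 // horner_poly /fev.
rewrite -(pair_big xpredT xpredT (fun (i : 'I_m.+1) (j : 'I_n.+1) => (pol p * f) i j * (z ^+ i * tau ^+ j))) /=.
by apply: eq_bigr => i _; rewrite mulr_suml; apply: eq_bigr => j _; rewrite mulrAC mulrA.
Qed.

Lemma restr_slice f : wandering2 S2 f -> slice2 tau f (restr f).
Proof.
move=> wf; have hf := W2_H2 hs wf; split; first exact: (h2_restr wf).
move=> z hz; change (ctends rF (fun r => ev f z (rc r * tau)) (ev1 (restr f) z)).
have Pz : P.[z] != 0 by apply: slice_nonzero; exact: inD_le.
have -> : ev1 (restr f) z = fev m n (pol p * f) z tau * (fev m n (pcoef p) z tau)^-1.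
  rewrite -restr_ev // -(peval_fev _ _ bd) [peval _ _ _](_ : _ = P.[z]) //.
  by rewrite mulrAC divff ?mul1r.
apply: (@ctends_near _ _ _ _ (fun r => fev m n (pol p * f) z (rc r * tau) * (fev m n (pcoef p) z (rc r * tau))^-1)).
  near=> r; have hr : inD (rc r * tau) by apply: inD_radial => //; near: r; exact: near01.
  rewrite -(peval_fev _ _ bd) -(ev_finform hz hr hf (W2_fin hs wf)).
  by rewrite mulrAC divff ?mul1r // nz.
apply: ctendsM; first exact: ctends_fev.
apply: ctendsV; last exact: ctends_fev.
by rewrite -(peval_fev _ _ bd).
Unshelve. all: by end_near. Qed.

Lemma restr_model f : wandering2 S2 f -> Kmodel1 (fun z => Theta m n p z tau) (restr f).
Proof.
move=> wf; apply: model_intro; first exact: h2_restr.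
by move=> i hi; rewrite P_restr num_degree.
Qed.

Lemma slice_unique f b b' : slice2 tau f b -> slice2 tau f b' -> b = b'.
Proof.
move=> [hb lb] [hb' lb']; apply: ev1_inj => // z hz.
exact: (ctends_unique (lb z hz) (lb' z hz)).
Qed.

Lemma num_sum d (x : 'I_d -> C) (e : 'I_d -> fps2) :
  num (\sum_k csc (x k) * e k) = \sum_k fpsC (x k) * num (e k).
Proof.
apply/funext => i; rewrite fps_sum /num.
have E (j : nat) : (pol p * (\sum_k csc (x k) * e k)) i j = \sum_k x k * (pol p * e k) i j.
  by rewrite mulr_sumr fps2_sum; apply: eq_bigr => k _; rewrite mulrCA cscM.
under eq_bigr do rewrite E mulr_suml.
rewrite exchange_big; apply: eq_bigr => k _ /=; rewrite fpsCM mulr_sumr.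
by apply: eq_bigr => j _; rewrite mulrA.
Qed.

Lemma restr_sum d (x : 'I_d -> C) (e : 'I_d -> fps2) :
  restr (\sum_k csc (x k) * e k) = \sum_k fpsC (x k) * restr (e k).
Proof.
by rewrite /restr num_sum mulr_sumr; apply: eq_bigr => k _; rewrite mulrCA.
Qed.

(** * Slices of an orthonormal basis *)

Section Basis.
Variables (d : nat) (e : 'I_d -> fps2).
Hypotheses (oe : onb S2 e)
  (sp : forall f, wandering2 S2 f -> f = \sum_k csc (ip f (e k)) * e k).

Let we k : wandering2 S2 (e k). Proof. by case: oe. Qed.

(** [agler] holds inside the bidisk only; with z2 = w2 = r tau and r tending to 1, the factor 1 - |r
    tau|^2 removes the second sum. *)
Lemma agler_slice z w : inD z -> inD w ->
  P.[z] * (P.[w])^* - Q.[z] * (Q.[w])^* = (1 - z * w^*) *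
  \sum_k fev m n (pol p * e k) z tau * (fev m n (pol p * e k) w tau)^*.
Proof.
move=> hz hw; have [d' [e' A]] := agler hs oe sp.
have cp x : ctends rF (fun r => peval p x (rc r * tau)) (P.[x]).
  have := ctends_fev m n (pcoef p) x tau; rewrite -(peval_fev _ _ bd).
  by under eq_fun do rewrite -(peval_fev _ _ bd).
have cq x : ctends rF (fun r => peval (prefl m n p) x (rc r * tau)) (Q.[x]).
  have := ctends_fev m n (refl m n (pcoef p)) x tau; rewrite -peval_refl.
  by under eq_fun do rewrite -peval_refl.
have lhs : ctends rF (fun r => peval p z (rc r * tau) * (peval p w (rc r * tau))^* -
     peval (prefl m n p) z (rc r * tau) * (peval (prefl m n p) w (rc r * tau))^*)
   (P.[z] * (P.[w])^* - Q.[z] * (Q.[w])^*).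
  by apply: ctendsD; [|apply: ctendsN]; apply: ctendsM => //; exact: ctendsJ.
apply: (ctends_unique lhs).
have ct : ctends rF (fun r => rc r * tau) tau.
  rewrite -[X in ctends _ _ X]mul1r.
  by apply: ctendsM; [exact: radial_id|exact: ctends_cst].
have rhs : ctends rF (fun r => (1 - z * w^*) *
   (\sum_k fev m n (pol p * e k) z (rc r * tau) * (fev m n (pol p * e k) w (rc r * tau))^*)
   + (1 - (rc r * tau) * (rc r * tau)^*) *
    (\sum_l fev m n (pol p * e' l) z (rc r * tau) * (fev m n (pol p * e' l) w (rc r * tau))^*))
   ((1 - z * w^*) * (\sum_k fev m n (pol p * e k) z tau * (fev m n (pol p * e k) w tau)^*)
   + (1 - tau * tau^*) *
    (\sum_l fev m n (pol p * e' l) z tau * (fev m n (pol p * e' l) w tau)^*)).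
  apply: ctendsD; apply: ctendsM.
  - exact: ctends_cst.
  - by apply: ctends_sum => k _; apply: ctendsM; [|apply: ctendsJ]; exact: ctends_fev.
  - apply: ctendsD; first exact: ctends_cst.
    by apply: ctendsN; apply: ctendsM => //; exact: ctendsJ.
  - by apply: ctends_sum => k _; apply: ctendsM; [|apply: ctendsJ]; exact: ctends_fev.
move: rhs; rewrite onT_mulJ // subrr mul0r addr0; apply: ctends_near; near=> r.
have hr : inD (rc r * tau) by apply: inD_radial => //; near: r; exact: near01.
by rewrite A.
Unshelve. all: by end_near. Qed.

Lemma model_frame b : Kmodel1 (fun z => Theta m n p z tau) b ->
  (b : fsr) = \sum_k fpsC (ip' b (restr (e k))) * restr (e k).
Proof.
move=> kb; have hb : h2 b by case: kb.
have hr k : h2 (restr (e k)) by exact: h2_restr.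
have hsum (x : 'I_d -> C) : h2 (\sum_k fpsC (x k) * restr (e k)).
  by apply: h2_sum => k _; exact: h2_Z.
apply: ev1_inj => // w hw.
have Pw : P.[w] != 0 by apply: slice_nonzero; exact: inD_le.
(* By [agler_slice] this is the reproducing kernel at w of the model space; pairing b with it in two
   ways gives the frame expansion. *)
pose kap := \sum_k fpsC (ev1 (restr (e k)) w)^* * restr (e k).
have hsz := h2_sz1 hw.
have hus : h2 (u * sz1 w) by apply: div_slice; rewrite mulrA Pu mul1r.
pose T := Q.[w] / P.[w].
have hQ : h2 (pol1 Q * (u * sz1 w)) by exact: h2_pol.
have kapE : kap = sz1 w - fpsC T^* * (pol1 Q * (u * sz1 w)).
  apply: ev1_inj; [exact: hsum|by apply: h2_B => //; exact: h2_Z|].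
  move=> z hz; have Pz : P.[z] != 0 by apply: slice_nonzero; exact: inD_le.
  rewrite ev1B //; last exact: h2_Z.
  rewrite ev1Z // ev1_pol //.
  have eu : ev1 (u * sz1 w) z = ev1 (sz1 w) z / P.[z].
    apply: (mulfI Pz); rewrite -ev1_pol // mulrA Pu mul1r mulrCA divff ?mulr1 //.
  have e1 := ev1_sz1 hw hz.
  have D0 : 1 - z * w^* != 0.
    by apply/eqP => E; move: e1; rewrite E mul0r => /esym/eqP; rewrite oner_eq0.
  have es : ev1 (sz1 w) z = (1 - z * w^*)^-1.
    by apply: (mulfI D0); rewrite e1 mulfV.
  have PJ : (P.[w])^* != 0 by rewrite conjC_eq0.
  have ek : ev1 kap z = (\sum_k fev m n (pol p * e k) z tau * (fev m n (pol p * e k) w tau)^*)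
      / (P.[z] * (P.[w])^*).
    rewrite ev1_sum // => [|k _]; last exact: h2_Z.
    rewrite mulr_suml; apply: eq_bigr => k _; rewrite ev1Z // -!restr_ev // rmorphM /=.
    by field; rewrite Pz PJ.
  have es2 : \sum_k fev m n (pol p * e k) z tau * (fev m n (pol p * e k) w tau)^* =
     (P.[z] * (P.[w])^* - Q.[z] * (Q.[w])^*) / (1 - z * w^*).
    by rewrite agler_slice // mulrC mulKf.
  rewrite ek es2 eu es /T rmorphM /= fmorphV /=; field.
  by rewrite D0 Pz PJ.
have E1 : ip' b kap = ev1 b w.
  rewrite kapE ip1Br //; last exact: h2_Z.
  rewrite ip1Zr // ip1_sz1 model_orth ?mulr0 ?subr0 //.
  by move=> i hi; exact: model_degree.
rewrite -E1 ip1_sumr // => [|k _]; last exact: h2_Z.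
rewrite ev1_sum // => [|k _]; last exact: h2_Z.
by apply: eq_bigr => k _; rewrite ip1Zr // ev1Z // conjCK mulrC.
Qed.

Let A : 'M[C]_(d, m) := \matrix_(k, i) num (e k) i.

(** The functions z^i / P with i < m lie in the model space; expanding them in the frame and
    comparing numerators gives the rows of X. *)
Lemma frame_left_inverse : exists X : 'M[C]_(m, d), X *m A = 1%:M.
Proof.
pose b (i : 'I_m) : fsr := u * fpsX C ^+ i.
have Pb i : pol1 P * b i = fpsX C ^+ i by rewrite /b mulrA Pu mul1r.
have kb i : Kmodel1 (fun z => Theta m n p z tau) (b i).
  have hX : h2 (fpsX C ^+ i) by apply/h2E; rewrite emb_XX; exact: H2_XX.
  apply: model_intro; first by apply: div_slice; rewrite Pb.
  move=> j hj; rewrite Pb -[_ ^+ i]mulr1 fpsXnM fps1.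
  have ij : (i < j)%N by exact: leq_trans (ltn_ord i) hj.
  by rewrite (ltnW ij) subn_eq0 leqNgt ij.
exists (\matrix_(i, k) ip' (b i) (restr (e k))).
apply/matrixP => i j; rewrite !mxE.
have := congr1 (fun a : fsr => (pol1 P * a) j) (model_frame (kb i)).
rewrite Pb mulr_sumr fps_sum -[fpsX C ^+ i]mulr1 fpsXnM fps1 => E.
transitivity (\sum_k (pol1 P * (fpsC (ip' (b i) (restr (e k))) * restr (e k))) j).
  by apply: eq_bigr => k _; rewrite !mxE mulrCA P_restr fpsCM.
rewrite -E subn_eq0 -val_eqE /= eqn_leq andbC.
by case: (leqP i j) => _; rewrite ?andbT ?andbF.
Qed.

Lemma basis_size : (m <= d)%N.
Proof.
have [X XA] := frame_left_inverse.
by have := mulmx_max_rank X A; rewrite XA mxrank1.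
Qed.

(** Expanding the frame vectors in the frame itself gives G A = A for the Gram matrix G, and A is
    invertible when d = m. *)
Lemma restr_gram : d = m -> forall k l, ip' (restr (e k)) (restr (e l)) = (k == l)%:R.
Proof.
have [X] := frame_left_inverse.
have [G [GE GA]] : exists G : 'M[C]_d,
    (forall k l, G k l = ip' (restr (e k)) (restr (e l))) /\ G *m A = A.
  exists (\matrix_(k, l) ip' (restr (e k)) (restr (e l))).
  split=> [k l|]; first by rewrite mxE.
  apply/matrixP => k i; rewrite !mxE.
  have := congr1 (fun a : fsr => (pol1 P * a) i) (model_frame (restr_model (we k))).
  rewrite P_restr mulr_sumr fps_sum => ->.
  by apply: eq_bigr => l _; rewrite !mxE mulrCA P_restr fpsCM.
move=> XA dm k l; rewrite -GE.
suff -> : G = 1%:M by rewrite mxE.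
(* Generalizing [A] lets m be replaced by d; the left inverse of a square matrix is two-sided. *)
move: (A) X GA XA; rewrite -dm => A' X GA XA.
by rewrite -[G]mulmx1 -(mulmx1C XA) mulmxA GA.
Qed.

Lemma slice_unitary : d = m ->
  unitary_map (wandering2 S2) (Kmodel1 (fun z => Theta m n p z tau)) (slice2 tau).
Proof.
move=> dm; have gram := restr_gram dm.
have hr k : h2 (restr (e k)) by exact: h2_restr.
have he k : H2 (e k) by exact: W2_H2 hs _ (we k).
split.
- by move=> f wf; exists (restr f); split; [exact: restr_model|exact: restr_slice].
- by move=> f b b' _; exact: slice_unique.
- move=> f g bf bg wf wg jf jg; change (ip' bf bg = ip f g).
  rewrite (slice_unique jf (restr_slice wf)) (slice_unique jg (restr_slice wg)).
  have hg := W2_H2 hs wg.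
  have hsum : h2 (\sum_k fpsC (ip g (e k)) * restr (e k)).
    by apply: h2_sum => k _; exact: h2_Z.
  have hsum2 : H2 (\sum_k csc (ip g (e k)) * e k).
    by apply: H2_sum => k _; exact: H2_Z.
  have E f' (wh : wandering2 S2 f') : restr f' = \sum_k fpsC (ip f' (e k)) * restr (e k).
    by rewrite {1}(sp wh) restr_sum.
  have -> : ip f g = ip (\sum_k csc (ip f (e k)) * e k) (\sum_k csc (ip g (e k)) * e k).
    by rewrite -(sp wf) -(sp wg).
  rewrite (E _ wf) (E _ wg) ip1_suml // => [|k _]; last exact: h2_Z.
  rewrite ip2_suml // => [|k _]; last exact: H2_Z.
  apply: eq_bigr => k _; rewrite ip1Zl // ip2Zl //; congr (_ * _).
  rewrite ip1_sumr // => [|l _]; last exact: h2_Z.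
  rewrite ip2_sumr // => [|l _]; last exact: H2_Z.
  by apply: eq_bigr => l _; rewrite ip1Zr // ip2Zr // gram; case: oe => _ ->.
move=> b kb; exists (\sum_k csc (ip' b (restr (e k))) * e k).
have ws : wandering2 S2 (\sum_k csc (ip' b (restr (e k))) * e k : fps2).
  by apply: (W2_sum hs) => k _; apply: (W2_Z hs).
split => //; have := restr_slice ws; rewrite restr_sum.
by rewrite -(model_frame kb).
Qed.

End Basis.
End Slice.

(** * Regular slices and the dimension count *)

Section Assembly.
Variable R : realType.
Local Notation C := (R[i]).
Local Notation fps2 := (fps (fps C)).
Implicit Types (p : {poly {poly C}}) (S : set (coef2 R)).

Lemma circle_avoids_roots (r : {poly C}) : r != 0 -> exists tau, onT tau /\ r.[tau] != 0.
Proof.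
move=> r0; apply: contrapT => h.
(* Points of the circle with pairwise distinct real parts; [size r] of them are too many roots for
   r. *)
pose pt (k : nat) : C := Complex (k.+1%:R)^-1 (Num.sqrt (1 - (k.+1%:R)^-1 ^+ 2)).
have ptT k : onT (pt k).
  rewrite onTE /nrm /= sqr_sqrtr; first by rewrite addrC subrK sqrtr1.
  by rewrite subr_ge0 expr_le1 // ?invr_ge0 // invf_le1 // ler1n.
have root_pt : all (root r) (mkseq pt (size r)).
  apply/allP => z /mapP[k _ ->]; apply/negPn/negP => nr.
  by apply: h; exists (pt k).
have uq : uniq (mkseq pt (size r)).
  by apply: mkseq_uniq => i j [] /invr_inj/eqP; rewrite eqr_nat eqSS => /eqP.
by have := max_poly_roots r0 root_pt uq; rewrite size_mkseq ltnn.
Qed.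

(** A zero (t1, tau) of p on the torus is also one of the reflection, hence of the polynomial r(z2)
    in their ideal. It suffices to take tau off the roots of r. *)
Lemma nonsingular_slice_exists m n p S1 S2 : setup m n p S1 S2 ->
  exists tau : C, onT tau /\ ~ (exists tau1, onT tau1 /\ peval p tau1 tau = 0).
Proof.
move=> hs; have [[bd nz ncf] _ _ _] := hs.
have [u [v [r [r0 E]]]] := bezout_z2 (p_neq0 nz) ncf.
have [tau [ht rt]] := circle_avoids_roots r0; exists tau; split => // -[t1 [ht1 pt]].
have qt : peval (prefl m n p) t1 tau = tau ^+ n * t1 ^+ m * (peval p t1 tau)^*.
  rewrite /peval (horner_coef_wide _ (@slice_sizeQ R m n p tau)).
  rewrite (horner_coef_wide _ (slice_sizeP hs tau)) rmorph_sum mulr_sumr.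
  rewrite (reindex_inj rev_ord_inj) /=; apply: eq_bigr => i _.
  have im : (i <= m)%N by rewrite -ltnS.
  rewrite subSS (slice_refl_coef hs ht) ?leq_subr // subKn // rmorphM rmorphXn /=.
  have -> : t1 ^+ m = t1 ^+ (m - i) * t1 ^+ i by rewrite -exprD subnK.
  transitivity (tau ^+ n * (p.[tau%:P]`_i)^* * t1 ^+ (m - i) * (t1 ^+ i * t1^* ^+ i)).
    by rewrite -exprMn onT_mulJ // expr1n mulr1.
  ring.
have pM a b : peval (a * b) t1 tau = peval a t1 tau * peval b t1 tau.
  by rewrite /peval !hornerM.
have := congr1 (fun q => peval q t1 tau) E.
rewrite {1}/peval !hornerD -/(peval _ _ _) -/(peval _ _ _) !pM qt pt conjC0 !mulr0 addr0.
rewrite /peval (horner_map polyC) /= hornerC => r1.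
by move: rt; rewrite -r1 eqxx.
Qed.

Lemma half_theorem m n p S1 S2 : setup m n p S1 S2 ->
  (forall tau : C, onT tau -> ~ (exists tau1, onT tau1 /\ peval p tau1 tau = 0) ->
     blaschke (fun z => Theta m n p z tau) m /\
     unitary_map (wandering2 S2) (Kmodel1 (fun z => Theta m n p z tau)) (slice2 tau)) /\
  dim_eq (wandering2 S2) m.
Proof.
move=> hs; have [d [e [dm oe sp]]] := onb_exists hs.
have inv tau : onT tau -> ~ (exists tau1, onT tau1 /\ peval p tau1 tau = 0) ->
    exists u : fps C, pol1 p.[tau%:P] * u = 1.
  move=> ht hE; apply: (@fps_inv_exists _ _ (p.[tau%:P]`_0)^-1).
  exact: (mulfV (P0_neq0 hs ht hE)).
(* The basis was chosen before any tau, so a single regular tau fixes its size for all slices. *)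
have dE : d = m.
  have [tau [ht hE]] := nonsingular_slice_exists hs; have [u Pu] := inv tau ht hE.
  by apply/eqP; rewrite eqn_leq dm (basis_size hs ht hE Pu oe sp).
split=> [tau ht hE|].
  have [u Pu] := inv tau ht hE; split; first exact: (slice_blaschke hs ht hE).
  exact: (slice_unitary hs ht hE Pu oe sp dE).
have [we ee] := oe; have he k : H2 (e k) by exact: (W2_H2 hs (we k)).
have sumE (x : 'I_d -> C) :
    (fun i j => \sum_(k < d) x k * e k i j) = \sum_k csc (x k) * e k :> fps2.
  by apply: fps2_ext => i j; rewrite fps2_sum; apply: eq_bigr => k _; rewrite cscM.
rewrite -dE; exists e; split => //.
  move=> x; rewrite sumE => E k.
  have := congr1 (fun f : fps2 => ip f (e k)) E.
  rewrite [RHS]ip2_0l // ip2_suml // => [|l _]; last exact: H2_Z.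
  under eq_bigr => l _ do rewrite ip2Zl // ee.
  rewrite (bigD1 k) //= eqxx mulr1 big1 ?addr0 // => l /negPf ->.
  by rewrite mulr0.
by move=> f wf; exists (fun k => ip f (e k)); rewrite sumE; exact: sp.
Qed.

Lemma unitary_swap S (K : set (Defs.coef1 R)) (tau : C) :
  unitary_map (wandering2 (trS S)) K (slice2 tau) ->
  unitary_map (wandering1 S) K (slice1 tau).
Proof.
have sl f b : slice1 tau f b <-> slice2 tau (tr f) b.
  have E (z : C) : (fun r : R => eval2 (tr f) z (Complex r 0 * tau)) =
      (fun r => eval2 f (Complex r 0 * tau) z).
    by apply/funext => r; exact: (@eval2_tr R f).
  split=> -[hb h]; (split; first exact: hb) => z hz; first by rewrite E; exact: h.
  by rewrite -E; exact: h.
move=> [h1 h2 h3 h4]; split.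
- move=> f wf; have [b [kb jb]] := h1 _ (W1_swap wf).
  by exists b; split; [exact: kb|exact: (proj2 (sl f b) jb)].
- move=> f b b' wf jb jb'.
  exact: (h2 _ _ _ (W1_swap wf) (proj1 (sl f b) jb) (proj1 (sl f b') jb')).
- move=> f g bf bg wf wg jf jg.
  have := h3 _ _ _ _ (W1_swap wf) (W1_swap wg) (proj1 (sl f bf) jf) (proj1 (sl g bg) jg).
  by move=> ->; exact: (@ip2_tr R f g).
move=> b kb; have [f [wf jf]] := h4 b kb; exists (tr f).
by split; [exact: wandering_swap wf|exact: (proj2 (sl (tr f) b) jf)].
Qed.

Lemma dim_swap S d : dim_eq (wandering2 (trS S)) d -> dim_eq (wandering1 S) d.
Proof.
move=> [e [we ind sp]]; exists (fun k => tr (e k)); split.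
- by move=> k; exact: wandering_swap.
- move=> x E; apply: ind; apply: fps2_ext => i j.
  by have := congr1 (fun f : fps2 => f j i) E.
move=> f /W1_swap/sp[x E]; exists x; apply: fps2_ext => i j.
by have := congr1 (fun f : fps2 => f j i) E.
Qed.

End Assembly.

Theorem theorem2p2 (R : realType) (m n : nat) (p : {poly {poly R[i]}})
    (S1 S2 : set (coef2 R)) :
  bideg_le m n p ->
  no_zeros_D2 p ->
  no_common_factor p (prefl m n p) ->
  closed_subspace2 S1 -> closed_subspace2 S2 ->
  (forall f, S1 f -> S1 (shift1 f)) ->
  (forall f, S2 f -> S2 (shift2 f)) ->
  orth_decomp (KTheta m n p) S1 S2 ->
  [/\ (forall tau : R[i], onT tau -> ~ (exists tau1, onT tau1 /\ peval p tau1 tau = 0) ->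
         blaschke (fun z => Theta m n p z tau) m /\
         unitary_map (wandering2 S2) (Kmodel1 (fun z => Theta m n p z tau)) (slice2 tau)),
      dim_eq (wandering2 S2) m,
      (forall tau : R[i], onT tau -> ~ (exists tau2, onT tau2 /\ peval p tau tau2 = 0) ->
         blaschke (fun z => Theta m n p tau z) n /\
         unitary_map (wandering1 S1) (Kmodel1 (fun z => Theta m n p tau z)) (slice1 tau)) &
      dim_eq (wandering1 S1) n].
Proof.
move=> bd nz ncf c1 c2 s1 s2 dc.
have hs : setup m n p S1 S2 by [].
have [h2 d2] := half_theorem hs.
have [h1 d1] := half_theorem (setup_swap hs).
split => //; last exact: dim_swap.
move=> tau ht hE.
have [|b1 u1] := h1 tau ht.
  by move=> [t [ht1 pt]]; apply: hE; exists t; rewrite -peval_swap.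
have E : (fun z => Theta n m (swapXY p) z tau) = (fun z => Theta m n p tau z).
  by apply/funext => z; exact: Theta_swap.
by rewrite -E; split; [exact: b1|exact: unitary_swap u1].
Qed.
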